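(* Let $\kappa$ be a measurable cardinal, and let $\langle\mu_i : i<\kappa\rangle$ be a sequence of measurable cardinals above $\kappa$. Then for every infinite cardinal $\nu$, there is a collection of $\nu$-many distinct, pairwise mutually embeddable, well-founded models, each having the same theory as $V$.
   Context: Two models $M,N$ are mutually embeddable if there exist elementary embeddings $M\to N$ and $N\to M$. *)

(* Defs.v *)
Record set_structure : Type := SetStructure {
  carrier :> Type;
  mem : carrier -> carrier -> Prop
}.
Arguments mem {s} x y.

Declare Scope zf_scope.
Notation "x ∈ y" := (mem x y) (at level 70, no associativity) : zf_scope.
Open Scope zf_scope.

(* First-order formulas in the language {=, ∈}, with de Bruijn indices: variable 0
   under [All] is the bound one. *)
Inductive formula : Type :=
| Mem (i j : nat)
| Eq (i j : nat)
| Bot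
| Imp (p q : formula)
| All (p : formula).

Fixpoint free_below (n : nat) (p : formula) : Prop :=
  match p with
  | Mem i j | Eq i j => i < n /\ j < n
  | Bot => True
  | Imp p q => free_below n p /\ free_below n q
  | All p => free_below (S n) p
  end.

Definition sentence (p : formula) : Prop := free_below 0 p.

Definition scons {A : Type} (x : A) (e : nat -> A) (n : nat) : A :=
  match n with 0 => x | S m => e m end.

(* Satisfaction in the structure (M, ∈); assignments are meant to take values in M. *)
Fixpoint sat {V : set_structure} (M : V -> Prop) (e : nat -> V) (p : formula) : Prop :=
  match p with
  | Mem i j => e i ∈ e j
  | Eq i j => e i = e j
  | Bot => False
  | Imp p q => sat M e p -> sat M e q
  | All p => forall x, M x -> sat M (scons x e) p
  end.

Definition universe {V : set_structure} : V -> Prop := fun _ => True.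

(* Definability is always over V, with parameters (the tail [e] of the assignment). *)
Definition definable {V : set_structure} (P : V -> Prop) : Prop :=
  exists (p : formula) (e : nat -> V), forall x, P x <-> sat universe (scons x e) p.

Definition definable2 {V : set_structure} (R : V -> V -> Prop) : Prop :=
  exists (p : formula) (e : nat -> V),
    forall x y, R x y <-> sat universe (scons x (scons y e)) p.

Definition empty {V : set_structure} (x : V) : Prop := forall y, ~ y ∈ x.

Definition subset {V : set_structure} (x y : V) : Prop := forall z, z ∈ x -> z ∈ y.

(* z = {x, y} *)
Definition upair {V : set_structure} (x y z : V) : Prop :=
  forall w, w ∈ z <-> w = x \/ w = y.

(* z = x ∪ {x} *)
Definition successor {V : set_structure} (x z : V) : Prop :=
  forall w, w ∈ z <-> w ∈ x \/ w = x.

(* Separation and Replacement are the first-order schemas, for formulas with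
   parameters; the other axioms are single sentences evaluated in V. *)
Record ZFC (V : set_structure) : Prop := {
  zf_extensionality : forall x y : V, (forall z, z ∈ x <-> z ∈ y) -> x = y;
  zf_foundation : forall x : V,
    (exists y, y ∈ x) -> exists y, y ∈ x /\ forall z, z ∈ x -> ~ z ∈ y;
  zf_pairing : forall x y : V, exists z, upair x y z;
  zf_union : forall x : V, exists u, forall z, z ∈ u <-> exists y, y ∈ x /\ z ∈ y;
  zf_powerset : forall x : V, exists p, forall z, z ∈ p <-> subset z x;
  zf_infinity : exists w : V,
    (exists x, empty x /\ x ∈ w) /\
    (forall x, x ∈ w -> exists y, successor x y /\ y ∈ w);
  zf_separation : forall P : V -> Prop, definable P ->
    forall a, exists b, forall x, x ∈ b <-> x ∈ a /\ P x;
  zf_replacement : forall R : V -> V -> Prop, definable2 R ->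
    forall a, (forall x, x ∈ a -> exists! y, R x y) ->
    exists b, forall y, y ∈ b <-> exists x, x ∈ a /\ R x y;
  zf_choice : forall a : V,
    (forall x, x ∈ a -> exists y, y ∈ x) ->
    (forall x y z, x ∈ a -> y ∈ a -> z ∈ x -> z ∈ y -> x = y) ->
    exists c, forall x, x ∈ a -> exists! y, y ∈ x /\ y ∈ c
}.

(* z = (x, y), the Kuratowski pair {{x}, {x, y}} *)
Definition opair {V : set_structure} (x y z : V) : Prop :=
  forall w, w ∈ z <-> upair x x w \/ upair x y w.

(* (x, y) ∈ f *)
Definition app {V : set_structure} (f x y : V) : Prop :=
  exists p, opair x y p /\ p ∈ f.

Definition function_on {V : set_structure} (f a : V) : Prop :=
  (forall p, p ∈ f -> exists x y, x ∈ a /\ opair x y p) /\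
  (forall x, x ∈ a -> exists! y, app f x y).

Definition maps_into {V : set_structure} (f b : V) : Prop :=
  forall x y, app f x y -> y ∈ b.

Definition injective {V : set_structure} (f : V) : Prop :=
  forall x x' y, app f x y -> app f x' y -> x = x'.

Definition bijection {V : set_structure} (f a b : V) : Prop :=
  function_on f a /\ maps_into f b /\ injective f /\
  (forall y, y ∈ b -> exists x, app f x y).

Definition transitive_set {V : set_structure} (x : V) : Prop :=
  forall y, y ∈ x -> subset y x.

(* In the presence of Foundation this is the usual notion of von Neumann ordinal. *)
Definition ordinal {V : set_structure} (x : V) : Prop :=
  transitive_set x /\ forall y, y ∈ x -> transitive_set y.

Definition zero_or_successor {V : set_structure} (x : V) : Prop :=
  empty x \/ exists y, successor y x.

Definition natural_number {V : set_structure} (n : V) : Prop :=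
  ordinal n /\ zero_or_successor n /\ forall m, m ∈ n -> zero_or_successor m.

Definition cardinal {V : set_structure} (k : V) : Prop :=
  ordinal k /\ forall a, a ∈ k -> ~ exists f, bijection f a k.

Definition infinite_cardinal {V : set_structure} (k : V) : Prop :=
  cardinal k /\ ~ natural_number k.

(* A cardinal k is uncountable iff it has an infinite ordinal as an element. *)
Definition uncountable_cardinal {V : set_structure} (k : V) : Prop :=
  cardinal k /\ exists w, w ∈ k /\ ~ natural_number w.

Definition ultrafilter {V : set_structure} (U k : V) : Prop :=
  (forall x, x ∈ U -> subset x k) /\
  k ∈ U /\
  (forall x, x ∈ U -> ~ empty x) /\
  (forall x y, x ∈ U -> subset x y -> subset y k -> y ∈ U) /\
  (forall x y z, x ∈ U -> y ∈ U -> (forall w, w ∈ z <-> w ∈ x /\ w ∈ y) -> z ∈ U) /\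
  (forall x y, subset x k -> (forall w, w ∈ y <-> w ∈ k /\ ~ w ∈ x) -> x ∈ U \/ y ∈ U).

Definition nonprincipal {V : set_structure} (U k : V) : Prop :=
  forall x s, x ∈ k -> upair x x s -> ~ s ∈ U.

(* Closure under intersections of sequences of length l < k of members of U. *)
Definition complete {V : set_structure} (U k : V) : Prop :=
  forall l f z, l ∈ k -> function_on f l -> maps_into f U ->
    (forall w, w ∈ z <-> w ∈ k /\ forall i x, app f i x -> w ∈ x) -> z ∈ U.

Definition measurable {V : set_structure} (k : V) : Prop :=
  uncountable_cardinal k /\
  exists U, ultrafilter U k /\ nonprincipal U k /\ complete U k.

Definition transitive_class {V : set_structure} (M : V -> Prop) : Prop :=
  forall x y, M x -> y ∈ x -> M y.

(* Well-foundedness of (M, ∈) in the sense of V; V itself need not be well-founded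
   from outside. *)
Definition well_founded_class {V : set_structure} (M : V -> Prop) : Prop :=
  forall a : V, (exists x, x ∈ a /\ M x) ->
    exists x, x ∈ a /\ M x /\ forall y, y ∈ a -> M y -> ~ y ∈ x.

Definition same_theory {V : set_structure} (M N : V -> Prop) : Prop :=
  forall p, sentence p -> forall e e', sat M e p <-> sat N e' p.

(* An elementary embedding of (M, ∈) into (N, ∈) that is a class of V; the values of f
   outside M are irrelevant. *)
Definition elementary_embedding {V : set_structure} (M N : V -> Prop) (f : V -> V) : Prop :=
  definable2 (fun x y => M x /\ y = f x) /\
  (forall x, M x -> N (f x)) /\
  (forall p e, (forall n, M (e n)) -> (sat M e p <-> sat N (fun n => f (e n)) p)).

Definition mutually_embeddable {V : set_structure} (M N : V -> Prop) : Prop :=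
  (exists f, elementary_embedding M N f) /\ (exists g, elementary_embedding N M g).

(* Main.v *)
(* The models are limit ultrapowers of V. Fix measures W_a on mu_a and U on kappa, let Z be
   the disjoint union of the mu_a for a < kappa, and let D be the U-average of the W_a. On
   the sequences x in Z^nu let E be the filter generated by iterating D along nu; it decides
   every set depending on finitely many coordinates. The i-th model collapses the functions
   on Z^nu that depend on finitely many coordinates, of which the i-th coordinate x_i is seen
   only through its projection to kappa. Such a model is well-founded because E is countably
   complete, and it has the theory of V by Los's theorem. Precomposing with the
   order-preserving map of nu into nu that skips j embeds the i-th model into the j-th one.

   For distinctness, let R collapse the functions for which both x_i and x_j are seen only
   through their projections a_i and a_j. By Fubini the i-th model is Ult(R, W_{a_j}) and the
   j-th one is Ult(R, W_{a_i}), so it suffices that Ult(V, W_a) and Ult(V, W_b) differ for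
   a <> b. If they were equal then the two ultrapower embeddings would agree on the ordinals,
   since a least ordinal of disagreement is definable without parameters; but their critical
   points mu_a and mu_b are different. *)

(* The obstacle is that coordinates of the iteration cannot be interchanged: [D] does not commute
   with itself, since for almost every later coordinate the projection is larger than that of an
   earlier one. So a whole coordinate cannot be moved to the end, which is what it would take to see
   one model as an ultrapower of another. Its fibre part can. Once the projection [a] of x_i is
   known, the point of mu_a is drawn from W_a; this draw commutes with U because kappa < mu_a, and
   with W_b for b <> a because measures on cardinals of different size commute. Later coordinates
   have a projection other than [a] almost everywhere. Hence the two-stage measure [D], the
   distinctness of the mu_i, and models that forget only the fibre part of a coordinate.

   A second constraint is that V is an arbitrary first-order model of ZFC, possibly ill-founded from
   outside. Induction, recursion and selection inside V are available only for definable predicates,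
   so every predicate used carries a definability proof. *)
From Stdlib Require Import ClassicalEpsilon FunctionalExtensionality Arith Lia.
Require Import Defs.

(** * Definability *)

Existing Class ZFC.

Section Definability.
Context {V : set_structure}.

Fixpoint rename (f : nat -> nat) (p : formula) : formula :=
  match p with
  | Mem i j => Mem (f i) (f j)
  | Eq i j => Eq (f i) (f j)
  | Bot => Bot
  | Imp p q => Imp (rename f p) (rename f q)
  | All p => All (rename (fun n => match n with 0 => 0 | S m => S (f m) end) p)
  end.

Lemma sat_rename (M : V -> Prop) p : forall f e,
  sat M e (rename f p) <-> sat M (fun n => e (f n)) p.
Proof.
  induction p; intros f e; simpl; try tauto.
  - rewrite IHp1, IHp2; tauto.
  - split; intros H x Hx; specialize (H x Hx); rewrite ?IHp in *;
    match goal with H : sat _ ?a _ |- sat _ ?b _ => replace b with a; [exact H|] end;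
    apply functional_extensionality; intros [|n]; reflexivity.
Qed.

Lemma sat_local (M : V -> Prop) p : forall n e e',
  free_below n p -> (forall k, k < n -> e k = e' k) -> sat M e p <-> sat M e' p.
Proof.
  induction p; intros n e e' Hf He; simpl in *; try tauto.
  - destruct Hf as [Hi Hj]. rewrite (He _ Hi), (He _ Hj). tauto.
  - destruct Hf as [Hi Hj]. rewrite (He _ Hi), (He _ Hj). tauto.
  - destruct Hf. rewrite (IHp1 n e e'), (IHp2 n e e'); tauto.
  - assert (forall x, sat M (scons x e) p <-> sat M (scons x e') p) as H.
    { intros x. apply (IHp (S n)); auto. intros [|k] Hk; simpl; auto. apply He; lia. }
    split; intros G x Hx; apply H; auto.
Qed.

Lemma free_below_mono p : forall n m, n <= m -> free_below n p -> free_below m p.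
Proof.
  induction p; intros n m Hnm; simpl; intuition eauto; try lia.
  eapply IHp; [|eassumption]. lia.
Qed.

Lemma free_below_exists p : exists n, free_below n p.
Proof.
  induction p; simpl.
  - exists (S (i + j)); lia.
  - exists (S (i + j)); lia.
  - now exists 0.
  - destruct IHp1 as [n Hn], IHp2 as [m Hm]. exists (n + m).
    split; eapply free_below_mono; try eassumption; lia.
  - destruct IHp as [n Hn]. exists n. eapply free_below_mono; [|eassumption]; lia.
Qed.

Definition lookup (r : nat -> nat + V) (e : nat -> V) (n : nat) : V :=
  match r n with inl k => e k | inr c => c end.

(* A predicate of assignments is definable when some formula defines it after sending each
   of its variables either to a position of the assignment or, if [b] is true, to a
   constant; [dfn false] is definability without parameters. *)
Definition dfn (b : bool) (P : (nat -> V) -> Prop) : Prop :=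
  exists p r, (b = false -> forall n c, r n <> inr c) /\
    forall e, P e <-> sat universe (lookup r e) p.

Definition dft (b : bool) (t : (nat -> V) -> V) : Prop :=
  dfn b (fun e => e 0 = t (fun n => e (S n))).

Lemma dfn_iff b P Q : (forall e, P e <-> Q e) -> dfn b P -> dfn b Q.
Proof.
  intros H (p & r & Hr & Hp). exists p, r. split; auto.
  intros e. rewrite <- H. apply Hp.
Qed.

Lemma dfn_ren b P f : dfn b P -> dfn b (fun e => P (fun n => e (f n))).
Proof.
  intros (p & r & Hr & Hp).
  exists p, (fun n => match r n with inl k => inl (f k) | inr c => inr c end). split.
  - intros Hb n c. specialize (Hr Hb n). destruct (r n); congruence.
  - intros e. rewrite Hp. replace (lookup r (fun n => e (f n))) with
      (lookup (fun n => match r n with inl k => inl (f k) | inr c => inr c end) e); [tauto|].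
    apply functional_extensionality; intros n. unfold lookup. now destruct (r n).
Qed.

Lemma dft_ren b t f : dft b t -> dft b (fun e => t (fun n => e (f n))).
Proof.
  intros H. exact (dfn_ren b _ (fun n => match n with 0 => 0 | S m => S (f m) end) H).
Qed.

Lemma dfn_false b : dfn b (fun _ => False).
Proof. exists Bot, inl. split; [congruence|]. simpl; tauto. Qed.

Lemma dfn_imp b P Q : dfn b P -> dfn b Q -> dfn b (fun e => P e -> Q e).
Proof.
  intros (p & r & Hr & Hp) (q & s & Hs & Hq).
  (* The two formulas come with unrelated lookups. Moving their variables to even and odd indices
     lets a single lookup serve both. *)
  exists (Imp (rename (fun n => 2 * n) p) (rename (fun n => S (2 * n)) q)),
    (fun n => if Nat.even n then r (Nat.div2 n) else s (Nat.div2 n)). split.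
  - intros Hb n c. destruct (Nat.even n); auto.
  - intros e. cbn [sat]. rewrite !sat_rename, Hp, Hq.
    match goal with |- _ <-> (sat _ ?a _ -> sat _ ?b _) =>
      replace a with (lookup r e); [replace b with (lookup s e); [tauto|]|] end;
    apply functional_extensionality; intros n; unfold lookup.
    + rewrite Nat.even_succ, <- Nat.negb_even, Nat.even_mul. simpl negb. cbv iota.
      rewrite Nat.div2_succ_double. reflexivity.
    + rewrite Nat.even_mul. cbn [Nat.even orb]. cbv iota. rewrite Nat.div2_double. reflexivity.
Qed.

Lemma dfn_all b (P : (nat -> V) -> V -> Prop) :
  dfn b (fun e => P (fun n => e (S n)) (e 0)) -> dfn b (fun e => forall x, P e x).
Proof.
  intros (p & r & Hr & Hp).
  (* Exactly the variables that the lookup sends to position 0 become the bound one; the others are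
     shifted past it. The new lookup returns [inl 0] only as a filler at indices that the renamed
     formula never reads. *)
  exists (All (rename (fun n => match r n with inl 0 => 0 | _ => S n end) p)),
    (fun n => match r n with inl (S k) => inl k | inl 0 => inl 0 | inr c => inr c end). split.
  - intros Hb n c. specialize (Hr Hb n). destruct (r n) as [[|]|]; congruence.
  - intros e. cbn [sat].
    assert (forall x, P e x <-> sat universe (lookup r (scons x e)) p) as H.
    { intros x. rewrite <- Hp. simpl. tauto. }
    assert (forall x, (fun n => scons x (lookup (fun n => match r n with inl (S k) => inl k
        | inl 0 => inl 0 | inr c => inr c end) e) (match r n with inl 0 => 0 | _ => S n end))
        = lookup r (scons x e)) as G.
    { intros x. apply functional_extensionality; intros n. unfold lookup.
      destruct (r n) as [[|k]|c] eqn:E; simpl; rewrite ?E; reflexivity. }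
    split.
    + intros K x _. rewrite sat_rename, G. apply H, K.
    + intros K x. apply H. rewrite <- G, <- sat_rename. apply K. exact I.
Qed.

Lemma dfn_not b P : dfn b P -> dfn b (fun e => ~ P e).
Proof. intros H. apply dfn_imp; [exact H | apply dfn_false]. Qed.

Lemma dfn_and b P Q : dfn b P -> dfn b Q -> dfn b (fun e => P e /\ Q e).
Proof.
  intros HP HQ. eapply dfn_iff; [|exact (dfn_not _ _ (dfn_imp _ _ _ HP (dfn_not _ _ HQ)))].
  intros e. simpl. tauto.
Qed.

Lemma dfn_or b P Q : dfn b P -> dfn b Q -> dfn b (fun e => P e \/ Q e).
Proof.
  intros HP HQ. eapply dfn_iff; [|exact (dfn_imp _ _ _ (dfn_not _ _ HP) HQ)].
  intros e. simpl. tauto.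
Qed.

Lemma dfn_equiv b P Q : dfn b P -> dfn b Q -> dfn b (fun e => P e <-> Q e).
Proof. intros HP HQ. apply dfn_and; apply dfn_imp; assumption. Qed.

Lemma dfn_ex b (P : (nat -> V) -> V -> Prop) :
  dfn b (fun e => P (fun n => e (S n)) (e 0)) -> dfn b (fun e => exists x, P e x).
Proof.
  intros H. eapply dfn_iff;
    [|exact (dfn_not _ _ (dfn_all b (fun e x => ~ P e x) (dfn_not _ _ H)))].
  intros e. simpl. split.
  - intros K. apply NNPP. intros N. apply K. intros x Hx. apply N. now exists x.
  - intros [x Hx] K. exact (K x Hx).
Qed.

Lemma dfn_var_eq b i j : dfn b (fun e => e i = e j).
Proof.
  exists (Eq i j), inl. split; [congruence|]. simpl. tauto.
Qed.

Lemma dfn_sub b (P : (nat -> V) -> V -> Prop) t : dft b t ->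
  dfn b (fun e => P (fun n => e (S n)) (e 0)) -> dfn b (fun e => P e (t e)).
Proof.
  intros Ht HP. eapply dfn_iff; [|exact (dfn_ex b (fun e x => x = t e /\ P e x)
    (dfn_and _ _ _ Ht HP))].
  intros e. simpl. split; [intros (x & -> & H); exact H | intros H; now exists (t e)].
Qed.

Lemma dft_var b i : dft b (fun e => e i).
Proof. exact (dfn_var_eq b 0 (S i)). Qed.

Lemma dft_const c : dft true (fun _ => c).
Proof.
  exists (Eq 0 1), (fun n => match n with 0 => inl 0 | _ => inr c end).
  split; [congruence|]. simpl. intros e. unfold lookup. tauto.
Qed.

Lemma dfn_eq b t s : dft b t -> dft b s -> dfn b (fun e => t e = s e).
Proof.
  intros Ht Hs. apply (dfn_sub b (fun e x => x = s e)); auto.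
Qed.

Lemma dfn_mem b t s : dft b t -> dft b s -> dfn b (fun e => t e ∈ s e).
Proof.
  intros Ht Hs. apply (dfn_sub b (fun e x => x ∈ s e)); auto.
  apply (dfn_sub b (fun e x => e 0 ∈ x) (fun e => s (fun n => e (S n)))).
  - exact (dft_ren b s S Hs).
  - exists (Mem 1 0), inl. split; [congruence|]. simpl. tauto.
Qed.

(** Classically an external proposition is equivalent to [Bot] or to its negation, so subexpressions
    that ignore the assignment need no analysis. *)
Lemma dfn_prop b (Q : Prop) : dfn b (fun _ => Q).
Proof.
  destruct (classic Q).
  - eapply dfn_iff; [|exact (dfn_not _ _ (dfn_false b))]. intros e; simpl; tauto.
  - eapply dfn_iff; [|exact (dfn_false b)]. intros e; simpl; tauto.
Qed.

Lemma dfn_exu b (P : (nat -> V) -> V -> Prop) :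
  dfn b (fun e => P (fun n => e (S n)) (e 0)) -> dfn b (fun e => exists! x, P e x).
Proof.
  intros H. apply dfn_ex. unfold unique. apply dfn_and; [exact H|].
  apply (dfn_all b (fun e x => P (fun n => e (S n)) x -> e 0 = x)).
  apply dfn_imp; [|apply dfn_var_eq].
  exact (dfn_ren b _ (fun n => match n with 0 => 0 | S m => S (S m) end) H).
Qed.

(** Definability is stated for all definable arguments, not just for variables, so that a hypothesis
    of this form applies wherever the predicate occurs. *)
Definition dpr1 (P : V -> Prop) :=
  forall t, dft true t -> dfn true (fun e => P (t e)).
Definition dpr2 (P : V -> V -> Prop) :=
  forall t s, dft true t -> dft true s -> dfn true (fun e => P (t e) (s e)).
Definition dfun1 (F : V -> V) :=
  forall t, dft true t -> dft true (fun e => F (t e)).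
Definition dfun2 (F : V -> V -> V) :=
  forall t s, dft true t -> dft true s -> dft true (fun e => F (t e) (s e)).


Lemma dpr1_definable (d : V) (P : V -> Prop) : dpr1 P -> definable P.
Proof.
  intros H. destruct (H _ (dft_var true 0)) as (p & r & _ & Hp).
  (* Each variable gets its own position in the tail, holding its constant if it has one and the
     filler [d] otherwise. *)
  exists (rename (fun n => match r n with inl 0 => 0 | _ => S n end) p),
    (lookup r (fun _ => d)).
  intros x. rewrite sat_rename, (Hp (scons x (fun _ => d))).
  match goal with |- sat _ ?a _ <-> sat _ ?b _ => replace b with a; [tauto|] end.
  apply functional_extensionality; intros n. unfold lookup.
  destruct (r n) as [[|k]|c] eqn:E; simpl; rewrite ?E; reflexivity.
Qed.

Lemma dpr2_definable (d : V) (P : V -> V -> Prop) : dpr2 P -> definable2 P.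
Proof.
  intros H. destruct (H _ _ (dft_var true 0) (dft_var true 1)) as (p & r & _ & Hp).
  exists (rename (fun n => match r n with inl 0 => 0 | inl 1 => 1 | _ => S (S n) end) p),
    (lookup r (fun _ => d)).
  intros x y. rewrite sat_rename, (Hp (scons x (scons y (fun _ => d)))).
  match goal with |- sat _ ?a _ <-> sat _ ?b _ => replace b with a; [tauto|] end.
  apply functional_extensionality; intros n. unfold lookup.
  destruct (r n) as [[|[|k]]|c] eqn:E; simpl; rewrite ?E; reflexivity.
Qed.

(** A formula without constants can be transferred along an elementary embedding with no parameter
    being moved. This serves for the least ordinal on which two embeddings disagree. *)
Lemma dfn_formula (P : V -> Prop) : dfn false (fun e => P (e 0)) ->
  exists p, forall e, P (e 0) <-> sat universe e p.
Proof.
  intros (p & r & Hr & Hp).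
  exists (rename (fun n => match r n with inl k => k | _ => 0 end) p).
  intros e. rewrite sat_rename, Hp.
  match goal with |- sat _ ?a _ <-> sat _ ?b _ => replace b with a; [tauto|] end.
  apply functional_extensionality; intros n. unfold lookup.
  destruct (r n) eqn:E; [reflexivity|]. exfalso. exact (Hr eq_refl n _ E).
Qed.

(** Induction on a formula of the metatheory; no truth predicate of V is involved. *)
Lemma dfn_sat b p : forall ts, (forall n, dft b (ts n)) ->
  dfn b (fun e => sat universe (fun n => ts n e) p).
Proof.
  induction p; intros ts Hts; simpl.
  - now apply dfn_mem.
  - now apply dfn_eq.
  - apply dfn_false.
  - now apply dfn_imp; auto.
  - apply (dfn_all b (fun e x => universe x -> sat universe (scons x (fun n => ts n e)) p)).
    apply dfn_imp; [unfold universe; apply dfn_prop|].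
    pose (ts' := fun n => match n with 0 => fun e : nat -> V => e 0
                 | S m => fun e => ts m (fun n => e (S n)) end).
    eapply dfn_iff; [|apply (IHp ts')].
    + intros e. cbn beta.
      replace (fun n => ts' n e) with (scons (e 0) (fun n => ts n (fun n => e (S n))));
      [reflexivity|]. apply functional_extensionality; now intros [|n].
    + intros [|n]; simpl; [apply dft_var|]. now apply (dft_ren b (ts n) S).
Qed.

End Definability.

(* Redefined below to cover each new notion. *)
Ltac dhook := fail.

Ltac dstep := cbn beta; lazymatch goal with
  | |- dpr1 _ => intros ? ?
  | |- dpr2 _ => intros ? ? ? ?
  | |- dfun1 _ => intros ? ?
  | |- dfun2 _ => intros ? ? ? ?
  | |- dfn _ (fun _ => ?A) => apply dfn_prop
  | |- dfn _ (fun e => _ = _) => apply dfn_eq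
  | |- dfn _ (fun e => mem _ _) => apply dfn_mem
  | |- dfn _ (fun e => _ /\ _) => apply dfn_and
  | |- dfn _ (fun e => _ \/ _) => apply dfn_or
  | |- dfn _ (fun e => ~ _) => apply dfn_not
  | |- dfn _ (fun e => _ <-> _) => apply dfn_equiv
  | |- dfn _ (fun e => exists! x, _) => apply dfn_exu
  | |- dfn _ (fun e => exists x, _) => apply dfn_ex
  | |- dfn _ (fun e => forall x, _) => first [apply dfn_all | apply dfn_imp]
  | |- dft true (fun _ => ?c) => apply dft_const
  | |- dft _ (fun e => e _) => apply dft_var
  | _ => first [ assumption | dhook
     | match goal with
       | H : dft _ ?t |- dft _ (fun e => ?t _) => apply (dft_ren _ _ _ H)
       | H : dfun1 ?F |- dft _ (fun e => ?F _) => apply H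
       | H : dfun2 ?F |- dft _ (fun e => ?F _ _) => apply H
       | H : dpr1 ?F |- dfn _ (fun e => ?F _) => apply H
       | H : dpr2 ?F |- dfn _ (fun e => ?F _ _) => apply H
       end ]
  end.
Ltac dsolve := repeat dstep.

(** * Set operations *)

Section Sets.
Context {V : set_structure} {HV : ZFC V}.

Lemma ZFC_inhabited : inhabited V.
Proof. destruct (zf_infinity V HV) as (w & _). exact (inhabits w). Qed.

Lemma definable1 (P : V -> Prop) : dpr1 P -> definable P.
Proof. destruct ZFC_inhabited as [d]. exact (dpr1_definable d P). Qed.

Lemma definable_2 (P : V -> V -> Prop) : dpr2 P -> definable2 P.
Proof. destruct ZFC_inhabited as [d]. exact (dpr2_definable d P). Qed.

Lemma set_ext (x y : V) : (forall z, z ∈ x <-> z ∈ y) -> x = y.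
Proof. apply (zf_extensionality V HV). Qed.

(* Total definite description: the empty set when there is no unique solution, so that the
   graph of a defined operation is always definable. *)
Definition iota (P : V -> Prop) : V := epsilon ZFC_inhabited (fun y =>
  (exists! z, P z) /\ P y \/ ~ (exists! z, P z) /\ empty y).

Lemma empty_exists : exists x : V, empty x.
Proof.
  destruct ZFC_inhabited as [d].
  destruct (zf_separation V HV (fun _ => False)) with (a := d) as [b Hb].
  - apply definable1. dsolve.
  - exists b. intros y Hy. apply Hb in Hy. tauto.
Qed.

Lemma empty_unique (x y : V) : empty x -> empty y -> x = y.
Proof. intros Hx Hy. apply set_ext. intros z. specialize (Hx z). specialize (Hy z). tauto. Qed.

Lemma iota_graph P y : y = iota P <->
  (exists! z, P z) /\ P y \/ ~ (exists! z, P z) /\ empty y.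
Proof.
  assert (let y := iota P in
    (exists! z, P z) /\ P y \/ ~ (exists! z, P z) /\ empty y) as H.
  { apply (epsilon_spec ZFC_inhabited (fun y =>
      (exists! z, P z) /\ P y \/ ~ (exists! z, P z) /\ empty y)).
    destruct (classic (exists! z, P z)) as [[z Hz]|N].
    - exists z. left. split; [now exists z | apply Hz].
    - destruct empty_exists as [x Hx]. exists x. tauto. }
  split; [intros ->; exact H|]. simpl in H.
  intros [[[z Hz] Hy]|[N Hy]]; destruct H as [[E H]|[M H]].
  - transitivity z; [symmetry|]; now apply Hz.
  - exfalso. apply M. now exists z.
  - contradiction.
  - now apply empty_unique.
Qed.

Lemma iota_eq (P : V -> Prop) y : P y -> (forall z, P z -> z = y) -> iota P = y.
Proof.
  intros H G. symmetry. apply iota_graph. left. split; [|exact H].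
  exists y. split; [exact H|]. intros z Hz. symmetry. now apply G.
Qed.

Lemma dft_iota b (P : (nat -> V) -> V -> Prop) :
  dfn b (fun e => P (fun n => e (S n)) (e 0)) -> dft b (fun e => iota (P e)).
Proof.
  intros H.
  assert (dfn b (fun e => exists! z, P (fun n => e (S n)) z)) as G.
  { exact (dfn_ren b _ S (dfn_exu b P H)). }
  eapply dfn_iff; [intros e; symmetry; apply iota_graph|].
  apply dfn_or; apply dfn_and; auto using dfn_not.
  unfold empty. dsolve.
Qed.

Definition setof (P : V -> Prop) : V := iota (fun b => forall x, x ∈ b <-> P x).

Lemma in_setof (P : V -> Prop) :
  (exists b : V, forall x, x ∈ b <-> P x) -> forall x, x ∈ setof P <-> P x.
Proof.
  intros [b Hb] x. replace (setof P) with b; [apply Hb|]. symmetry. apply iota_eq; auto.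
  intros z Hz. apply set_ext. intros w. rewrite Hz, Hb. tauto.
Qed.

Lemma dft_setof b (P : (nat -> V) -> V -> Prop) :
  dfn b (fun e => P (fun n => e (S n)) (e 0)) -> dft b (fun e => setof (P e)).
Proof.
  intros H. apply dft_iota. apply dfn_all. apply dfn_equiv; [dsolve|].
  exact (dfn_ren b _ (fun n => match n with 0 => 0 | S m => S (S m) end) H).
Qed.

Definition sep (a : V) (P : V -> Prop) : V := setof (fun x => x ∈ a /\ P x).
Definition upr (x y : V) : V := setof (fun w => w = x \/ w = y).
Definition opr (x y : V) : V := upr (upr x x) (upr x y).
Definition bigcup (x : V) : V := setof (fun z => exists y, y ∈ x /\ z ∈ y).
Definition cup (x y : V) : V := bigcup (upr x y).
Definition pow (x : V) : V := setof (fun z => subset z x).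
Definition rep (a : V) (F : V -> V) : V := setof (fun y => exists x, x ∈ a /\ y = F x).
Definition lam (a : V) (F : V -> V) : V := rep a (fun x => opr x (F x)).
Definition ap (f x : V) : V := iota (fun y => opr x y ∈ f).
Definition prod (a b : V) : V := bigcup (rep a (fun x => rep b (fun y => opr x y))).
Definition funs (a b : V) : V := setof (fun f => function_on f a /\ maps_into f b).
Definition zero : V := setof (fun _ => False).
Definition ite (P : Prop) (x y : V) : V := iota (fun z => P /\ z = x \/ ~ P /\ z = y).

Lemma in_sep a P : dpr1 P -> forall x, x ∈ sep a P <-> x ∈ a /\ P x.
Proof. intros H. apply in_setof. apply (zf_separation V HV). now apply definable1. Qed.

Lemma in_upr x y w : w ∈ upr x y <-> w = x \/ w = y.
Proof. apply in_setof. destruct (zf_pairing V HV x y) as [z Hz]. now exists z. Qed.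

Lemma in_bigcup x z : z ∈ bigcup x <-> exists y, y ∈ x /\ z ∈ y.
Proof. apply in_setof. apply (zf_union V HV). Qed.

Lemma in_cup x y z : z ∈ cup x y <-> z ∈ x \/ z ∈ y.
Proof.
  unfold cup. rewrite in_bigcup. setoid_rewrite in_upr. split.
  - intros (w & [-> | ->] & H); auto.
  - intros [H|H]; eauto.
Qed.

Lemma in_pow x z : z ∈ pow x <-> subset z x.
Proof. apply (in_setof (fun z => subset z x)). apply (zf_powerset V HV). Qed.

Lemma in_zero x : ~ x ∈ zero.
Proof.
  intros H. apply (in_setof (fun _ => False)) in H; [exact H|]. destruct empty_exists as [e He].
  exists e. intros y. specialize (He y). tauto.
Qed.

Lemma in_rep a F : dfun1 F -> forall y, y ∈ rep a F <-> exists x, x ∈ a /\ y = F x.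
Proof.
  intros H. apply in_setof. apply (zf_replacement V HV (fun x y => y = F x)).
  - apply definable_2. dsolve.
  - intros x _. exists (F x). split; congruence.
Qed.

Lemma upr_eq (x y z : V) : upair x y z -> z = upr x y.
Proof. intros H. apply set_ext. intros w. rewrite in_upr. apply H. Qed.

Lemma upair_upr (x y : V) : upair x y (upr x y).
Proof. intros w. apply in_upr. Qed.

Lemma opair_opr (x y z : V) : opair x y z <-> z = opr x y.
Proof.
  unfold opair, opr. split.
  - intros H. apply set_ext. intros w. rewrite H, in_upr. split.
    + intros [G|G]; apply upr_eq in G; auto.
    + intros [-> | ->]; auto using upair_upr.
  - intros -> w. rewrite in_upr. split.
    + intros [-> | ->]; auto using upair_upr.
    + intros [G|G]; apply upr_eq in G; auto.
Qed.

Lemma app_opr (f x y : V) : app f x y <-> opr x y ∈ f.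
Proof.
  split.
  - intros (p & Hp & Hf). apply opair_opr in Hp. now subst.
  - intros H. exists (opr x y). split; auto. now apply opair_opr.
Qed.

Lemma upr_inj (x y z w : V) : upr x y = upr z w -> x = z /\ y = w \/ x = w /\ y = z.
Proof.
  intros H.
  assert (forall u, (u = x \/ u = y) <-> (u = z \/ u = w)) as G.
  { intros u. rewrite <- !in_upr, H. tauto. }
  pose proof (proj1 (G x) (or_introl eq_refl)). pose proof (proj1 (G y) (or_intror eq_refl)).
  pose proof (proj2 (G z) (or_introl eq_refl)). pose proof (proj2 (G w) (or_intror eq_refl)).
  intuition congruence.
Qed.

Lemma opr_inj (x y z w : V) : opr x y = opr z w -> x = z /\ y = w.
Proof.
  intros H. apply upr_inj in H. destruct H as [[H G]|[H G]];
  apply upr_inj in H; apply upr_inj in G; intuition congruence.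
Qed.

Implicit Types t s u : (nat -> V) -> V.

Lemma dfn_empty b t : dft b t -> dfn b (fun e => empty (t e)).
Proof. intros; unfold empty; dsolve. Qed.
Lemma dfn_subset b t s : dft b t -> dft b s -> dfn b (fun e => subset (t e) (s e)).
Proof. intros; unfold subset; dsolve. Qed.
Lemma dft_sep b t P : dft b t -> dfn b (fun e => P (fun n => e (S n)) (e 0)) ->
  dft b (fun e => sep (t e) (P e)).
Proof. intros; unfold sep. apply dft_setof. dsolve. Qed.
Lemma dft_upr b t s : dft b t -> dft b s -> dft b (fun e => upr (t e) (s e)).
Proof. intros; unfold upr; apply dft_setof; dsolve. Qed.
Lemma dft_opr b t s : dft b t -> dft b s -> dft b (fun e => opr (t e) (s e)).
Proof. intros; unfold opr; auto using dft_upr. Qed.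
Lemma dft_bigcup b t : dft b t -> dft b (fun e => bigcup (t e)).
Proof. intros; unfold bigcup; apply dft_setof; dsolve. Qed.
Lemma dft_cup b t s : dft b t -> dft b s -> dft b (fun e => cup (t e) (s e)).
Proof. intros; unfold cup; auto using dft_bigcup, dft_upr. Qed.
Lemma dft_pow b t : dft b t -> dft b (fun e => pow (t e)).
Proof. intros; unfold pow; apply dft_setof, dfn_subset; dsolve. Qed.
Lemma dft_rep b t F : dft b t -> dft b (fun e => F (fun n => e (S n)) (e 0)) ->
  dft b (fun e => rep (t e) (F e)).
Proof.
  intros H G; unfold rep; apply dft_setof; dsolve.
  exact (dft_ren b _ (fun n => match n with 0 => 0 | S m => S (S m) end) G).
Qed.
Lemma dft_lam b t F : dft b t -> dft b (fun e => F (fun n => e (S n)) (e 0)) ->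
  dft b (fun e => lam (t e) (F e)).
Proof. intros; unfold lam; apply dft_rep; auto. apply dft_opr; auto. dsolve. Qed.
Lemma dft_ap b t s : dft b t -> dft b s -> dft b (fun e => ap (t e) (s e)).
Proof.
  intros; unfold ap; apply dft_iota. apply dfn_mem; [apply dft_opr|]; dsolve.
Qed.
Lemma dfn_app b t s u : dft b t -> dft b s -> dft b u ->
  dfn b (fun e => app (t e) (s e) (u e)).
Proof.
  intros; eapply dfn_iff; [intros e; symmetry; apply app_opr|].
  apply dfn_mem; [apply dft_opr|]; dsolve.
Qed.
Lemma dft_prod b t s : dft b t -> dft b s -> dft b (fun e => prod (t e) (s e)).
Proof.
  intros; unfold prod. apply dft_bigcup, dft_rep, dft_rep, dft_opr; dsolve.
Qed.
Lemma dfn_opair b t s u : dft b t -> dft b s -> dft b u ->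
  dfn b (fun e => opair (t e) (s e) (u e)).
Proof.
  intros; eapply dfn_iff; [intros e; symmetry; apply opair_opr|].
  apply dfn_eq; [|apply dft_opr]; dsolve.
Qed.
Lemma dfn_function_on b t s : dft b t -> dft b s -> dfn b (fun e => function_on (t e) (s e)).
Proof.
  intros; unfold function_on; dsolve.
  - apply dfn_opair; dsolve.
  - apply dfn_app; dsolve.
Qed.
Lemma dfn_maps_into b t s : dft b t -> dft b s -> dfn b (fun e => maps_into (t e) (s e)).
Proof. intros; unfold maps_into; dsolve. apply dfn_app; dsolve. Qed.
Lemma dft_funs b t s : dft b t -> dft b s -> dft b (fun e => funs (t e) (s e)).
Proof.
  intros; unfold funs; apply dft_setof, dfn_and.
  - apply dfn_function_on; dsolve.
  - apply dfn_maps_into; dsolve.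
Qed.
Lemma dft_ite b P t s : dfn b P -> dft b t -> dft b s -> dft b (fun e => ite (P e) (t e) (s e)).
Proof.
  intros H ? ?; unfold ite; apply dft_iota; dsolve; exact (dfn_ren b P S H).
Qed.
End Sets.

Ltac dsets := match goal with
  | |- dft _ (fun e => iota _) => apply dft_iota
  | |- dft _ (fun e => sep _ _) => apply dft_sep
  | |- dft _ (fun e => upr _ _) => apply dft_upr
  | |- dft _ (fun e => opr _ _) => apply dft_opr
  | |- dft _ (fun e => bigcup _) => apply dft_bigcup
  | |- dft _ (fun e => cup _ _) => apply dft_cup
  | |- dft _ (fun e => pow _) => apply dft_pow
  | |- dft _ (fun e => rep _ _) => apply dft_rep
  | |- dft _ (fun e => lam _ _) => apply dft_lam
  | |- dft _ (fun e => ap _ _) => apply dft_ap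
  | |- dft _ (fun e => prod _ _) => apply dft_prod
  | |- dft _ (fun e => funs _ _) => apply dft_funs
  | |- dft _ (fun e => ite _ _ _) => apply dft_ite
  | |- dfn _ (fun e => empty _) => apply dfn_empty
  | |- dfn _ (fun e => subset _ _) => apply dfn_subset
  | |- dfn _ (fun e => app _ _ _) => apply dfn_app
  | |- dfn _ (fun e => function_on _ _) => apply dfn_function_on
  | |- dfn _ (fun e => maps_into _ _) => apply dfn_maps_into
  end.
Ltac dhook ::= dsets.

Section Sets2.
Context {V : set_structure} {HV : ZFC V}.

Lemma ite_true (P : Prop) (x y : V) : P -> ite P x y = x.
Proof. intros H. apply iota_eq; [tauto|]. intros z; tauto. Qed.

Lemma ite_false (P : Prop) (x y : V) : ~ P -> ite P x y = y.
Proof. intros H. apply iota_eq; [tauto|]. intros z; tauto. Qed.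

Lemma ite_iff (P Q : Prop) (x y : V) : (P <-> Q) -> ite P x y = ite Q x y.
Proof.
  intros H. destruct (classic P).
  - rewrite !ite_true; tauto.
  - rewrite !ite_false; tauto.
Qed.

Lemma in_prod (a b p : V) : p ∈ prod a b <-> exists x y, x ∈ a /\ y ∈ b /\ p = opr x y.
Proof.
  unfold prod. rewrite in_bigcup. split.
  - intros (z & Hz & Hp). apply in_rep in Hz; [|dsolve]. destruct Hz as (x & Hx & ->).
    apply in_rep in Hp; [|dsolve]. destruct Hp as (y & Hy & ->). eauto.
  - intros (x & y & Hx & Hy & ->). exists (rep b (fun y => opr x y)). split.
    + apply in_rep; [dsolve|]. eauto.
    + apply in_rep; [dsolve|]. eauto.
Qed.

Lemma app_ap (f a x : V) : function_on f a -> x ∈ a -> app f x (ap f x).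
Proof.
  intros [_ H] Hx. destruct (H x Hx) as (y & Hy & U).
  replace (ap f x) with y; [exact Hy|]. symmetry. apply iota_eq.
  - now apply app_opr.
  - intros z Hz. symmetry. apply U. now apply app_opr.
Qed.

Lemma app_dom (f a x y : V) : function_on f a -> app f x y -> x ∈ a.
Proof.
  intros [H _] G. apply app_opr in G. destruct (H _ G) as (z & w & Hz & E).
  apply opair_opr in E. apply opr_inj in E. now destruct E as [-> _].
Qed.

Lemma app_eq (f a x y : V) : function_on f a -> app f x y -> y = ap f x.
Proof.
  intros H G. pose proof (app_dom _ _ _ _ H G) as Hx.
  destruct H as [H1 H2]. destruct (H2 x Hx) as (z & Hz & U).
  rewrite <- (U _ G). apply U. eapply app_ap; [split; eassumption|exact Hx].
Qed.

Lemma function_ext (f g a : V) : function_on f a -> function_on g a ->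
  (forall x, x ∈ a -> ap f x = ap g x) -> f = g.
Proof.
  intros Hf Hg H. apply set_ext.
  assert (forall f g : V, function_on f a -> function_on g a ->
    (forall x, x ∈ a -> ap f x = ap g x) -> forall z, z ∈ f -> z ∈ g) as K.
  { clear. intros f g Hf Hg H z Hz. destruct (proj1 Hf z Hz) as (x & y & Hx & E).
    apply opair_opr in E. subst z. apply app_opr in Hz.
    rewrite (app_eq _ _ _ _ Hf Hz), H by assumption. apply app_opr. now apply (app_ap g a). }
  split; apply K; auto. intros x Hx. symmetry. auto.
Qed.

Lemma lam_function (a : V) F : dfun1 F -> function_on (lam a F) a.
Proof.
  intros HF. assert (forall p, p ∈ lam a F <-> exists x, x ∈ a /\ p = opr x (F x)) as H.
  { apply in_rep. dsolve. }
  split.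
  - intros p Hp. apply H in Hp. destruct Hp as (x & Hx & ->). exists x, (F x).
    split; auto. now apply opair_opr.
  - intros x Hx. exists (F x). split.
    + apply app_opr, H. eauto.
    + intros y Hy. apply app_opr, H in Hy. destruct Hy as (x' & _ & E).
      apply opr_inj in E. destruct E; congruence.
Qed.

Lemma ap_lam (a x : V) F : dfun1 F -> x ∈ a -> ap (lam a F) x = F x.
Proof.
  intros HF Hx. symmetry. apply (app_eq _ a).
  - now apply lam_function.
  - apply app_opr. apply in_rep; [dsolve|]. eauto.
Qed.

Lemma lam_ext (a : V) F G : dfun1 F -> dfun1 G -> (forall x, x ∈ a -> F x = G x) ->
  lam a F = lam a G.
Proof.
  intros HF HG H. apply (function_ext _ _ a); auto using lam_function.
  intros x Hx. rewrite !ap_lam; auto.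
Qed.

Lemma lam_ap (f a : V) : function_on f a -> lam a (fun x => ap f x) = f.
Proof.
  intros H. apply (function_ext _ _ a); auto.
  - apply lam_function. dsolve.
  - intros x Hx. rewrite ap_lam; auto. dsolve.
Qed.

Lemma maps_into_ap (f a b : V) : function_on f a ->
  maps_into f b <-> forall x, x ∈ a -> ap f x ∈ b.
Proof.
  intros Hf. split.
  - intros H x Hx. apply (H x). now apply (app_ap f a).
  - intros H x y Hxy. rewrite (app_eq _ _ _ _ Hf Hxy). apply H. now apply (app_dom f a x y).
Qed.

Lemma in_funs (a b f : V) :
  f ∈ funs a b <-> function_on f a /\ forall x, x ∈ a -> ap f x ∈ b.
Proof.
  transitivity (function_on f a /\ maps_into f b).
  - apply (in_setof (fun f => function_on f a /\ maps_into f b)).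
    exists (sep (pow (prod a b)) (fun f => function_on f a /\ maps_into f b)).
    intros g. rewrite in_sep by dsolve. split; [tauto|]. intros [H G]. split; auto.
    apply in_pow. intros p Hp. apply in_prod.
    destruct (proj1 H p Hp) as (x & y & Hx & E). apply opair_opr in E. subst p.
    exists x, y. repeat split; auto. apply (G x). now apply app_opr.
  - split; intros [H G]; split; auto; eapply maps_into_ap; eauto.
Qed.

Lemma lam_funs (a b : V) F : dfun1 F -> (forall x, x ∈ a -> F x ∈ b) -> lam a F ∈ funs a b.
Proof.
  intros HF H. apply in_funs. split; [now apply lam_function|].
  intros x Hx. rewrite ap_lam; auto.
Qed.

End Sets2.

(* Otherwise failing unifications unfold the set operations down to [epsilon]. *)
#[global] Opaque iota setof sep upr opr bigcup cup pow rep lam ap prod funs zero ite.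

(** * Recursion, ordinals and selection *)

Section Recursion.
Context {V : set_structure} {HV : ZFC V}.

(** Only sets of V are tested, because [R] may be ill-founded from outside. Induction along [R] is
    accordingly limited to definable predicates. *)
Definition wf_on (A : V) (R : V -> V -> Prop) : Prop :=
  forall B, subset B A -> (exists x, x ∈ B) -> exists x, x ∈ B /\ forall y, y ∈ B -> ~ R y x.

Lemma wf_on_mem (A : V) : wf_on A mem.
Proof.
  intros B _ H. destruct (zf_foundation V HV B H) as (x & Hx & G).
  exists x. split; auto.
Qed.

Lemma wf_on_ind (A : V) R (P : V -> Prop) : wf_on A R -> dpr1 P ->
  (forall x, x ∈ A -> (forall y, y ∈ A -> R y x -> P y) -> P x) -> forall x, x ∈ A -> P x.
Proof.
  intros HR HP H x Hx. apply NNPP. intros N.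
  destruct (HR (sep A (fun x => ~ P x))) as (y & Hy & G).
  - intros z Hz. apply in_sep in Hz; [tauto|dsolve].
  - exists x. apply in_sep; [dsolve|auto].
  - apply in_sep in Hy; [|dsolve]. destruct Hy as [Hy K]. apply K, H; auto.
    intros z Hz Hzy. apply NNPP. intros M. apply (G z); auto. apply in_sep; [dsolve|auto].
Qed.

(** * Recursion along a well-founded relation on a set *)

Section Attempts.
Variables (A : V) (R : V -> V -> Prop) (G : V -> V -> V).
Hypotheses (HR : dpr2 R) (HG : dfun2 G) (Hwf : wf_on A R).

Let step (g x : V) : V := G x (lam (sep A (fun y => R y x)) (fun y => ap g y)).

Let attempt (g B : V) : Prop :=
  subset B A /\ function_on g B /\ (forall x y, x ∈ B -> y ∈ A -> R y x -> y ∈ B) /\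
  forall x, x ∈ B -> ap g x = step g x.

Local Lemma step_ext g h x : (forall y, y ∈ A -> R y x -> ap g y = ap h y) ->
  step g x = step h x.
Proof.
  intros H. unfold step. f_equal. apply lam_ext; try dsolve.
  intros y Hy. apply in_sep in Hy; [|dsolve]. now apply H.
Qed.

Local Lemma attempt_agree g B h C : attempt g B -> attempt h C ->
  forall x, x ∈ A -> x ∈ B -> x ∈ C -> ap g x = ap h x.
Proof.
  intros (HB1 & HB2 & HB3 & HB4) (HC1 & HC2 & HC3 & HC4).
  apply (wf_on_ind A R (fun x => x ∈ B -> x ∈ C -> ap g x = ap h x)); auto.
  - dsolve.
  - intros x Hx IH Hb Hc. rewrite HB4, HC4 by auto. apply step_ext.
    intros y Hy Hyx. apply IH; eauto.
Qed.

Local Lemma attempt_dpr2 : dpr2 attempt.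
Proof. unfold attempt, step. dsolve. Qed.

(** The solution is glued from attempts, that is, solutions on subsets of [A] closed under
    predecessors. Any two agree where both are defined, and a point whose predecessors are all
    covered by attempts is covered itself. *)
Lemma recursion : exists h, function_on h A /\ forall x, x ∈ A ->
  ap h x = G x (lam (sep A (fun y => R y x)) (fun y => ap h y)).
Proof.
  pose proof attempt_dpr2 as HA.
  pose (val := fun x => iota (fun y => exists g B, attempt g B /\ x ∈ B /\ y = ap g x)).
  assert (dfun1 val) as Hval by (unfold val; dsolve).
  assert (forall g B x, attempt g B -> x ∈ B -> val x = ap g x) as Hv.
  { intros g B x Ha Hx. apply iota_eq; [eauto|].
    intros z (g' & B' & Ha' & Hx' & ->). eapply attempt_agree; eauto. now apply (proj1 Ha). }
  assert (forall x, x ∈ A -> exists g B, attempt g B /\ x ∈ B) as Hall.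
  { apply (wf_on_ind A R); auto; [dsolve|]. intros x Hx IH.
    apply NNPP. intros N.
    (* The attempt for [x] is built on all covered points and not only on the predecessors of [x]:
       those alone need not be closed, as [R] may fail to be transitive. *)
    pose (B0 := sep A (fun y => exists g B, attempt g B /\ y ∈ B)).
    assert (forall y, y ∈ B0 <-> y ∈ A /\ exists g B, attempt g B /\ y ∈ B) as HB0.
    { apply in_sep. dsolve. }
    pose (v := G x (lam (sep A (fun y => R y x)) val)).
    pose (F := fun z => ite (z = x) v (val z)).
    assert (dfun1 F) as HF by (unfold F; dsolve).
    assert (forall z, z <> x -> F z = val z) as Fz by (intros; now apply ite_false).
    assert (F x = v) as Fx by (now apply ite_true).
    pose (B1 := cup B0 (upr x x)).
    assert (forall y, y ∈ B1 <-> y ∈ B0 \/ y = x) as HB1.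
    { intros y. unfold B1. rewrite in_cup, in_upr. tauto. }
    apply N. exists (lam B1 F), B1. split; [|apply HB1; auto].
    assert (forall y, y ∈ B0 -> y <> x) as Hne.
    { intros y Hy ->. apply HB0 in Hy. tauto. }
    split; [|split; [|split]].
    - intros y Hy. apply HB1 in Hy. destruct Hy as [Hy| ->]; auto. now apply HB0.
    - now apply lam_function.
    - intros z y Hz Hy Hyz. apply HB1. left. apply HB0. split; auto.
      apply HB1 in Hz. destruct Hz as [Hz| ->]; [|now apply IH].
      apply HB0 in Hz. destruct Hz as (_ & g & B & Ha & Hz). exists g, B. split; auto.
      destruct Ha as (_ & _ & Ha & _). eauto.
    - intros z Hz. rewrite ap_lam by auto. unfold step.
      apply HB1 in Hz. destruct Hz as [Hz| ->].
      + pose proof (Hne _ Hz) as Hzx. apply HB0 in Hz. destruct Hz as (Hz & g & B & Ha & Hz').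
        rewrite Fz by auto. rewrite (Hv g B) by auto.
        destruct (Ha) as (Ha1 & Ha2 & Ha3 & Ha4). rewrite Ha4 by auto. apply step_ext.
        intros y Hy Hyz. assert (y ∈ B) by eauto.
        assert (y ∈ B0) by (apply HB0; eauto).
        rewrite ap_lam; [|auto|apply HB1; auto]. rewrite Fz by auto. symmetry. now apply (Hv g B).
      + rewrite Fx. unfold v. f_equal. apply lam_ext; try dsolve.
        intros y Hy. apply in_sep in Hy; [|dsolve]. destruct Hy as [Hy Hyx].
        assert (y ∈ B0) by (apply HB0; auto).
        rewrite ap_lam; [|auto|apply HB1; auto]. now rewrite Fz by auto. }
  exists (lam A val). split; [now apply lam_function|].
  intros x Hx. rewrite ap_lam by auto. destruct (Hall x Hx) as (g & B & Ha & Hb).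
  rewrite (Hv g B) by auto. destruct (Ha) as (Ha1 & Ha2 & Ha3 & Ha4). rewrite Ha4 by auto.
  apply step_ext. intros y Hy Hyx. rewrite ap_lam by auto. symmetry. apply (Hv g B); eauto.
Qed.
End Attempts.

Definition suc (x : V) : V := cup x (upr x x).
Definition omega : V := setof natural_number.

Lemma in_suc x y : y ∈ suc x <-> y ∈ x \/ y = x.
Proof. unfold suc. rewrite in_cup, in_upr. tauto. Qed.

Lemma successor_suc (x y : V) : successor x y <-> y = suc x.
Proof.
  split.
  - intros H. apply set_ext. intros z. rewrite in_suc. apply H.
  - intros -> z. apply in_suc.
Qed.

Lemma dft_suc b (t : (nat -> V) -> V) : dft b t -> dft b (fun e => suc (t e)).
Proof. intros; unfold suc; dsolve. Qed.
Lemma dfn_transitive_set b (t : (nat -> V) -> V) : dft b t -> dfn b (fun e => transitive_set (t e)).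
Proof. intros; unfold transitive_set; dsolve. Qed.
Lemma dfn_ordinal b (t : (nat -> V) -> V) : dft b t -> dfn b (fun e => ordinal (t e)).
Proof. intros; unfold ordinal; dsolve; apply dfn_transitive_set; dsolve. Qed.
Lemma dfn_zos b (t : (nat -> V) -> V) : dft b t -> dfn b (fun e => zero_or_successor (t e)).
Proof. intros; unfold zero_or_successor, successor; dsolve. Qed.
Lemma dfn_natural b (t : (nat -> V) -> V) : dft b t -> dfn b (fun e => natural_number (t e)).
Proof.
  intros; unfold natural_number; dsolve; first [apply dfn_ordinal | apply dfn_zos]; dsolve.
Qed.
Lemma dft_omega b : dft b (fun _ => omega).
Proof. intros; unfold omega; apply dft_setof, dfn_natural; dsolve. Qed.

Lemma not_mem_self (x : V) : ~ x ∈ x.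
Proof.
  intros H. destruct (zf_foundation V HV (upr x x)) as (y & Hy & G).
  - exists x. apply in_upr. auto.
  - apply in_upr in Hy. assert (y = x) as -> by tauto. apply (G x); auto. apply in_upr; auto.
Qed.

Lemma ordinal_elem (a x : V) : ordinal a -> x ∈ a -> ordinal x.
Proof.
  intros [H1 H2] Hx. split; [auto|]. intros y Hy. apply H2. now apply (H1 x).
Qed.

Lemma ordinal_suc (a : V) : ordinal a -> ordinal (suc a).
Proof.
  intros [H1 H2]. split.
  - intros y Hy z Hz. apply in_suc. apply in_suc in Hy. destruct Hy as [Hy| ->]; auto.
    left. now apply (H1 y).
  - intros y Hy. apply in_suc in Hy. destruct Hy as [Hy| ->]; auto.
Qed.

Lemma empty_zero (x : V) : empty x <-> x = zero.
Proof.
  split; [|intros ->; exact in_zero]. intros H. apply empty_unique; auto. exact in_zero.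
Qed.

Lemma natural_zero : natural_number (zero : V).
Proof.
  repeat split; try (intros y Hy; destruct (in_zero _ Hy)).
  left. exact in_zero.
Qed.

Lemma natural_elem (n m : V) : natural_number n -> m ∈ n -> natural_number m.
Proof.
  intros (H1 & H2 & H3) Hm. split; [|split]; auto.
  - eapply ordinal_elem; eauto.
  - intros k Hk. apply H3. now apply (proj1 H1 m).
Qed.

Lemma natural_suc (n : V) : natural_number n -> natural_number (suc n).
Proof.
  intros (H1 & H2 & H3). split; [|split].
  - now apply ordinal_suc.
  - right. exists n. now apply successor_suc.
  - intros m Hm. apply in_suc in Hm. destruct Hm as [Hm| ->]; auto.
Qed.

Lemma in_omega (n : V) : n ∈ omega <-> natural_number n.
Proof.
  apply in_setof. destruct (zf_infinity V HV) as (w & (z & Hz & Hzw) & Hw).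
  exists (sep w natural_number). intros x. rewrite in_sep by (dsolve; now apply dfn_natural).
  split; [tauto|]. intros Hx. split; auto.
  assert (forall m, m ∈ suc x -> m ∈ w) as K.
  { apply (wf_on_ind (suc x) mem); [apply wf_on_mem|dsolve|].
    intros m Hm IH. assert (natural_number m) as Hn.
    { eapply natural_elem; [|exact Hm]. now apply natural_suc. }
    destruct (Hn) as (_ & [E|[y Hy]] & _).
    - apply empty_zero in E, Hz. now subst.
    - apply successor_suc in Hy. subst m. assert (y ∈ w) as Hyw.
      { apply IH.
        - apply (proj1 (ordinal_suc _ (proj1 Hx)) (suc y)); auto. apply in_suc; auto.
        - apply in_suc; auto. }
      destruct (Hw y Hyw) as (y' & Hy' & Hy''). apply successor_suc in Hy'. now subst. }
  apply K, in_suc. auto.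
Qed.

Lemma omega_zero : zero ∈ omega.
Proof. apply in_omega, natural_zero. Qed.

Lemma omega_suc n : n ∈ omega -> suc n ∈ omega.
Proof. rewrite !in_omega. apply natural_suc. Qed.

Lemma omega_transitive n m : n ∈ omega -> m ∈ n -> m ∈ omega.
Proof. rewrite !in_omega. apply natural_elem. Qed.

Lemma bigcup_suc (n : V) : transitive_set n -> bigcup (suc n) = n.
Proof.
  intros H. apply set_ext. intros z. rewrite in_bigcup. split.
  - intros (y & Hy & Hz). apply in_suc in Hy. destruct Hy as [Hy| ->]; auto. now apply (H y).
  - intros Hz. exists n. split; auto. apply in_suc; auto.
Qed.

Lemma transitive_closure (x : V) : exists T, transitive_set T /\ subset x T.
Proof.
  (* Stage n adds to [x] the unions of all earlier stages, which avoids a case distinction between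
     zero and successors. *)
  destruct (recursion omega mem (fun n u => cup x (bigcup (rep n (fun m => bigcup (ap u m))))))
    as (h & _ & Hh).
  - dsolve.
  - dsolve.
  - apply wf_on_mem.
  - assert (forall n z, n ∈ omega ->
      z ∈ ap h n <-> z ∈ x \/ exists m, m ∈ n /\ z ∈ bigcup (ap h m)) as K.
    { intros n z Hn. rewrite Hh by auto. rewrite in_cup, in_bigcup.
      assert (forall m, m ∈ n -> ap (lam (sep omega (fun y => y ∈ n)) (fun y => ap h y)) m
        = ap h m) as L.
      { intros m Hm. apply ap_lam; [dsolve|]. apply in_sep; [dsolve|]. split; auto.
        eapply omega_transitive; eauto. }
      apply or_iff_compat_l. split.
      - intros (y & Hy & Hz). apply in_rep in Hy; [|dsolve]. destruct Hy as (m & Hm & ->).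
        exists m. rewrite L in Hz by auto. auto.
      - intros (m & Hm & Hz). eexists. split; [apply in_rep; [dsolve|]; exists m; split; eauto|].
        now rewrite L by auto. }
    exists (bigcup (rep omega (ap h))).
    assert (forall z, z ∈ bigcup (rep omega (ap h)) <-> exists n, n ∈ omega /\ z ∈ ap h n) as L.
    { intros z. rewrite in_bigcup. split.
      - intros (y & Hy & Hz). apply in_rep in Hy; [|dsolve]. destruct Hy as (m & Hm & ->). eauto.
      - intros (n & Hn & Hz). exists (ap h n). split; auto. apply in_rep; [dsolve|]. eauto. }
    split.
    + intros y Hy z Hz. apply L in Hy. apply L. destruct Hy as (n & Hn & Hy).
      exists (suc n). split; [now apply omega_suc|]. apply K; [now apply omega_suc|].
      right. exists n. split; [apply in_suc; auto|]. apply in_bigcup. eauto.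
    + intros z Hz. apply L. exists zero. split; [apply omega_zero|]. apply K; auto.
      apply omega_zero.
Qed.

Lemma transitive_containing (x : V) : exists T, transitive_set T /\ x ∈ T.
Proof.
  destruct (transitive_closure (upr x x)) as (T & HT & H). exists T. split; auto.
  apply H, in_upr. auto.
Qed.

Lemma eps_ind (P : V -> Prop) : dpr1 P ->
  (forall x, (forall y, y ∈ x -> P y) -> P x) -> forall x, P x.
Proof.
  intros HP H x. destruct (transitive_containing x) as (T & HT & Hx).
  revert x Hx. apply (wf_on_ind T mem); auto using wf_on_mem.
  intros x Hx IH. apply H. intros y Hy. apply IH; auto. now apply (HT x).
Qed.

End Recursion.

Ltac dords := match goal with
  | |- dft _ (fun e => suc _) => apply dft_suc
  | |- dft _ (fun e => omega) => apply dft_omega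
  | |- dfn _ (fun e => transitive_set _) => apply dfn_transitive_set
  | |- dfn _ (fun e => ordinal _) => apply dfn_ordinal
  | |- dfn _ (fun e => natural_number _) => apply dfn_natural
  end.
Ltac dhook ::= first [dsets | dords].

(** * Ordinals, the cumulative hierarchy and choice functions *)

Section Ordinals.
Context {V : set_structure} {HV : ZFC V}.

Lemma ordinal_trichotomy (a : V) : ordinal a -> forall b : V, ordinal b -> a ∈ b \/ a = b \/ b ∈ a.
Proof.
  pattern a. revert a. apply eps_ind; [dsolve|]. intros a IHa Ha.
  apply (eps_ind (fun b => ordinal b -> a ∈ b \/ a = b \/ b ∈ a)); [dsolve|].
  intros b IHb Hb. apply NNPP. intros N. apply N. right. left. apply set_ext. intros x. split.
  - intros Hx. destruct (IHa x Hx (ordinal_elem _ _ Ha Hx) b Hb) as [H|[->|H]]; auto.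
    + exfalso; tauto.
    + exfalso. apply N. right. right. now apply (proj1 Ha x).
  - intros Hx. destruct (IHb x Hx (ordinal_elem _ _ Hb Hx)) as [H|[->|H]]; auto.
    + exfalso. apply N. left. now apply (proj1 Hb x).
    + exfalso; tauto.
Qed.

Lemma least_ordinal (P : V -> Prop) a : dpr1 P -> ordinal a -> P a ->
  exists b, ordinal b /\ P b /\ forall c, c ∈ b -> ~ P c.
Proof.
  intros HP. revert a.
  apply (eps_ind (fun a => ordinal a -> P a ->
    exists b, ordinal b /\ P b /\ forall c, c ∈ b -> ~ P c)); [dsolve|].
  intros a IH Ha Pa. destruct (classic (exists c, c ∈ a /\ P c)) as [(c & Hc & Pc)|N].
  - apply (IH c); auto. eapply ordinal_elem; eauto.
  - exists a. split; [|split]; auto. intros c Hc Pc. apply N; eauto.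
Qed.

Lemma ordinal_omega : ordinal (omega : V).
Proof.
  split.
  - intros n Hn m Hm. eapply omega_transitive; eauto.
  - intros n Hn. apply in_omega in Hn. exact (proj1 (proj1 Hn)).
Qed.

Lemma ordinal_asym (a b : V) : ordinal a -> a ∈ b -> ~ b ∈ a.
Proof. intros Ha H G. apply (not_mem_self a). eapply (proj1 Ha); eauto. Qed.

(** Recursion on membership over the whole universe. No set carries the full solution, so the value
    is read off from any solution on a transitive set containing [x]. *)
Definition erec (G : V -> V -> V) (x : V) : V := iota (fun y => exists T h,
  transitive_set T /\ x ∈ T /\ function_on h T /\
  (forall t, t ∈ T -> ap h t = G t (lam t (fun s => ap h s))) /\ y = ap h x).

Lemma erec_dfun1 G : dfun2 G -> dfun1 (erec G).
Proof. intros HG. unfold erec. dsolve. Qed.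

Lemma erec_eq G x : dfun2 G -> erec G x = G x (lam x (fun y => erec G y)).
Proof.
  intros HG. pose proof (erec_dfun1 G HG) as HE.
  assert (forall T h T' h', transitive_set T -> transitive_set T' ->
    (forall t, t ∈ T -> ap h t = G t (lam t (fun s => ap h s))) ->
    (forall t, t ∈ T' -> ap h' t = G t (lam t (fun s => ap h' s))) ->
    forall x, x ∈ T -> x ∈ T' -> ap h x = ap h' x) as K.
  { intros T h T' h' HT HT' Hh Hh'.
    apply (eps_ind (fun x => x ∈ T -> x ∈ T' -> ap h x = ap h' x)); [dsolve|].
    intros y IH Hy Hy'. rewrite Hh, Hh' by auto. f_equal. apply lam_ext; [dsolve|dsolve|].
    intros z Hz. apply IH; auto; [now apply (HT y)|now apply (HT' y)]. }
  destruct (transitive_containing x) as (T & HT & Hx).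
  destruct (recursion T mem G) as (h & Hf & Hh); [dsolve|exact HG|apply wf_on_mem|].
  assert (forall t, t ∈ T -> ap h t = G t (lam t (fun s => ap h s))) as Hh'.
  { intros t Ht. rewrite Hh by auto.
    replace (sep T (fun y => y ∈ t)) with t; auto. apply set_ext. intros z.
    rewrite in_sep by dsolve. split; [|tauto]. intros Hz. split; auto. now apply (HT t). }
  assert (forall y, y ∈ T -> erec G y = ap h y) as L.
  { intros y Hy. apply iota_eq.
    - exists T, h. auto.
    - intros z (T' & h' & HT' & Hy' & _ & Hr & ->).
      exact (K T' h' T h HT' HT Hr Hh' y Hy' Hy). }
  rewrite L by auto. rewrite Hh' by auto. f_equal. apply lam_ext; [dsolve|dsolve|].
  intros y Hy. symmetry. apply L. now apply (HT x).
Qed.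

(** At an ordinal this is the level of the cumulative hierarchy with that index. Taking it at
    arbitrary sets makes recursion on membership apply directly. The companion [rk] is the usual
    rank. *)
Definition lev (x : V) : V := erec (fun t h => bigcup (rep t (fun y => pow (ap h y)))) x.
Definition rk (x : V) : V := erec (fun t h => bigcup (rep t (fun y => suc (ap h y)))) x.

Lemma lev_dfun1 : dfun1 lev.
Proof. apply erec_dfun1. dsolve. Qed.
Lemma rk_dfun1 : dfun1 rk.
Proof. apply erec_dfun1. dsolve. Qed.

Lemma in_bigcup_rep (x z : V) F : dfun1 F ->
  z ∈ bigcup (rep x F) <-> exists y, y ∈ x /\ z ∈ F y.
Proof.
  intros HF. rewrite in_bigcup. split.
  - intros (u & Hu & Hz). apply in_rep in Hu; auto. destruct Hu as (y & Hy & ->). eauto.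
  - intros (y & Hy & Hz). exists (F y). split; auto. apply in_rep; eauto.
Qed.

Lemma in_lev x z : z ∈ lev x <-> exists y, y ∈ x /\ subset z (lev y).
Proof.
  pose proof lev_dfun1 as HL. unfold lev at 1. rewrite erec_eq by dsolve.
  rewrite in_bigcup_rep by dsolve. split; intros (y & Hy & Hz); exists y; split; auto.
  - rewrite ap_lam in Hz; [now apply in_pow| |auto]. exact HL.
  - rewrite ap_lam; [now apply in_pow| |auto]. exact HL.
Qed.

Lemma in_rk x z : z ∈ rk x <-> exists y, y ∈ x /\ z ∈ suc (rk y).
Proof.
  pose proof rk_dfun1 as HL. unfold rk at 1. rewrite erec_eq by dsolve.
  rewrite in_bigcup_rep by dsolve. split; intros (y & Hy & Hz); exists y; split; auto.
  - rewrite ap_lam in Hz; [exact Hz| |auto]. exact HL.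
  - rewrite ap_lam; [exact Hz| |auto]. exact HL.
Qed.

Lemma rk_ordinal x : ordinal (rk x).
Proof.
  pose proof rk_dfun1 as HL.
  revert x. apply eps_ind; [dsolve|]. intros x IH. split.
  - intros a Ha b Hb. apply in_rk in Ha. apply in_rk. destruct Ha as (y & Hy & Ha).
    exists y. split; auto. eapply (proj1 (ordinal_suc _ (IH y Hy))); eauto.
  - intros a Ha. apply in_rk in Ha. destruct Ha as (y & Hy & Ha).
    apply (proj2 (ordinal_suc _ (IH y Hy))); auto.
Qed.

Lemma lev_rk x : subset (lev x) (lev (rk x)).
Proof.
  pose proof rk_dfun1 as HR. pose proof lev_dfun1 as HL.
  revert x. apply eps_ind; [dsolve|]. intros x IH z Hz.
  apply in_lev in Hz. apply in_lev. destruct Hz as (y & Hy & Hz). exists (rk y). split.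
  - apply in_rk. exists y. split; auto. apply in_suc; auto.
  - intros w Hw. apply IH; auto.
Qed.

Lemma lev_self x : subset x (lev x).
Proof.
  pose proof lev_dfun1 as HL.
  revert x. apply eps_ind; [dsolve|]. intros x IH z Hz. apply in_lev. eauto.
Qed.

Lemma exists_lev z : exists a, ordinal a /\ z ∈ lev a.
Proof.
  exists (suc (rk z)). split; [apply ordinal_suc, rk_ordinal|].
  apply in_lev. exists (rk z). split; [apply in_suc; auto|].
  intros w Hw. apply lev_rk, lev_self, Hw.
Qed.

(** Scott's trick: for each [x] use the least level of the hierarchy that contains a witness. *)
Lemma collection (A : V) (Q : V -> V -> Prop) : dpr2 Q ->
  exists C, forall x, x ∈ A -> (exists z, Q x z) -> exists z, z ∈ C /\ Q x z.
Proof.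
  intros HQ. pose proof lev_dfun1 as HL.
  pose (low := fun x a => ordinal a /\ (exists z, z ∈ lev a /\ Q x z) /\
    forall c, c ∈ a -> ~ exists z, z ∈ lev c /\ Q x z).
  exists (bigcup (rep A (fun x => lev (iota (low x))))). intros x Hx (z & Hz).
  destruct (exists_lev z) as (a & Ha & Hza).
  destruct (least_ordinal (fun a => exists z, z ∈ lev a /\ Q x z) a) as (b & Hb & Pb & Lb);
    eauto; [dsolve|].
  assert (iota (low x) = b) as E.
  { apply iota_eq; [exact (conj Hb (conj Pb Lb))|].
    intros c (Hc & Pc & Lc). destruct (ordinal_trichotomy c Hc b Hb) as [H|[H|H]]; auto.
    - now apply Lb in H.
    - now apply Lc in H. }
  destruct Pb as (w & Hw & Qw). exists w. split; auto.
  apply in_bigcup_rep; [unfold low; dsolve|]. exists x. rewrite E. auto.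
Qed.

Lemma choice_function (A : V) :
  exists c, forall x, x ∈ A -> (exists y, y ∈ x) -> ap c x ∈ x.
Proof.
  pose (A' := sep A (fun x => exists y, y ∈ x)).
  assert (forall x, x ∈ A' <-> x ∈ A /\ exists y, y ∈ x) as HA' by (apply in_sep; dsolve).
  (* The axiom of choice wants pairwise disjoint sets, so each [x] is replaced by its tagged copy
     {x} × x. *)
  destruct (zf_choice V HV (rep A' (fun x => prod (upr x x) x))) as (c & Hc).
  - intros w Hw. apply in_rep in Hw; [|dsolve]. destruct Hw as (x & Hx & ->).
    apply HA' in Hx. destruct Hx as (_ & y & Hy). exists (opr x y). apply in_prod.
    exists x, y. rewrite in_upr. auto.
  - intros w w' z Hw Hw' Hz Hz'.
    apply in_rep in Hw; [|dsolve]. apply in_rep in Hw'; [|dsolve].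
    destruct Hw as (x & _ & ->). destruct Hw' as (x' & _ & ->).
    apply in_prod in Hz, Hz'.
    destruct Hz as (u & v & Hu & _ & E), Hz' as (u' & v' & Hu' & _ & E').
    apply in_upr in Hu, Hu'. rewrite E in E'. apply opr_inj in E'. destruct E' as [E' _].
    assert (x = x') by intuition congruence. now subst.
  - exists (lam A' (fun x => iota (fun y => y ∈ x /\ opr x y ∈ c))).
    intros x Hx Hne. assert (x ∈ A') as Hx' by (now apply HA').
    rewrite ap_lam; [|dsolve|auto].
    destruct (Hc (prod (upr x x) x)) as (p & (Hp & Hpc) & U).
    { apply in_rep; [dsolve|]. eauto. }
    apply in_prod in Hp. destruct Hp as (x' & y & Hx'' & Hy & ->).
    apply in_upr in Hx''. assert (x' = x) as -> by tauto.
    rewrite (iota_eq _ y); auto. intros z [Hz Hzc].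
    assert (opr x y = opr x z) as E.
    { apply U. split; auto. apply in_prod. exists x, z. rewrite in_upr. auto. }
    apply opr_inj in E. now destruct E.
Qed.

(* The selected witness depends on [x] only through [Q x]; this is what transports supports
   to witnesses. *)
Lemma selection (A : V) (Q : V -> V -> Prop) : dpr2 Q ->
  exists k, function_on k A /\ (forall x, x ∈ A -> (exists z, Q x z) -> Q x (ap k x)) /\
  forall x y, x ∈ A -> y ∈ A -> (forall z, Q x z <-> Q y z) -> ap k x = ap k y.
Proof.
  intros HQ. destruct (collection A Q HQ) as (C & HC).
  destruct (choice_function (pow C)) as (c & Hc).
  assert (dfun1 (fun x => ap c (sep C (Q x)))) as HF by dsolve.
  exists (lam A (fun x => ap c (sep C (Q x)))). split; [|split].
  - now apply lam_function.
  - intros x Hx Hz. rewrite ap_lam by auto.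
    assert (forall z, z ∈ sep C (Q x) <-> z ∈ C /\ Q x z) as HS by (apply in_sep; dsolve).
    apply HS. apply Hc.
    + apply in_pow. intros z Hz'. now apply HS.
    + destruct (HC x Hx Hz) as (z & Hzc & Hq). exists z. now apply HS.
  - intros x y Hx Hy H. rewrite !ap_lam by auto. f_equal. apply set_ext. intros z.
    rewrite !in_sep by dsolve. rewrite H. tauto.
Qed.

End Ordinals.

(** * Limit ultrapowers *)

Section Filters.
Context {V : set_structure} {HV : ZFC V}.

Lemma omega_ind (P : V -> Prop) : dpr1 P -> P zero ->
  (forall n, n ∈ omega -> P n -> P (suc n)) -> forall n, n ∈ omega -> P n.
Proof.
  intros HP H0 HS. apply (wf_on_ind omega mem P); auto using wf_on_mem.
  intros n Hn IH. pose proof Hn as Hn'. apply in_omega in Hn'.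
  destruct Hn' as (_ & [E|[y Hy]] & _).
  - apply empty_zero in E. now subst.
  - apply successor_suc in Hy. subst n.
    assert (y ∈ suc y) by (apply in_suc; auto).
    assert (y ∈ omega) by (eapply omega_transitive; eauto). apply HS; auto.
Qed.

(** A witnessing set is asked for, instead of membership of the set of all good points in [E], so
    that this makes sense before [P] is known to be definable. *)
Definition ae (E : V) (P : V -> Prop) : Prop := exists X, X ∈ E /\ forall x, x ∈ X -> P x.

(** A proper filter that is closed under countable intersections; binary intersections come from the
    countable ones in [ae_and]. *)
Definition sfilter (J E : V) : Prop :=
  (forall X, X ∈ E -> subset X J) /\
  (forall X Y, X ∈ E -> subset X Y -> subset Y J -> Y ∈ E) /\
  J ∈ E /\
  (forall X, X ∈ E -> exists x, x ∈ X) /\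
  (forall c, (forall n, n ∈ omega -> ap c n ∈ E) ->
    exists Y, Y ∈ E /\ forall x n, x ∈ Y -> n ∈ omega -> x ∈ ap c n).

(* The members of [S] are functions on [J] standing for the equivalence relations they
   induce; the filter has to decide every set invariant under one of these. *)
Definition supports (J E S : V) : Prop :=
  (exists s, s ∈ S) /\
  (forall s t, s ∈ S -> t ∈ S -> exists u, u ∈ S /\ forall x y, x ∈ J -> y ∈ J ->
    ap u x = ap u y -> ap s x = ap s y /\ ap t x = ap t y) /\
  (forall X s, subset X J -> s ∈ S ->
    (forall x y, x ∈ J -> y ∈ J -> ap s x = ap s y -> x ∈ X -> y ∈ X) ->
    X ∈ E \/ exists Y, Y ∈ E /\ forall x, x ∈ Y -> ~ x ∈ X).

Definition good (J E S : V) : Prop := sfilter J E /\ supports J E S.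

Definition meas (J s f : V) : Prop :=
  forall x y, x ∈ J -> y ∈ J -> ap s x = ap s y -> ap f x = ap f y.

(** These are the functions of a limit ultrapower: constant on the classes of one of the designated
    equivalence relations. *)
Definition adm (J S f : V) : Prop := function_on f J /\ exists s, s ∈ S /\ meas J s f.

Definition memE (E f g : V) : Prop := ae E (fun x => ap f x ∈ ap g x).
Definition eqE (E f g : V) : Prop := ae E (fun x => ap f x = ap g x).

Lemma dfn_ae b (t : (nat -> V) -> V) P : dft b t -> dfn b (fun e => P (fun n => e (S n)) (e 0)) ->
  dfn b (fun e => ae (t e) (P e)).
Proof.
  intros H G; unfold ae; dsolve.
  exact (dfn_ren b _ (fun n => match n with 0 => 0 | S m => S (S m) end) G).
Qed.
Lemma dfn_memE b (t s u : (nat -> V) -> V) : dft b t -> dft b s -> dft b u ->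
  dfn b (fun e => memE (t e) (s e) (u e)).
Proof. intros; unfold memE; apply dfn_ae; dsolve. Qed.
Lemma dfn_eqE b (t s u : (nat -> V) -> V) : dft b t -> dft b s -> dft b u ->
  dfn b (fun e => eqE (t e) (s e) (u e)).
Proof. intros; unfold eqE; apply dfn_ae; dsolve. Qed.
Lemma dfn_good b (t s u : (nat -> V) -> V) : dft b t -> dft b s -> dft b u ->
  dfn b (fun e => good (t e) (s e) (u e)).
Proof. intros; unfold good, sfilter, supports; dsolve. Qed.
Lemma dfn_adm b (t s u : (nat -> V) -> V) : dft b t -> dft b s -> dft b u ->
  dfn b (fun e => adm (t e) (s e) (u e)).
Proof. intros; unfold adm, meas; dsolve. Qed.

End Filters.

Ltac dfilters := match goal with
  | |- dfn _ (fun e => ae _ _) => apply dfn_ae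
  | |- dfn _ (fun e => memE _ _ _) => apply dfn_memE
  | |- dfn _ (fun e => eqE _ _ _) => apply dfn_eqE
  | |- dfn _ (fun e => good _ _ _) => apply dfn_good
  | |- dfn _ (fun e => adm _ _ _) => apply dfn_adm
  end.
Ltac dhook ::= first [dsets | dords | dfilters].

Section Sfilter.
Context {V : set_structure} {HV : ZFC V}.
Variables (J E : V).
Hypothesis HE : sfilter J E.

Lemma ae_mono (P Q : V -> Prop) : (forall x, x ∈ J -> P x -> Q x) -> ae E P -> ae E Q.
Proof.
  intros H (X & HX & HP). exists X. split; auto. intros x Hx. apply H; auto.
  now apply (proj1 HE X).
Qed.

Lemma ae_all (P : V -> Prop) : (forall x, x ∈ J -> P x) -> ae E P.
Proof. intros H. exists J. split; [apply HE|auto]. Qed.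

Lemma ae_ex (P : V -> Prop) : ae E P -> exists x, x ∈ J /\ P x.
Proof.
  intros (X & HX & HP). destruct (proj1 (proj2 (proj2 (proj2 HE))) X HX) as (x & Hx).
  exists x. split; auto. now apply (proj1 HE X).
Qed.

Lemma ae_const (P : Prop) : ae E (fun _ => P) <-> P.
Proof.
  split.
  - intros H. apply ae_ex in H. now destruct H as (_ & _ & H).
  - intros H. now apply ae_all.
Qed.

Lemma ae_sep P : dpr1 P -> ae E P <-> sep J P ∈ E.
Proof.
  intros HP. split.
  - intros (X & HX & H). apply (proj1 (proj2 HE) X); auto; intros x Hx.
    + apply in_sep; auto. split; auto. now apply (proj1 HE X).
    + apply in_sep in Hx; tauto.
  - intros H. exists (sep J P). split; auto. intros x Hx. apply in_sep in Hx; tauto.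
Qed.

Lemma ae_omega (P : V -> V -> Prop) : dpr2 P -> (forall n, n ∈ omega -> ae E (P n)) ->
  ae E (fun x => forall n, n ∈ omega -> P n x).
Proof.
  intros HP H.
  destruct (proj2 (proj2 (proj2 (proj2 HE))) (lam omega (fun n => sep J (P n)))) as (Y & HY & K).
  - intros n Hn. rewrite ap_lam; [|dsolve|auto]. apply ae_sep; auto. dsolve.
  - exists Y. split; auto. intros x Hx n Hn. specialize (K x n Hx Hn).
    rewrite ap_lam in K; [|dsolve|auto]. apply in_sep in K; [tauto|dsolve].
Qed.

Lemma ae_and (P Q : V -> Prop) : ae E P -> ae E Q -> ae E (fun x => P x /\ Q x).
Proof.
  intros (X & HX & HP) (Y & HY & HQ).
  (* This is the countable sequence X, Y, Y, Y, ... *)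
  destruct (ae_omega (fun n x => (n = zero -> x ∈ X) /\ (n <> zero -> x ∈ Y))) as (Z & HZ & K).
  - dsolve.
  - intros n Hn. destruct (classic (n = zero)).
    + exists X. split; auto. tauto.
    + exists Y. split; auto. tauto.
  - exists Z. split; auto. intros x Hx. split.
    + apply HP. now apply (K x Hx zero omega_zero).
    + apply HQ. apply (K x Hx (suc zero) (omega_suc _ omega_zero)).
      intros G. apply (in_zero (zero : V)). rewrite <- G at 2. apply in_suc. auto.
Qed.

Lemma ae_mono2 (P Q R : V -> Prop) : (forall x, x ∈ J -> P x -> Q x -> R x) ->
  ae E P -> ae E Q -> ae E R.
Proof.
  intros H HP HQ. apply (ae_mono (fun x => P x /\ Q x)); [|now apply ae_and].
  intros x Hx [? ?]; auto.
Qed.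

Lemma ae_contra (P : V -> Prop) : ae E P -> ae E (fun x => ~ P x) -> False.
Proof. intros HP HQ. destruct (ae_ex _ (ae_and _ _ HP HQ)) as (x & _ & H). tauto. Qed.

(** If there were no minimal element, an infinite descending sequence of functions could be chosen
    inside V. By countable completeness it would descend at one single point, against Foundation. *)
Lemma memE_wf A : wf_on A (memE E).
Proof.
  intros B _ (f0 & Hf0). apply NNPP. intros N.
  destruct (selection B (fun f g => g ∈ B /\ memE E g f)) as (k & _ & Hk & _); [dsolve|].
  assert (forall f, f ∈ B -> ap k f ∈ B /\ memE E (ap k f) f) as Hk'.
  { intros f Hf. apply Hk; auto. apply NNPP. intros M. apply N. exists f. split; auto.
    intros g Hg Hgf. apply M. eauto. }
  destruct (recursion omega mem (fun n u => ite (n = zero) f0 (ap k (ap u (bigcup n)))))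
    as (h & _ & Hh); [dsolve|dsolve|apply wf_on_mem|].
  assert (ap h zero = f0) as h0.
  { rewrite Hh by apply omega_zero. now apply ite_true. }
  assert (forall n, n ∈ omega -> ap h (suc n) = ap k (ap h n)) as hS.
  { intros n Hn. rewrite Hh by (now apply omega_suc). rewrite ite_false.
    - rewrite bigcup_suc; [|apply in_omega in Hn; exact (proj1 (proj1 Hn))].
      rewrite ap_lam; [auto|dsolve|]. apply in_sep; [dsolve|].
      split; auto. apply in_suc; auto.
    - intros G. apply (in_zero n). rewrite <- G. apply in_suc; auto. }
  assert (forall n, n ∈ omega -> ap h n ∈ B) as hB.
  { apply (omega_ind (fun n => ap h n ∈ B)); [dsolve| |].
    - now rewrite h0.
    - intros n Hn IH. rewrite hS by auto. now apply Hk'. }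
  destruct (ae_ex (fun x => forall n, n ∈ omega -> ap (ap h (suc n)) x ∈ ap (ap h n) x))
    as (x & _ & Hx).
  { apply ae_omega; [dsolve|]. intros n Hn. rewrite hS by auto. now apply Hk', hB. }
  destruct (zf_foundation V HV (rep omega (fun n => ap (ap h n) x))) as (y & Hy & Hmin).
  - exists (ap (ap h zero) x). apply in_rep; [dsolve|]. exists zero. auto using omega_zero.
  - apply in_rep in Hy; [|dsolve]. destruct Hy as (n & Hn & ->).
    apply (Hmin (ap (ap h (suc n)) x)); auto.
    apply in_rep; [dsolve|]. exists (suc n). auto using omega_suc.
Qed.
End Sfilter.

(** * The Mostowski collapse of admissible functions *)

Section Collapse.
Context {V : set_structure} {HV : ZFC V}.

(** The admissible functions form a proper class. The collapse is therefore computed on the set of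
    those with values in a transitive set [T], and [collapsing_unique] shows that the choice of [T]
    does not matter. *)
Definition Fn (J S T : V) : V := sep (funs J T) (adm J S).

Definition collapsing (J E S T h : V) : Prop := forall g u, g ∈ Fn J S T ->
  u ∈ ap h g <-> exists k, k ∈ Fn J S T /\ memE E k g /\ u = ap h k.

Definition col (J E S f : V) : V := iota (fun y => exists T h,
  transitive_set T /\ f ∈ Fn J S T /\ collapsing J E S T h /\ y = ap h f).

Definition uclass (J E S y : V) : Prop := exists f, adm J S f /\ y = col J E S f.

Lemma dft_Fn b (t s u : (nat -> V) -> V) : dft b t -> dft b s -> dft b u ->
  dft b (fun e => Fn (t e) (s e) (u e)).
Proof. intros; unfold Fn; dsolve. Qed.

Lemma dft_col b (t s u v : (nat -> V) -> V) : dft b t -> dft b s -> dft b u -> dft b v ->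
  dft b (fun e => col (t e) (s e) (u e) (v e)).
Proof. intros; unfold col, collapsing; dsolve; apply dft_Fn; dsolve. Qed.

Lemma dfn_uclass b (t s u v : (nat -> V) -> V) : dft b t -> dft b s -> dft b u -> dft b v ->
  dfn b (fun e => uclass (t e) (s e) (u e) (v e)).
Proof. intros; unfold uclass; dsolve; apply dft_col; dsolve. Qed.
End Collapse.

Ltac dcol := match goal with
  | |- dft _ (fun e => col _ _ _ _) => apply dft_col
  | |- dfn _ (fun e => uclass _ _ _ _) => apply dfn_uclass
  end.
Ltac dhook ::= first [dsets | dords | dfilters | dcol].

(** * The collapsed limit ultrapower and Los's theorem *)

Section LimitUltrapower.
Context {V : set_structure} {HV : ZFC V}.
Variables (J E S : V).
Hypothesis HG : good J E S.
Let HE : sfilter J E := proj1 HG.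

Lemma ae_dec (P : V -> Prop) s : dpr1 P -> s ∈ S ->
  (forall x y, x ∈ J -> y ∈ J -> ap s x = ap s y -> P x -> P y) ->
  ae E P \/ ae E (fun x => ~ P x).
Proof.
  intros HP Hs Hinv. destruct (proj2 HG) as (_ & _ & H).
  destruct (H (sep J P) s) as [K|(Y & HY & K)].
  - intros x Hx. apply in_sep in Hx; tauto.
  - exact Hs.
  - intros x y Hx Hy Hxy. rewrite !in_sep by auto. intros [_ G]. split; eauto.
  - left. now apply (ae_sep J E HE).
  - right. exists Y. split; auto. intros x Hx Px. apply (K x Hx). apply in_sep; auto. split; auto.
    now apply (proj1 HE Y).
Qed.

(** The number [n] is external: it bounds the free variables of a formula, so finitely many
    functions in the sense of the metatheory have to share a support. *)
Lemma join_supports (n : nat) (f : nat -> V) : (forall k, k < n -> adm J S (f k)) ->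
  exists s, s ∈ S /\ forall k, k < n -> meas J s (f k).
Proof.
  induction n as [|n IH]; intros H.
  - destruct (proj2 HG) as ([s Hs] & _). exists s. split; auto. intros k Hk. lia.
  - destruct IH as (s & Hs & Ks); auto.
    destruct (H n) as (_ & t & Ht & Kt); auto.
    destruct (proj1 (proj2 (proj2 HG)) s t Hs Ht) as (u & Hu & K).
    exists u. split; auto. intros k Hk x y Hx Hy Hxy. destruct (K x y Hx Hy Hxy).
    destruct (Nat.eq_dec k n) as [->|]; [apply Kt|apply Ks]; auto. lia.
Qed.

Lemma join_supports2 f g : adm J S f -> adm J S g ->
  exists s, s ∈ S /\ meas J s f /\ meas J s g.
Proof.
  intros Hf Hg. destruct (join_supports 2 (scons f (fun _ => g))) as (s & Hs & K).
  - intros [|k] _; auto.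
  - exists s. split; auto. split; [apply (K 0)|apply (K 1)]; lia.
Qed.

Lemma adm_lam2 F f g : dfun2 F -> adm J S f -> adm J S g ->
  adm J S (lam J (fun x => F (ap f x) (ap g x))).
Proof.
  intros HF Hf Hg. destruct (join_supports2 f g Hf Hg) as (s & Hs & K1 & K2).
  split; [apply lam_function; dsolve|]. exists s. split; auto.
  intros x y Hx Hy Hxy. rewrite !ap_lam by (dsolve || auto).
  rewrite (K1 x y), (K2 x y); auto.
Qed.

Lemma adm_const a : adm J S (lam J (fun _ => a)).
Proof.
  split; [apply lam_function; dsolve|]. destruct (proj2 HG) as ([s Hs] & _).
  exists s. split; auto. intros x y Hx Hy _. rewrite !ap_lam by (dsolve || auto). reflexivity.
Qed.

Lemma adm_selection (Q : V -> V -> Prop) s : dpr2 Q -> s ∈ S ->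
  (forall x y, x ∈ J -> y ∈ J -> ap s x = ap s y -> forall z, Q x z <-> Q y z) ->
  exists k, adm J S k /\ forall x, x ∈ J -> (exists z, Q x z) -> Q x (ap k x).
Proof.
  intros HQ Hs H. destruct (selection J Q HQ) as (k & K1 & K2 & K3).
  exists k. split; auto. split; auto. exists s. split; auto.
  intros x y Hx Hy Hxy. apply K3; auto.
Qed.

Lemma in_Fn T f : f ∈ Fn J S T <-> adm J S f /\ forall x, x ∈ J -> ap f x ∈ T.
Proof.
  unfold Fn. rewrite in_sep by dsolve. rewrite in_funs. unfold adm. tauto.
Qed.

Lemma exists_Fn f : adm J S f -> exists T, transitive_set T /\ f ∈ Fn J S T.
Proof.
  intros Hf. destruct (transitive_closure (rep J (ap f))) as (T & HT & H).
  exists T. split; auto. apply in_Fn. split; auto. intros x Hx. apply H.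
  apply in_rep; [dsolve|eauto].
Qed.

Lemma exists_collapsing T : exists h, collapsing J E S T h.
Proof.
  destruct (recursion (Fn J S T) (memE E)
    (fun g u => rep (sep (Fn J S T) (fun k => memE E k g)) (fun k => ap u k)))
    as (h & _ & Hh); [dsolve|dsolve|now apply (memE_wf J)|].
  exists h. intros g u Hg. rewrite Hh by auto. rewrite in_rep by dsolve.
  split.
  - intros (k & Hk & ->). pose proof Hk as Hk'. apply in_sep in Hk'; [|dsolve].
    exists k. rewrite ap_lam; [tauto|dsolve|auto].
  - intros (k & Hk & Hkg & ->). exists k.
    assert (k ∈ sep (Fn J S T) (fun k => memE E k g)) by (apply in_sep; [dsolve|auto]).
    rewrite ap_lam; [auto|dsolve|auto].
Qed.

(** Where [k] is below [g] its values already lie in [T]; elsewhere, on a negligible set, they are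
    replaced by the values of [g]. Restricting to [T] therefore loses no member of the class of
    [g]. *)
Lemma restrict_below T g k : transitive_set T -> g ∈ Fn J S T -> adm J S k -> memE E k g ->
  exists k', k' ∈ Fn J S T /\ eqE E k' k.
Proof.
  intros HT Hg Hk Hkg. apply in_Fn in Hg. destruct Hg as [Hg Hg'].
  pose (F := fun a b : V => ite (a ∈ b) a b).
  exists (lam J (fun x => F (ap k x) (ap g x))). split.
  - apply in_Fn. split; [apply adm_lam2; unfold F; auto; dsolve|].
    intros x Hx. rewrite ap_lam; [|unfold F; dsolve|auto]. unfold F.
    destruct (classic (ap k x ∈ ap g x)).
    + rewrite ite_true by auto. apply (HT (ap g x)); auto.
    + rewrite ite_false; auto.
  - revert Hkg. apply (ae_mono J E HE). intros x Hx H.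
    rewrite ap_lam; [|unfold F; dsolve|auto]. now apply ite_true.
Qed.

Lemma eqE_sym f g : eqE E f g -> eqE E g f.
Proof. apply (ae_mono J E HE). congruence. Qed.
Lemma memE_eqE f f' g g' : eqE E f f' -> eqE E g g' -> memE E f g -> memE E f' g'.
Proof.
  intros H1 H2 H3. generalize (ae_and J E HE _ _ H1 H2) H3. apply (ae_mono2 J E HE).
  intros x _ [-> ->]. auto.
Qed.
Lemma eqE_refl f : eqE E f f.
Proof. now apply (ae_all J E HE). Qed.

(** By [restrict_below], the members of [g] and of [g'] correspond modulo [E], and corresponding
    members collapse to the same set by induction. *)
Lemma collapsing_unique T h T' h' : transitive_set T -> transitive_set T' ->
  collapsing J E S T h -> collapsing J E S T' h' ->
  forall g, g ∈ Fn J S T -> forall g', g' ∈ Fn J S T' -> eqE E g g' -> ap h g = ap h' g'.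
Proof.
  intros HT HT' Hh Hh'.
  apply (wf_on_ind (Fn J S T) (memE E) (fun g => forall g', g' ∈ Fn J S T' ->
    eqE E g g' -> ap h g = ap h' g')); [now apply (memE_wf J)|dsolve|].
  intros g Hg IH g' Hg' Hgg'. apply set_ext. intros u. rewrite (Hh g), (Hh' g') by auto.
  split; intros (k & Hk & Hkg & ->).
  - destruct (restrict_below T' g' k) as (k' & Hk' & Ek); auto.
    + now apply in_Fn in Hk.
    + exact (memE_eqE _ _ _ _ (eqE_refl k) Hgg' Hkg).
    + exists k'. split; auto. split.
      * apply (memE_eqE k k' g g'); auto. now apply eqE_sym.
      * apply IH; auto. now apply eqE_sym.
  - destruct (restrict_below T g k) as (k' & Hk' & Ek); auto.
    + now apply in_Fn in Hk.
    + apply (memE_eqE k k g' g); auto using eqE_refl, eqE_sym.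
    + exists k'. assert (memE E k' g) as Hm.
      { apply (memE_eqE k k' g' g); auto using eqE_sym. }
      split; auto. split; auto. symmetry. apply IH; auto.
Qed.

Lemma col_eq_ap T h f : transitive_set T -> f ∈ Fn J S T -> collapsing J E S T h ->
  col J E S f = ap h f.
Proof.
  intros HT Hf Hh. apply iota_eq.
  - exists T, h. auto.
  - intros z (T' & h' & HT' & Hf' & Hh' & ->).
    apply (collapsing_unique T' h' T h); auto using eqE_refl.
Qed.

Lemma eqE_col f g : adm J S f -> adm J S g -> eqE E f g -> col J E S f = col J E S g.
Proof.
  intros Hf Hg H. destruct (exists_Fn f Hf) as (T & HT & Hf').
  destruct (exists_Fn g Hg) as (T' & HT' & Hg').
  destruct (exists_collapsing T) as (h & Hh). destruct (exists_collapsing T') as (h' & Hh').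
  rewrite (col_eq_ap T h), (col_eq_ap T' h') by auto.
  apply (collapsing_unique T h T' h'); auto.
Qed.

Lemma in_col f u : adm J S f ->
  u ∈ col J E S f <-> exists g, adm J S g /\ memE E g f /\ u = col J E S g.
Proof.
  intros Hf. destruct (exists_Fn f Hf) as (T & HT & Hf').
  destruct (exists_collapsing T) as (h & Hh).
  rewrite (col_eq_ap T h) by auto. rewrite (Hh f) by auto. split.
  - intros (k & Hk & Hkf & ->). exists k. rewrite (col_eq_ap T h) by auto.
    apply in_Fn in Hk. tauto.
  - intros (k & Hk & Hkf & ->). destruct (restrict_below T f k) as (k' & Hk' & Ek); auto.
    exists k'. split; auto. split.
    + apply (memE_eqE k k' f f); auto using eqE_refl, eqE_sym.
    + rewrite <- (col_eq_ap T h) by auto. apply eqE_col; auto using eqE_sym.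
      now apply in_Fn in Hk'.
Qed.

Lemma uclass_transitive : transitive_class (uclass J E S).
Proof.
  intros x y (f & Hf & ->) Hy. apply in_col in Hy; auto.
  destruct Hy as (g & Hg & _ & ->). exists g; auto.
Qed.

(** The model is already collapsed, so Foundation in V is enough; countable completeness was spent
    on the existence of the collapse. *)
Lemma uclass_well_founded : well_founded_class (uclass J E S).
Proof.
  intros a (x & Hx & Mx). destruct (zf_foundation V HV (sep a (uclass J E S))) as (y & Hy & H).
  - exists x. apply in_sep; [dsolve|auto].
  - apply in_sep in Hy; [|dsolve]. exists y. split; [tauto|]. split; [tauto|].
    intros z Hz Mz. apply H. apply in_sep; [dsolve|auto].
Qed.

(** Extensionality before collapsing. An element of the symmetric difference is selected pointwise,
    so that it has the common support of [f] and [g]; the filter then decides on which side it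
    lies. *)
Lemma ae_diff_witness f g : adm J S f -> adm J S g -> ~ eqE E f g ->
  exists k, adm J S k /\ (memE E k f /\ ~ memE E k g \/ memE E k g /\ ~ memE E k f).
Proof.
  intros Hf Hg N. destruct (join_supports2 f g Hf Hg) as (s & Hs & K1 & K2).
  destruct (ae_dec (fun x => ap f x = ap g x) s) as [K|K]; auto.
  { dsolve. }
  { intros x y Hx Hy Hxy. rewrite (K1 x y), (K2 x y); auto. }
  - contradiction.
  - destruct (adm_selection (fun x z => z ∈ ap f x /\ ~ z ∈ ap g x \/
      z ∈ ap g x /\ ~ z ∈ ap f x) s) as (k & Hk & Kk); auto.
    + dsolve.
    + intros x y Hx Hy Hxy z. rewrite (K1 x y), (K2 x y); auto. tauto.
    + exists k. split; auto.
      assert (ae E (fun x => ap k x ∈ ap f x /\ ~ ap k x ∈ ap g x \/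
        ap k x ∈ ap g x /\ ~ ap k x ∈ ap f x)) as L.
      { revert K. apply (ae_mono J E HE). intros x Hx D. apply Kk; auto.
        apply NNPP. intros M. apply D, set_ext. intros z.
        split; intros Hz; apply NNPP; intros Hz'; apply M; exists z; tauto. }
      destruct (join_supports 3 (fun n => match n with 0 => f | 1 => g | _ => k end))
        as (t & Ht & Kt).
      { intros [|[|n]] _; auto. }
      pose proof (Kt 0 ltac:(lia)) as T0. pose proof (Kt 1 ltac:(lia)) as T1.
      pose proof (Kt 2 ltac:(lia)) as T2. simpl in T0, T1, T2.
      destruct (ae_dec (fun x => ap k x ∈ ap f x) t) as [M|M]; auto.
      { dsolve. }
      { intros x y Hx Hy Hxy. rewrite (T0 x y), (T2 x y); auto. }
      * left. split; auto. intros M'. apply (ae_contra J E HE _ M').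
        generalize L M. apply (ae_mono2 J E HE). tauto.
      * right. split.
        -- generalize L M. apply (ae_mono2 J E HE). tauto.
        -- intros M'. exact (ae_contra J E HE _ M' M).
Qed.

Lemma col_inj : forall y f g, adm J S f -> adm J S g -> y = col J E S f -> y = col J E S g ->
  eqE E f g.
Proof.
  apply (eps_ind (fun y => forall f g, adm J S f -> adm J S g -> y = col J E S f ->
    y = col J E S g -> eqE E f g)); [dsolve|].
  assert (forall y, (forall z, z ∈ y -> forall f g, adm J S f -> adm J S g ->
    z = col J E S f -> z = col J E S g -> eqE E f g) -> forall f g k, adm J S f -> adm J S g ->
    y = col J E S f -> y = col J E S g -> adm J S k -> memE E k f -> memE E k g) as K.
  { intros y IH f g k Hf Hg Ef Eg Hk Hkf.
    assert (col J E S k ∈ y) as Hy by (subst y; apply in_col; eauto).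
    pose proof Hy as Hy'. rewrite Eg in Hy'. apply in_col in Hy'; auto.
    destruct Hy' as (k' & Hk' & Hk'g & Ek').
    apply (memE_eqE k' k g g); auto using eqE_refl. apply (IH _ Hy); auto. }
  intros y IH f g Hf Hg Ef Eg. apply NNPP. intros N.
  destruct (ae_diff_witness f g Hf Hg N) as (k & Hk & [[H1 H2]|[H1 H2]]); apply H2.
  - apply (K y IH f g); auto.
  - apply (K y IH g f); auto.
Qed.

Lemma col_eq f g : adm J S f -> adm J S g -> col J E S f = col J E S g <-> eqE E f g.
Proof.
  intros Hf Hg. split.
  - intros H. apply (col_inj (col J E S f)); auto.
  - now apply eqE_col.
Qed.

Lemma col_mem f g : adm J S f -> adm J S g -> col J E S f ∈ col J E S g <-> memE E f g.
Proof.
  intros Hf Hg. rewrite in_col by auto. split.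
  - intros (k & Hk & Hkg & H). apply col_eq in H; auto.
    apply (memE_eqE k f g g); auto using eqE_refl, eqE_sym.
  - intros H. exists f. auto.
Qed.

(** Only finitely many variables occur in [p], so a single support makes its truth set invariant and
    the filter decides it. In the quantifier case a counterexample is selected with that same
    support and is therefore admissible. *)
Lemma los p : forall F, (forall n, adm J S (F n)) ->
  sat (uclass J E S) (fun n => col J E S (F n)) p <->
  ae E (fun x => sat universe (fun n => ap (F n) x) p).
Proof.
  assert (forall p F, (forall n, adm J S (F n)) -> exists s, s ∈ S /\
    forall x y, x ∈ J -> y ∈ J -> ap s x = ap s y -> forall z,
    sat universe (scons z (fun n => ap (F n) x)) p <->
    sat universe (scons z (fun n => ap (F n) y)) p) as Hinv.
  { clear p. intros p F HF. destruct (free_below_exists p) as (n & Hn).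
    destruct (join_supports n F) as (s & Hs & K); auto. exists s. split; auto.
    intros x y Hx Hy Hxy z. apply (sat_local _ p n); auto. intros [|k] Hk; simpl; auto.
    apply K; auto. lia. }
  assert (forall p F, (forall n, adm J S (F n)) -> exists s, s ∈ S /\
    forall x y, x ∈ J -> y ∈ J -> ap s x = ap s y ->
    sat universe (fun n => ap (F n) x) p -> sat universe (fun n => ap (F n) y) p) as Hinv'.
  { clear p. intros p F HF. destruct (free_below_exists p) as (n & Hn).
    destruct (join_supports n F) as (s & Hs & K); auto. exists s. split; auto.
    intros x y Hx Hy Hxy. apply (sat_local _ p n); auto. intros k Hk.
    apply K; auto. }
  induction p; intros F HF; simpl.
  - now apply col_mem.
  - now apply col_eq.
  - split; [tauto|]. intros H. exact (proj1 (ae_const J E HE False) H).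
  - rewrite IHp1, IHp2 by auto. split.
    + intros H. destruct (Hinv' p1 F HF) as (s & Hs & Ks).
      destruct (ae_dec (fun x => sat universe (fun n => ap (F n) x) p1) s) as [K|K]; auto.
      { intros t Ht. apply (dfn_sat true p1 (fun n e => ap (F n) (t e))). intros n. dsolve. }
      * specialize (H K). revert H. apply (ae_mono J E HE). auto.
      * revert K. apply (ae_mono J E HE). tauto.
    + intros H K. generalize H K. apply (ae_mono2 J E HE). auto.
  - assert (forall g x, sat universe (fun n => ap (scons g F n) x) p <->
      sat universe (scons (ap g x) (fun n => ap (F n) x)) p) as Hs1.
    { intros g x. replace (fun n => ap (scons g F n) x) with
        (scons (ap g x) (fun n => ap (F n) x)); [tauto|].
      apply functional_extensionality. now intros [|n]. }
    assert (forall g, sat (uclass J E S) (fun n => col J E S (scons g F n)) p <->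
      sat (uclass J E S) (scons (col J E S g) (fun n => col J E S (F n))) p) as Hs2.
    { intros g. replace (fun n => col J E S (scons g F n)) with
        (scons (col J E S g) (fun n => col J E S (F n))); [tauto|].
      apply functional_extensionality. now intros [|n]. }
    assert (forall g, adm J S g -> forall n, adm J S (scons g F n)) as HF'.
    { intros g Hg [|n]; simpl; auto. }
    destruct (Hinv p F HF) as (s & Hs & Ks).
    pose (Q := fun x z => sat universe (scons z (fun n => ap (F n) x)) p).
    assert (dpr2 Q) as Hdef.
    { unfold Q. intros t u Ht Hu.
      pose (ts := fun n => match n with 0 => u | Datatypes.S m => fun e => ap (F m) (t e) end).
      eapply dfn_iff; [|apply (dfn_sat true p ts)].
      - intros e. cbn beta. replace (fun n => ts n e) with
          (scons (u e) (fun n => ap (F n) (t e))); [tauto|].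
        apply functional_extensionality; now intros [|n].
      - intros [|n]; simpl; dsolve. }
    split.
    + intros H. apply NNPP. intros N.
      destruct (ae_dec (fun x => forall z, Q x z) s) as [K|K]; auto.
      { dsolve. }
      { intros x y Hx Hy Hxy G z. apply (Ks x y Hx Hy Hxy z), G. }
      { apply N. revert K. apply (ae_mono J E HE). intros x _ K z _. apply K. }
      destruct (adm_selection (fun x z => ~ Q x z) s) as (k & Hk & Kk); auto.
      { dsolve. }
      { intros x y Hx Hy Hxy z. unfold Q. rewrite (Ks x y Hx Hy Hxy z). tauto. }
      assert (ae E (fun x => sat universe (fun n => ap (scons k F n) x) p)) as G.
      { apply IHp; auto. apply Hs2. apply H. exists k; auto. }
      apply (ae_contra J E HE _ G). revert K. apply (ae_mono J E HE).
      intros x Hx D. rewrite Hs1. apply Kk; auto. apply NNPP. intros M. apply D.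
      intros z. apply NNPP. intros M'. apply M. eauto.
    + intros H y (g & Hg & ->). apply Hs2, IHp; auto. revert H.
      apply (ae_mono J E HE). intros x Hx H. apply Hs1. apply H. exact Logic.I.
Qed.

Definition emb (a : V) : V := col J E S (lam J (fun _ => a)).

Lemma emb_elementary p e : sat (uclass J E S) (fun n => emb (e n)) p <-> sat universe e p.
Proof.
  unfold emb. rewrite (los p (fun n => lam J (fun _ => e n))) by (intros; apply adm_const).
  rewrite <- (ae_const J E HE (sat universe e p)).
  split; apply (ae_mono J E HE); intros x Hx;
  replace (fun n => ap (lam J (fun _ => e n)) x) with e; auto;
  apply functional_extensionality; intros n; (rewrite ap_lam; [auto|dsolve|auto]).
Qed.

Lemma uclass_theory : same_theory (uclass J E S) universe.
Proof.
  intros p Hp e e'. destruct ZFC_inhabited as [d].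
  rewrite <- (emb_elementary p e'). apply (sat_local _ p 0); auto. intros k Hk; lia.
Qed.
End LimitUltrapower.

Definition reindex {V : set_structure} {HV : ZFC V} (J' h f : V) : V :=
  lam J' (fun x => ap f (ap h x)).

Lemma reindex_elementary {V : set_structure} {HV : ZFC V} J E S J' E' S' h :
  good J E S -> good J' E' S' ->
  (forall x, x ∈ J' -> ap h x ∈ J) ->
  (forall f, adm J S f -> adm J' S' (reindex J' h f)) ->
  (forall X, X ∈ E -> ae E' (fun x => ap h x ∈ X)) ->
  exists j, elementary_embedding (uclass J E S) (uclass J' E' S') j.
Proof.
  intros HG HG' Hh Hadm HX.
  assert (dfun1 (reindex J' h)) as HR by (unfold reindex; dsolve).
  (* The given direction carries large sets to large sets. The converse holds because [E] decides
     the set: if it were negligible for [E], its complement would be carried over too. *)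
  assert (forall P s, dpr1 P -> s ∈ S ->
    (forall x y, x ∈ J -> y ∈ J -> ap s x = ap s y -> P x -> P y) ->
    ae E P <-> ae E' (fun x => P (ap h x))) as Hae.
  { intros P s HP Hs Hinv.
    assert (forall Q, ae E Q -> ae E' (fun x => Q (ap h x))) as K.
    { intros Q (X & HX' & HQ). generalize (HX X HX').
      apply (ae_mono J' E' (proj1 HG')). auto. }
    split; auto. intros H. destruct (ae_dec J E S HG P s) as [L|L]; auto.
    apply K in L. destruct (ae_contra J' E' (proj1 HG') _ H L). }
  pose (j := fun y => iota (fun z => exists f, adm J S f /\ y = col J E S f /\
    z = col J' E' S' (reindex J' h f))).
  assert (dfun1 j) as Hj by (unfold j; dsolve).
  assert (forall f, adm J S f -> j (col J E S f) = col J' E' S' (reindex J' h f)) as jE.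
  { intros f Hf. apply iota_eq; [eauto|]. intros z (g & Hg & Efg & ->).
    apply (col_eq J' E' S' HG'); auto. apply (col_eq J E S HG) in Efg; auto.
    destruct (join_supports2 J E S HG f g Hf Hg) as (s & Hs & K1 & K2).
    unfold eqE in Efg. rewrite (Hae _ s) in Efg; auto.
    - revert Efg. apply (ae_mono J' E' (proj1 HG')). intros x Hx H. unfold reindex.
      rewrite !ap_lam; auto; dsolve.
    - dsolve.
    - intros x y Hx Hy Hxy. rewrite (K1 x y), (K2 x y); auto. }
  exists j. split; [|split].
  - apply definable_2. dsolve.
  - intros x (f & Hf & ->). rewrite jE by auto. exists (reindex J' h f). auto.
  - intros p e He.
    (* The representatives are picked by choice in the metatheory. The resulting sequence need not
       belong to V, and [los] does not ask for that. *)
    destruct (choice (fun n f => adm J S f /\ e n = col J E S f)) as (F & HF).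
    { intros n. destruct (He n) as (f & Hf & E0). eauto. }
    assert (forall n, adm J S (F n)) as HF' by (intros n; apply HF).
    replace e with (fun n => col J E S (F n)) at 1
      by (apply functional_extensionality; intros n; symmetry; apply HF).
    replace (fun n => j (e n)) with (fun n => col J' E' S' (reindex J' h (F n)))
      by (apply functional_extensionality; intros n; rewrite (proj2 (HF n)), jE; auto).
    rewrite (los J E S HG p F HF'), (los J' E' S' HG' p) by auto.
    destruct (free_below_exists p) as (n & Hn).
    destruct (join_supports J E S HG n F) as (s & Hs & K); auto.
    rewrite (Hae _ s); auto.
    + assert (forall x, x ∈ J' -> (fun n => ap (reindex J' h (F n)) x) =
        (fun n => ap (F n) (ap h x))) as L.
      { intros x Hx. apply functional_extensionality. intros m. unfold reindex.
        rewrite ap_lam; auto; dsolve. }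
      split; apply (ae_mono J' E' (proj1 HG')); intros x Hx; rewrite L by auto; auto.
    + intros t Ht. apply (dfn_sat true p (fun n e => ap (F n) (t e))). intros m. dsolve.
    + intros x y Hx Hy Hxy. apply (sat_local _ p n); auto. intros k Hk. apply K; auto.
Qed.

(** * Ultrapower embeddings on ordinals *)

Section EmbeddingsOnOrdinals.
Context {V : set_structure} {HV : ZFC V}.

Lemma sat_class_ext (M N : V -> Prop) p : (forall x, M x <-> N x) ->
  forall e, sat M e p <-> sat N e p.
Proof.
  intros H. induction p; intros e; simpl; try tauto.
  - rewrite IHp1, IHp2. tauto.
  - split; intros K x Hx; apply IHp, K, H, Hx.
Qed.

(** The filters and supports are quantified and not fixed, so that this class of sets is definable
    without parameters. *)
Definition disagree (a : V) : Prop := exists J E S J' E' S', good J E S /\ good J' E' S' /\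
  (forall y, uclass J E S y <-> uclass J' E' S' y) /\ emb J E S a <> emb J' E' S' a.

(* A least ordinal on which the embeddings disagree would be definable without parameters,
   so both embeddings would send it to the ordinal with that definition in the common
   target model. *)
Lemma emb_unique J E S J' E' S' a : good J E S -> good J' E' S' ->
  (forall y, uclass J E S y <-> uclass J' E' S' y) -> ordinal a ->
  emb J E S a = emb J' E' S' a.
Proof.
  intros HG HG' HU Ha. apply NNPP. intros N.
  assert (forall b t, dft b t -> dfn b (fun e => disagree (t e))) as Hdis.
  { intros b t Ht. unfold disagree, emb. dsolve. }
  pose (least := fun a => ordinal a /\ disagree a /\ forall c, c ∈ a -> ~ disagree c).
  destruct (least_ordinal disagree a) as (b & Hb & Db & Lb); auto.
  { intros t. apply Hdis. }
  { exists J, E, S, J', E', S'. auto. }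
  assert (forall b c, least b -> least c -> b = c) as Huniq.
  { intros x y (Hx & Dx & Lx) (Hy & Dy & Ly).
    destruct (ordinal_trichotomy x Hx y Hy) as [K|[K|K]]; auto; exfalso.
    - exact (Ly x K Dx).
    - exact (Lx y K Dy). }
  destruct (dfn_formula least) as (p & Hp).
  { unfold least. dsolve; apply Hdis; dsolve. }
  (* The least ordinal [b] of disagreement may owe this to filters other than the given ones, so
     those are discarded and the ones attached to [b] are used. *)
  clear J E S J' E' S' HG HG' HU N.
  destruct (Db) as (J & E & S & J' & E' & S' & HG & HG' & HU & N). apply N.
  (* The sentence says that at most one set satisfies [p]. It is true in V, hence in the common
     model, where both images of [b] satisfy [p]. *)
  pose (q := All (All (Imp (rename (fun _ => 0) p) (Imp (rename (fun _ => 1) p) (Eq 0 1))))).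
  assert (sat (uclass J E S) (fun _ => emb J E S b) q) as K.
  { apply (emb_elementary J E S HG q (fun _ => b)). simpl. intros x _ y _.
    rewrite !sat_rename. cbn. intros H1 H2. apply Huniq.
    - now apply (Hp (fun _ => y)).
    - now apply (Hp (fun _ => x)). }
  simpl in K.
  assert (uclass J E S (emb J E S b)) as M1.
  { exists (lam J (fun _ => b)). split; auto. apply (adm_const J E S HG). }
  assert (uclass J E S (emb J' E' S' b)) as M2.
  { apply HU. exists (lam J' (fun _ => b)). split; auto. apply (adm_const J' E' S' HG'). }
  assert (least b) as Lst by exact (conj Hb (conj Db Lb)).
  apply (K _ M2 _ M1).
  - rewrite sat_rename. cbn. apply (emb_elementary J E S HG p (fun _ => b)).
    now apply (Hp (fun _ => b)).
  - rewrite sat_rename. cbn. apply (sat_class_ext _ _ p HU).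
    apply (emb_elementary J' E' S' HG' p (fun _ => b)). now apply (Hp (fun _ => b)).
Qed.

End EmbeddingsOnOrdinals.

(** * Ordinary ultrapowers and their critical points *)

Section Ultrapowers.
Context {V : set_structure} {HV : ZFC V}.

Definition ultra (Z W : V) : Prop := sfilter Z W /\
  forall X, subset X Z -> X ∈ W \/ exists Y, Y ∈ W /\ forall x, x ∈ Y -> ~ x ∈ X.

(** The only support is the identity, which separates points. Every function on [Z] is then
    admissible and the limit ultrapower is the ordinary ultrapower. *)
Definition full_support (Z : V) : V := upr (lam Z (fun x => x)) (lam Z (fun x => x)).

Lemma dft_full_support b (t : (nat -> V) -> V) : dft b t ->
  dft b (fun e => full_support (t e)).
Proof. intros; unfold full_support; dsolve. Qed.

Lemma ultra_good Z W : ultra Z W -> good Z W (full_support Z).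
Proof.
  intros [HW HD]. split; auto. split; [|split].
  - eexists. apply in_upr. eauto.
  - intros s t Hs Ht. apply in_upr in Hs, Ht. exists s. split; [apply in_upr; tauto|].
    assert (s = t) by intuition congruence. subst t. auto.
  - intros X s HX _ _. now apply HD.
Qed.

Lemma adm_full_support Z f : adm Z (full_support Z) f <-> function_on f Z.
Proof.
  split; [intros [H _]; exact H|]. intros H. split; auto. exists (lam Z (fun x => x)).
  split; [apply in_upr; auto|]. intros x y Hx Hy. rewrite !ap_lam by (dsolve || auto).
  congruence.
Qed.

Lemma ultra_dec Z W P : ultra Z W -> dpr1 P -> ae W P \/ ae W (fun x => ~ P x).
Proof.
  intros HW HP. apply (ae_dec Z W (full_support Z) (ultra_good Z W HW) P (lam Z (fun x => x)));
    auto.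
  - apply in_upr. auto.
  - intros x y Hx Hy. rewrite !ap_lam by (dsolve || auto). now intros ->.
Qed.

Definition ucol (Z W f : V) : V := col Z W (full_support Z) f.

Definition ult (Z W y : V) : Prop := uclass Z W (full_support Z) y.

Lemma dft_ucol b (t s u : (nat -> V) -> V) : dft b t -> dft b s -> dft b u ->
  dft b (fun e => ucol (t e) (s e) (u e)).
Proof. intros; unfold ucol; dsolve; apply dft_full_support; dsolve. Qed.

Lemma dfn_ult b (t s u : (nat -> V) -> V) : dft b t -> dft b s -> dft b u ->
  dfn b (fun e => ult (t e) (s e) (u e)).
Proof. intros; unfold ult; dsolve; apply dft_full_support; dsolve. Qed.

Lemma ult_iff Z W y : ult Z W y <-> exists f, function_on f Z /\ y = ucol Z W f.
Proof.
  unfold ult, uclass, ucol. split; intros (f & Hf & ->); exists f; split; auto.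
  - exact (proj1 (adm_full_support Z f) Hf).
  - exact (proj2 (adm_full_support Z f) Hf).
Qed.

Lemma ucol_eq Z W f g : ultra Z W -> function_on f Z -> function_on g Z ->
  ucol Z W f = ucol Z W g <-> ae W (fun x => ap f x = ap g x).
Proof.
  intros HW Hf Hg. apply (col_eq Z W _ (ultra_good Z W HW)); now apply adm_full_support.
Qed.

Lemma in_ucol Z W f u : ultra Z W -> function_on f Z ->
  u ∈ ucol Z W f <->
  exists g, function_on g Z /\ ae W (fun x => ap g x ∈ ap f x) /\ u = ucol Z W g.
Proof.
  intros HW Hf. unfold ucol. rewrite (in_col Z W _ (ultra_good Z W HW))
    by now apply adm_full_support.
  split; intros (g & Hg & K & ->); exists g; split; auto.
  - exact (proj1 (adm_full_support Z g) Hg).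
  - exact (proj2 (adm_full_support Z g) Hg).
Qed.

(** Completeness in the form that critical points need: a function that is bounded by [th] almost
    everywhere is constant almost everywhere. *)
Definition constant_below (Z W th : V) : Prop := forall g, function_on g Z ->
  ae W (fun x => ap g x ∈ th) -> exists a, a ∈ th /\ ae W (fun x => ap g x = a).

(** Induction on [a]: a member of the image of [a] is represented by a function into [a], hence by a
    constant [b] in [a], and [b] is fixed already. *)
Lemma emb_fixed Z W m : ultra Z W -> transitive_set m ->
  (forall a, a ∈ m -> constant_below Z W a) -> forall a, a ∈ m ->
  emb Z W (full_support Z) a = a.
Proof.
  intros HW Hm Hc.
  apply (wf_on_ind m mem (fun a => emb Z W (full_support Z) a = a)).
  - apply wf_on_mem.
  - unfold emb. dsolve; apply dft_full_support; dsolve.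
  - intros a Ha IH. change (ucol Z W (lam Z (fun _ => a)) = a).
    apply set_ext. intros u. rewrite in_ucol by (auto; apply lam_function; dsolve). split.
    + intros (g & Hg & K & ->).
      assert (ae W (fun x => ap g x ∈ a)) as K'.
      { revert K. apply (ae_mono Z W (proj1 HW)). intros x Hx.
        rewrite ap_lam by (dsolve || auto). auto. }
      destruct (Hc a Ha g Hg K') as (b & Hb & L).
      assert (ucol Z W g = b) as ->; auto. rewrite <- (IH b); auto; [|now apply (Hm a)].
      apply ucol_eq; auto; [apply lam_function; dsolve|].
      revert L. apply (ae_mono Z W (proj1 HW)). intros x Hx.
      rewrite ap_lam by (dsolve || auto). auto.
    + intros Hu. exists (lam Z (fun _ => u)). split; [apply lam_function; dsolve|]. split.
      * apply (ae_all Z W (proj1 HW)). intros x Hx. now rewrite !ap_lam by (dsolve || auto).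
      * symmetry. apply IH; auto. now apply (Hm a).
Qed.

Lemma emb_fixed_top Z W m : ultra Z W -> transitive_set m ->
  (forall a, a ∈ m -> constant_below Z W a) -> constant_below Z W m ->
  emb Z W (full_support Z) m = m.
Proof.
  intros HW Hm Hc Hmc. apply (emb_fixed Z W (suc m)); auto.
  - intros y Hy z Hz. apply in_suc. apply in_suc in Hy. destruct Hy as [Hy| ->]; auto.
    left. now apply (Hm y).
  - intros a Ha. apply in_suc in Ha. destruct Ha as [Ha| ->]; auto.
  - apply in_suc. auto.
Qed.

(** If [m] were fixed, the class of [d] would be an element of [m] and so fixed too. Then [d] would
    agree almost everywhere with the constant function of that value. *)
Lemma emb_moved Z W m d : ultra Z W -> transitive_set m ->
  (forall a, a ∈ m -> constant_below Z W a) -> function_on d Z ->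
  ae W (fun x => ap d x ∈ m) -> (forall a, a ∈ m -> ~ ae W (fun x => ap d x = a)) ->
  emb Z W (full_support Z) m <> m.
Proof.
  intros HW Hm Hc Hd Hdm Hna E.
  assert (ucol Z W d ∈ m) as K.
  { rewrite <- E. change (ucol Z W d ∈ ucol Z W (lam Z (fun _ => m))).
    apply in_ucol; auto; [apply lam_function; dsolve|]. exists d. split; auto. split; auto.
    revert Hdm. apply (ae_mono Z W (proj1 HW)). intros x Hx.
    rewrite ap_lam by (dsolve || auto). auto. }
  apply (Hna _ K).
  assert (ucol Z W d = ucol Z W (lam Z (fun _ => ucol Z W d))) as L.
  { symmetry. apply (emb_fixed Z W m); auto. }
  apply ucol_eq in L; auto; [|apply lam_function; dsolve].
  revert L. apply (ae_mono Z W (proj1 HW)). intros x Hx.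
  rewrite ap_lam by (dsolve || auto). auto.
Qed.

End Ultrapowers.

Ltac dult := match goal with
  | |- dft _ (fun e => ucol _ _ _) => apply dft_ucol
  | |- dfn _ (fun e => ult _ _ _) => apply dfn_ult
  end.

#[global] Opaque col ucol ult.

(** * Iterating an ultrafilter along an ordinal *)

Ltac dhook ::= first [dsets | dords | dfilters | dcol | dult].

Section IterationDefs.
Context {V : set_structure} {HV : ZFC V}.

Definition restr (x c : V) : V := lam c (fun i => ap x i).

(** The strategy prescribes a set in [D] for the next coordinate. It is given the partial sequence
    alone; the length can be recovered as its domain. *)
Definition strategy (nu Z D F : V) : Prop := forall c g, c ∈ nu -> g ∈ funs c Z -> ap F g ∈ D.

Definition follows (nu F x : V) : Prop := forall c, c ∈ nu -> ap x c ∈ ap F (restr x c).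

(* A set is large when some strategy forces every sequence following it into the set; this
   avoids a recursion on finite sets of coordinates. *)
Definition iterate (nu Z D : V) : V := sep (pow (funs nu Z)) (fun X => exists F,
  strategy nu Z D F /\ forall x, x ∈ funs nu Z -> follows nu F x -> x ∈ X).

(* Finiteness of a set of ordinals: there is no infinite increasing sequence in it. *)
Definition finite_in (nu a : V) : Prop := subset a nu /\
  forall b, subset b a -> (exists x, x ∈ b) ->
  exists m, m ∈ b /\ forall c, c ∈ b -> c ∈ m \/ c = m.

Definition upd (nu x m z : V) : V := lam nu (fun c => ite (c = m) z (ap x c)).

Lemma dft_restr b (t s : (nat -> V) -> V) : dft b t -> dft b s ->
  dft b (fun e => restr (t e) (s e)).
Proof. intros; unfold restr; dsolve. Qed.
Lemma dfn_strategy b (t s u v : (nat -> V) -> V) : dft b t -> dft b s -> dft b u -> dft b v ->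
  dfn b (fun e => strategy (t e) (s e) (u e) (v e)).
Proof. intros; unfold strategy; dsolve. Qed.
Lemma dfn_follows b (t s u : (nat -> V) -> V) : dft b t -> dft b s -> dft b u ->
  dfn b (fun e => follows (t e) (s e) (u e)).
Proof. intros; unfold follows; dsolve; apply dft_restr; dsolve. Qed.
Lemma dfn_finite_in b (t s : (nat -> V) -> V) : dft b t -> dft b s ->
  dfn b (fun e => finite_in (t e) (s e)).
Proof. intros; unfold finite_in; dsolve. Qed.
Lemma dft_upd b (t s u v : (nat -> V) -> V) : dft b t -> dft b s -> dft b u -> dft b v ->
  dft b (fun e => upd (t e) (s e) (u e) (v e)).
Proof. intros; unfold upd; dsolve. Qed.

End IterationDefs.

Ltac diter := match goal with
  | |- dft _ (fun e => restr _ _) => apply dft_restr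
  | |- dft _ (fun e => upd _ _ _ _) => apply dft_upd
  | |- dfn _ (fun e => strategy _ _ _ _) => apply dfn_strategy
  | |- dfn _ (fun e => follows _ _ _) => apply dfn_follows
  | |- dfn _ (fun e => finite_in _ _) => apply dfn_finite_in
  end.
Ltac dhook ::= first [dsets | dords | dfilters | dcol | dult | diter].

Section Iteration.
Context {V : set_structure} {HV : ZFC V}.
Variables (nu Z D : V).
Hypotheses (Hnu : ordinal nu) (HD : ultra Z D).
Let HD' : sfilter Z D := proj1 HD.
Local Notation I := (funs nu Z).
Local Notation E := (iterate nu Z D).

Lemma in_iterate X : X ∈ E <-> subset X I /\ exists F,
  strategy nu Z D F /\ forall x, x ∈ I -> follows nu F x -> x ∈ X.
Proof. unfold iterate. rewrite in_sep by dsolve. rewrite in_pow. tauto. Qed.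

Lemma ae_iterate P F : dpr1 P -> strategy nu Z D F ->
  (forall x, x ∈ I -> follows nu F x -> P x) -> ae E P.
Proof.
  intros HP HF H. exists (sep I P). split.
  - apply in_iterate. split.
    + intros x Hx. apply in_sep in Hx; tauto.
    + exists F. split; auto. intros x Hx Hf. apply in_sep; auto.
  - intros x Hx. apply in_sep in Hx; tauto.
Qed.

Lemma restr_funs x c : x ∈ I -> c ∈ nu -> restr x c ∈ funs c Z.
Proof.
  intros Hx Hc. apply lam_funs; [dsolve|]. intros i Hi. apply in_funs in Hx. apply Hx.
  now apply (proj1 Hnu c).
Qed.

Lemma make_strategy G : dfun1 G -> exists F,
  (forall c g, c ∈ nu -> g ∈ funs c Z -> ap F g = G g).
Proof.
  intros HG. exists (lam (bigcup (rep nu (fun c => funs c Z))) G).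
  intros c g Hc Hg. apply ap_lam; auto. apply in_bigcup_rep; [dsolve|]. eauto.
Qed.

Lemma full_strategy : exists F, strategy nu Z D F.
Proof.
  destruct (make_strategy (fun _ => Z)) as (F & HF); [dsolve|]. exists F.
  intros c g Hc Hg. rewrite (HF c) by auto. apply HD'.
Qed.

Lemma exists_following F : strategy nu Z D F -> exists x, x ∈ I /\ follows nu F x.
Proof.
  intros HF. destruct (choice_function D) as (ch & Hch).
  destruct (recursion nu mem (fun c u => ap ch (ap F u))) as (x & Hx & Hr);
    [dsolve|dsolve|apply wf_on_mem|].
  assert (forall c, c ∈ nu -> ap x c = ap ch (ap F (restr x c))) as Hr'.
  { intros c Hc. rewrite Hr by auto. do 2 f_equal. unfold restr. f_equal.
    apply set_ext. intros z. rewrite in_sep by dsolve. split; [tauto|].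
    intros Hz. split; auto. now apply (proj1 Hnu c). }
  assert (forall X, X ∈ D -> ap ch X ∈ X) as Hch'.
  { intros X HX. apply Hch; auto. now apply HD'. }
  assert (forall c, c ∈ nu -> ap x c ∈ Z) as HZ.
  { apply (wf_on_ind nu mem (fun c => ap x c ∈ Z)); [apply wf_on_mem|dsolve|].
    intros c Hc IH. rewrite Hr' by auto.
    assert (ap F (restr x c) ∈ D) as K.
    { apply (HF c); auto. apply lam_funs; [dsolve|]. intros i Hi. apply IH; auto.
      now apply (proj1 Hnu c). }
    apply (proj1 HD' _ K). now apply Hch'. }
  assert (x ∈ I) as HI by (apply in_funs; auto).
  exists x. split; auto. intros c Hc. rewrite Hr' at 1 by auto. apply Hch'.
  apply (HF c); auto. now apply restr_funs.
Qed.

Lemma iterate_sfilter : sfilter I E.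
Proof.
  split; [|split; [|split; [|split]]].
  - intros X HX. now apply in_iterate in HX.
  - intros X Y HX HXY HY. apply in_iterate in HX. apply in_iterate. split; auto.
    destruct HX as (_ & F & HF & H). exists F. auto.
  - apply in_iterate. split; [now intros x|]. destruct full_strategy as (F & HF).
    exists F. auto.
  - intros X HX. apply in_iterate in HX. destruct HX as (_ & F & HF & H).
    destruct (exists_following F HF) as (x & Hx & Hf). eauto.
  - intros c Hc.
    destruct (selection omega (fun n F => strategy nu Z D F /\
      forall x, x ∈ I -> follows nu F x -> x ∈ ap c n)) as (k & _ & Hk & _); [dsolve|].
    assert (forall n, n ∈ omega -> strategy nu Z D (ap k n) /\
      forall x, x ∈ I -> follows nu (ap k n) x -> x ∈ ap c n) as Hk'.
    { intros n Hn. apply Hk; auto. specialize (Hc n Hn). now apply in_iterate in Hc. }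
    (* Countably many strategies are combined by intersecting their prescriptions at every move,
       which is possible because [D] is countably complete. *)
    destruct (make_strategy (fun g => sep Z (fun z => forall n, n ∈ omega -> z ∈ ap (ap k n) g)))
      as (F & HF); [dsolve|].
    exists (sep I (fun x => forall n, n ∈ omega -> x ∈ ap c n)). split.
    + apply in_iterate. split.
      { intros x Hx. apply in_sep in Hx; [tauto|dsolve]. }
      exists F. split.
      * intros d g Hd Hg. rewrite (HF d) by auto. apply (ae_sep Z D HD'); [dsolve|].
        apply (ae_omega Z D HD' (fun n z => z ∈ ap (ap k n) g)); [dsolve|].
        intros n Hn. exists (ap (ap k n) g). split; auto. now apply (proj1 (Hk' n Hn) d).
      * intros x Hx Hf. apply in_sep; [dsolve|]. split; auto. intros n Hn.
        apply (proj2 (Hk' n Hn)); auto. intros d Hd. specialize (Hf d Hd).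
        rewrite (HF d) in Hf by (auto using restr_funs).
        apply in_sep in Hf; [|dsolve]. now apply Hf.
    + intros x n Hx Hn. apply in_sep in Hx; [|dsolve]. now apply Hx.
Qed.

Let HE := iterate_sfilter.

Lemma ap_upd_same x m z : m ∈ nu -> ap (upd nu x m z) m = z.
Proof. intros Hm. unfold upd. rewrite ap_lam by (dsolve || auto). now apply ite_true. Qed.

Lemma ap_upd_other x m z c : c ∈ nu -> c <> m -> ap (upd nu x m z) c = ap x c.
Proof. intros Hm N. unfold upd. rewrite ap_lam by (dsolve || auto). now apply ite_false. Qed.

Lemma upd_funs x m z : x ∈ I -> z ∈ Z -> upd nu x m z ∈ I.
Proof.
  intros Hx Hz. apply lam_funs; [dsolve|]. intros c Hc. destruct (classic (c = m)).
  - now rewrite ite_true.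
  - rewrite ite_false by auto. apply in_funs in Hx. now apply Hx.
Qed.

Lemma funs_ext x y : x ∈ I -> y ∈ I -> (forall c, c ∈ nu -> ap x c = ap y c) -> x = y.
Proof.
  intros Hx Hy. apply in_funs in Hx, Hy. apply function_ext; tauto.
Qed.

Lemma upd_self x m : x ∈ I -> upd nu x m (ap x m) = x.
Proof.
  intros Hx. destruct (classic (m ∈ nu)) as [Hm|Hm].
  - assert (ap x m ∈ Z) by (apply in_funs in Hx; now apply Hx).
    apply funs_ext; auto using upd_funs. intros c Hc. destruct (classic (c = m)) as [-> |N].
    + now apply ap_upd_same.
    + now apply ap_upd_other.
  - pose proof Hx as Hx'. apply in_funs in Hx'. destruct Hx' as [Hf _].
    unfold upd. transitivity (lam nu (fun c => ap x c)); [|now apply lam_ap].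
    apply lam_ext; [dsolve|dsolve|]. intros c Hc. apply ite_false. congruence.
Qed.

Lemma upd_upd x m z w : m ∈ nu -> x ∈ I -> z ∈ Z -> w ∈ Z ->
  upd nu (upd nu x m z) m w = upd nu x m w.
Proof.
  intros Hm Hx Hz Hw. apply funs_ext; auto using upd_funs. intros c Hc.
  destruct (classic (c = m)) as [-> |N].
  - now rewrite !ap_upd_same.
  - now rewrite !ap_upd_other.
Qed.

Lemma upd_comm x m n z w : m ∈ nu -> n ∈ nu -> m <> n -> x ∈ I -> z ∈ Z -> w ∈ Z ->
  upd nu (upd nu x m z) n w = upd nu (upd nu x n w) m z.
Proof.
  intros Hm Hn N Hx Hz Hw. apply funs_ext.
  { apply upd_funs; [now apply upd_funs|exact Hw]. }
  { apply upd_funs; [now apply upd_funs|exact Hz]. }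
  intros c Hc.
  destruct (classic (c = m)) as [-> |N1]; [|destruct (classic (c = n)) as [-> |N2]].
  - now rewrite ap_upd_other, !ap_upd_same by auto.
  - rewrite ap_upd_same by auto. rewrite ap_upd_other, ap_upd_same; auto.
  - now rewrite !ap_upd_other.
Qed.

Definition depends (a X : V) : Prop := forall x y, x ∈ I -> y ∈ I ->
  (forall c, c ∈ a -> ap x c = ap y c) -> x ∈ X -> y ∈ X.

Definition average (m X : V) : V := sep I (fun x => ae D (fun z => upd nu x m z ∈ X)).

Lemma in_average m X x : x ∈ average m X <-> x ∈ I /\ ae D (fun z => upd nu x m z ∈ X).
Proof.
  exact (in_sep I (fun x => ae D (fun z => upd nu x m z ∈ X)) ltac:(dsolve) x).
Qed.

(** A strategy for the average is sharpened at length [m] only: the next coordinate must also put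
    the sequence into [X]. This prescription is large by definition of the average, and it depends
    on the partial sequence alone because [X] looks at no coordinate beyond [m]. *)
Lemma average_large m X : m ∈ nu -> depends (suc m) X -> ae E (fun x => x ∈ average m X) ->
  ae E (fun x => x ∈ X).
Proof.
  intros Hm HX (Y & HY & H). apply in_iterate in HY. destruct HY as (HYI & F & HF & HFY).
  pose (G := fun g => sep Z (fun z => z ∈ ap F g /\
    ((exists x, x ∈ average m X /\ restr x m = g) -> forall x, x ∈ average m X ->
     restr x m = g -> upd nu x m z ∈ X))).
  pose (G' := fun g => ite (function_on g m) (G g) (ap F g)).
  assert (dfun1 G') as HG' by (unfold G', G, average; dsolve).
  assert (forall x y z, x ∈ I -> y ∈ I -> z ∈ Z -> restr x m = restr y m ->
    upd nu x m z ∈ X -> upd nu y m z ∈ X) as Hrestr.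
  { intros x y z Hx Hy Hz Hr. apply HX; auto using upd_funs. intros c Hc.
    apply in_suc in Hc. destruct Hc as [Hc| ->].
    - assert (c ∈ nu) by now apply (proj1 Hnu m).
      assert (c <> m) by (intros ->; now apply (not_mem_self m)).
      rewrite !ap_upd_other by auto.
      assert (forall u, ap (restr u m) c = ap u c) as K.
      { intros u. apply ap_lam; auto. dsolve. }
      now rewrite <- (K x), <- (K y), Hr.
    - now rewrite !ap_upd_same. }
  destruct (make_strategy G' HG') as (F' & HF').
  assert (forall c g, c ∈ nu -> g ∈ funs c Z -> subset (ap F' g) (ap F g)) as Hsub.
  { intros c g Hc Hg z Hz. rewrite (HF' c) in Hz by auto. unfold G' in Hz.
    destruct (classic (function_on g m)).
    - rewrite ite_true in Hz by auto. apply in_sep in Hz; [tauto|unfold average; dsolve].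
    - now rewrite ite_false in Hz. }
  assert (strategy nu Z D F') as HSt.
  { intros c g Hc Hg. rewrite (HF' c) by auto. pose proof (HF c g Hc Hg) as HFg. unfold G'.
    destruct (classic (function_on g m)).
    - rewrite ite_true by auto. unfold G. apply (ae_sep Z D HD'); [unfold average; dsolve|].
      assert (ae D (fun z => z ∈ ap F g)) as K1 by (exists (ap F g); auto).
      destruct (classic (exists x, x ∈ average m X /\ restr x m = g)) as [(x & Hx & Hr)|N].
      + apply in_average in Hx. destruct Hx as [Hx K2]. generalize K1 K2.
        apply (ae_mono2 Z D HD'). intros z Hz H1 H2. split; auto.
        intros _ y Hy Hry. apply in_average in Hy. apply (Hrestr x y z); try tauto. congruence.
      + revert K1. apply (ae_mono Z D HD'). intros z Hz H1. split; auto. tauto.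
    - now rewrite ite_false by auto. }
  apply (ae_iterate _ F'); [dsolve|auto|].
  intros x Hx Hf.
  assert (x ∈ average m X) as Ha.
  { apply H, HFY; auto. intros c Hc. apply (Hsub c); auto using restr_funs. }
  specialize (Hf m Hm). rewrite (HF' m) in Hf by auto using restr_funs.
  unfold G' in Hf. rewrite ite_true in Hf.
  - apply in_sep in Hf; [|unfold average; dsolve]. destruct Hf as (_ & _ & Hf).
    rewrite <- (upd_self x m Hx). apply Hf; eauto.
  - apply lam_function. dsolve.
Qed.

Definition decided (X : V) : Prop := ae E (fun x => x ∈ X) \/ ae E (fun x => ~ x ∈ X).

Lemma max_depends a m X : (forall c, c ∈ a -> c ∈ m \/ c = m) -> depends a X ->
  depends (suc m) X.
Proof.
  intros Hm HX x y Hx Hy H. apply HX; auto. intros c Hc. apply H, in_suc; auto.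
Qed.

Lemma average_depends a m X : m ∈ nu -> subset a nu -> depends a X ->
  depends (sep a (fun c => c <> m)) (average m X).
Proof.
  intros Hm Ha HX x y Hx Hy H Hxa. apply in_average in Hxa. apply in_average. split; auto.
  destruct Hxa as [_ K]. revert K. apply (ae_mono Z D HD'). intros z Hz.
  apply HX; auto using upd_funs. intros c Hc. destruct (classic (c = m)) as [-> |N].
  - now rewrite !ap_upd_same.
  - rewrite !ap_upd_other by auto. apply H. apply in_sep; [dsolve|auto].
Qed.

Lemma finite_in_subset a b : finite_in nu a -> subset b a -> finite_in nu b.
Proof.
  intros [H1 H2] Hb. split.
  - intros x Hx. auto.
  - intros c Hc. apply H2. intros x Hx. auto.
Qed.

Lemma sep_subset (a : V) P : dpr1 P -> subset (sep a P) a.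
Proof. intros HP x Hx. apply in_sep in Hx; tauto. Qed.

(** [D] is an ultrafilter, so averaging commutes with complements. *)
Lemma average_complement m X : m ∈ nu -> depends (suc m) X ->
  ae E (fun x => ~ x ∈ average m X) -> ae E (fun x => ~ x ∈ X).
Proof.
  intros Hm HX K.
  assert (forall x, x ∈ sep I (fun x => ~ x ∈ X) <-> x ∈ I /\ ~ x ∈ X) as HC
    by (apply in_sep; dsolve).
  assert (ae E (fun x => x ∈ sep I (fun x => ~ x ∈ X))) as L.
  { apply (average_large m); auto.
    - intros x y Hx Hy Hxy. rewrite !HC. intros [_ G]. split; auto. intros G'. apply G.
      apply (HX y x); auto. intros c Hc. symmetry; auto.
    - revert K. apply (ae_mono I E HE). intros x Hx N. apply in_average. split; auto.
      destruct (ultra_dec Z D (fun z => upd nu x m z ∈ X) HD) as [M|M].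
      + dsolve.
      + exfalso. apply N, in_average; auto.
      + revert M. apply (ae_mono Z D HD'). intros z Hz G. apply HC. auto using upd_funs. }
  revert L. apply (ae_mono I E HE). intros x Hx G. now apply HC in G.
Qed.

(** The largest coordinate [m] of [a] is averaged out, leaving coordinates below [m]; this drives an
    induction on the bound [d]. A set depending on no coordinate is empty or everything. *)
Lemma decided_bounded : forall d, ordinal d -> forall a X, finite_in nu a -> subset X I ->
  depends a X -> subset a d -> decided X.
Proof.
  apply (eps_ind (fun d => ordinal d -> forall a X, finite_in nu a -> subset X I ->
    depends a X -> subset a d -> decided X)); [unfold decided, depends, iterate; dsolve|].
  intros d IH Hd a X Ha HXI HX Had.
  destruct (classic (exists c, c ∈ a)) as [Hne|Hemp].
  - destruct (Ha) as [Hanu Hmax]. destruct (Hmax a) as (m & Hma & Hm); auto.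
    { now intros x. }
    assert (m ∈ nu) by auto.
    assert (subset (sep a (fun c => c <> m)) a) as Hs by (apply sep_subset; dsolve).
    assert (decided (average m X)) as K.
    { apply (IH m) with (a := sep a (fun c => c <> m)); auto.
      - exact (ordinal_elem d m Hd (Had m Hma)).
      - now apply (finite_in_subset a).
      - intros x Hx. now apply in_average in Hx.
      - now apply average_depends.
      - intros c Hc. apply in_sep in Hc; [|dsolve]. destruct (Hm c); tauto. }
    destruct K as [K|K].
    + left. apply (average_large m); auto. now apply (max_depends a).
    + right. apply (average_complement m); auto. now apply (max_depends a).
  - destruct (classic (exists x, x ∈ X)) as [(x & Hx)|N].
    + left. apply (ae_all I E HE). intros y Hy. apply (HX x y); auto.
      intros c Hc. exfalso. eauto.
    + right. apply (ae_all I E HE). intros y Hy Hyx. eauto.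
Qed.

Lemma decided_finite a X : finite_in nu a -> subset X I -> depends a X -> decided X.
Proof.
  intros Ha HX Hd. apply (decided_bounded nu Hnu a X); auto. apply Ha.
Qed.

(** The converse of [average_large] comes from decidedness: a negligible average would make [X]
    negligible. *)
Lemma average_iff a m X : finite_in nu a -> m ∈ nu ->
  (forall c, c ∈ a -> c ∈ m \/ c = m) -> depends a X ->
  ae E (fun x => x ∈ average m X) <-> ae E (fun x => x ∈ X).
Proof.
  intros Ha Hm Hmax HX. pose proof (max_depends a m X Hmax HX) as HX'.
  split; [now apply average_large|]. intros H.
  destruct (decided_finite (sep a (fun c => c <> m)) (average m X)) as [K|K]; auto.
  - apply (finite_in_subset a); auto. apply sep_subset. dsolve.
  - intros x Hx. now apply in_average in Hx.
  - apply average_depends; auto. apply Ha.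
  - destruct (ae_contra I E HE _ H (average_complement m X Hm HX' K)).
Qed.

Lemma finite_in_cup a b : finite_in nu a -> finite_in nu b -> finite_in nu (cup a b).
Proof.
  intros [Ha Ha'] [Hb Hb']. split.
  - intros x Hx. apply in_cup in Hx. destruct Hx; auto.
  - intros d Hd (x & Hx).
    assert (forall u : V, dpr1 (fun z => z ∈ u)) as Hu by (intros; dsolve).
    assert (forall a : V, (forall b, subset b a -> (exists x, x ∈ b) -> exists m, m ∈ b /\
       forall c, c ∈ b -> c ∈ m \/ c = m) -> (forall y, y ∈ d -> ~ y ∈ a) \/
       exists m, m ∈ d /\ forall c, c ∈ d -> c ∈ a -> c ∈ m \/ c = m) as K.
    { intros w Hw. destruct (classic (exists y, y ∈ d /\ y ∈ w)) as [(y & Hy & Hyw)|N].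
      - right. destruct (Hw (sep d (fun z => z ∈ w))) as (m & Hm & Hmax).
        + intros z Hz. apply in_sep in Hz; auto. tauto.
        + exists y. apply in_sep; auto.
        + apply in_sep in Hm; auto. exists m. split; [tauto|]. intros c Hc Hcw.
          apply Hmax, in_sep; auto.
      - left. intros y Hy Hyw. eauto. }
    assert (forall y, y ∈ d -> y ∈ a \/ y ∈ b) as Hd'.
    { intros y Hy. apply in_cup. auto. }
    assert (forall y, y ∈ d -> ordinal y) as Ho.
    { intros y Hy. apply (ordinal_elem nu); auto. destruct (Hd' y Hy); auto. }
    destruct (K a Ha') as [Na|(m & Hm & Mm)].
    { destruct (K b Hb') as [Nb|(n & Hn & Mn)].
      - exfalso. destruct (Hd' x Hx); [eapply Na|eapply Nb]; eauto.
      - exists n. split; auto. intros c Hc. apply Mn; auto. destruct (Hd' c Hc); auto.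
        exfalso. eapply Na; eauto. }
    destruct (K b Hb') as [Nb|(n & Hn & Mn)].
    { exists m. split; auto. intros c Hc. apply Mm; auto. destruct (Hd' c Hc); auto.
      exfalso. eapply Nb; eauto. }
    assert (forall m n, m ∈ d -> n ∈ d -> m ∈ n \/ m = n -> forall c, c ∈ m \/ c = m ->
      c ∈ n \/ c = n) as T.
    { intros u v Hu' Hv Huv c [Hc| ->]; auto. destruct Huv as [Huv| ->]; auto.
      left. now apply (proj1 (Ho v Hv) u). }
    assert ((m ∈ n \/ m = n) \/ (n ∈ m \/ n = m)) as [L|L].
    { destruct (ordinal_trichotomy m (Ho m Hm) n (Ho n Hn)) as [G|[G|G]]; auto. }
    + exists n. split; auto. intros c Hc. destruct (Hd' c Hc); auto. apply (T m n); auto.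
    + exists m. split; auto. intros c Hc. destruct (Hd' c Hc); auto. apply (T n m); auto.
Qed.

Lemma finite_in_singleton i : i ∈ nu -> finite_in nu (upr i i).
Proof.
  intros Hi. split.
  - intros x Hx. apply in_upr in Hx. now destruct Hx as [-> | ->].
  - intros b Hb (x & Hx). exists x. split; auto. intros c Hc. right.
    apply Hb, in_upr in Hx. apply Hb, in_upr in Hc. intuition congruence.
Qed.

End Iteration.

(** * Finite supports and the factor lemma *)

Section FiniteSupports.
Context {V : set_structure} {HV : ZFC V}.
Variables (nu Z D : V) (p : V -> V).
Hypotheses (Hnu : ordinal nu) (HD : ultra Z D) (Hp : dfun1 p).
Let HD' : sfilter Z D := proj1 HD.
Local Notation I := (funs nu Z).
Local Notation E := (iterate nu Z D).
Let HE : sfilter I E := iterate_sfilter nu Z D Hnu HD.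

(** [B] collects the coordinates that are blurred to their projection. A model blurs one coordinate;
    the common ground of two models blurs two. *)
Definition visible (B x c : V) : V := ite (c ∈ B) (p (ap x c)) (ap x c).

Definition trace (B a : V) : V := lam I (fun x => lam a (fun c => visible B x c)).

Definition traces (B : V) : V := rep (sep (pow nu) (finite_in nu)) (trace B).

Definition agree (B a x y : V) : Prop := forall c, c ∈ a -> visible B x c = visible B y c.

Lemma visible_dfun2 B : dfun2 (visible B).
Proof. unfold visible. dsolve. Qed.

Lemma dft_traces t : dft true t -> dft true (fun e => traces (t e)).
Proof. intros; unfold traces, trace, visible; dsolve. Qed.

Lemma trace_dfun1 B : dfun1 (trace B).
Proof. unfold trace, visible. dsolve. Qed.

Lemma in_traces B s : s ∈ traces B <-> exists a, finite_in nu a /\ s = trace B a.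
Proof.
  unfold traces. rewrite in_rep by apply trace_dfun1. split.
  - intros (a & Ha & ->). apply in_sep in Ha; [|dsolve]. exists a. tauto.
  - intros (a & Ha & ->). exists a. split; auto. apply in_sep; [dsolve|].
    split; auto. apply in_pow, Ha.
Qed.

Lemma trace_eq B a x y : x ∈ I -> y ∈ I ->
  ap (trace B a) x = ap (trace B a) y <-> agree B a x y.
Proof.
  intros Hx Hy. pose proof (visible_dfun2 B) as Hv. unfold trace.
  rewrite !ap_lam by (dsolve || auto). split.
  - intros H c Hc.
    pose proof (f_equal (fun f => ap f c) H) as G. cbn beta in G.
    rewrite !ap_lam in G by (dsolve || auto). exact G.
  - intros H. apply lam_ext; [dsolve|dsolve|]. exact H.
Qed.

Lemma agree_subset B a b x y : subset a b -> agree B b x y -> agree B a x y.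
Proof. intros H K c Hc. apply K, H, Hc. Qed.

Lemma agree_eq B a x y : (forall c, c ∈ a -> ap x c = ap y c) -> agree B a x y.
Proof. intros H c Hc. unfold visible. now rewrite H. Qed.

Lemma adm_traces B f : adm I (traces B) f <-> function_on f I /\ exists a, finite_in nu a /\
  forall x y, x ∈ I -> y ∈ I -> agree B a x y -> ap f x = ap f y.
Proof.
  split.
  - intros (Hf & s & Hs & H). split; auto. apply in_traces in Hs. destruct Hs as (a & Ha & ->).
    exists a. split; auto. intros x y Hx Hy Hxy. apply H; auto. now apply trace_eq.
  - intros (Hf & a & Ha & H). split; auto. exists (trace B a). split.
    + apply in_traces. eauto.
    + intros x y Hx Hy Hxy. apply H; auto. now apply trace_eq.
Qed.

Lemma subset_cup_l (a b : V) : subset a (cup a b).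
Proof. intros x Hx. apply in_cup. auto. Qed.
Lemma subset_cup_r (a b : V) : subset b (cup a b).
Proof. intros x Hx. apply in_cup. auto. Qed.

Lemma finite_in_zero : finite_in nu zero.
Proof.
  split.
  - intros x Hx. destruct (in_zero _ Hx).
  - intros b Hb (x & Hx). destruct (in_zero x). auto.
Qed.

Lemma iterate_good B : good I E (traces B).
Proof.
  split; [exact HE|]. split; [|split].
  - exists (trace B zero). apply in_traces. exists zero. split; auto. apply finite_in_zero.
  - intros s t Hs Ht. apply in_traces in Hs, Ht.
    destruct Hs as (a & Ha & ->), Ht as (b & Hb & ->). exists (trace B (cup a b)). split.
    + apply in_traces. exists (cup a b). split; auto. now apply finite_in_cup.
    + intros x y Hx Hy. rewrite !trace_eq by auto. intros H.
      split; revert H; apply agree_subset; [apply subset_cup_l|apply subset_cup_r].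
  - intros X s HX Hs H. apply in_traces in Hs. destruct Hs as (a & Ha & ->).
    destruct (decided_finite nu Z D Hnu HD a X) as [K|K]; auto.
    + intros x y Hx Hy Hxy. apply H; auto. apply trace_eq; auto. now apply agree_eq.
    + left. apply (ae_sep I E HE) in K; [|dsolve].
      replace X with (sep I (fun x => x ∈ X)); auto.
      apply set_ext. intros z. rewrite in_sep by dsolve. split; [tauto|]. auto.
Qed.

Lemma ae_dec_traces B a P : dpr1 P -> finite_in nu a ->
  (forall x y, x ∈ I -> y ∈ I -> agree B a x y -> P x -> P y) ->
  ae E P \/ ae E (fun x => ~ P x).
Proof.
  intros HP Ha H. apply (ae_dec I E (traces B) (iterate_good B) P (trace B a)); auto.
  - apply in_traces. eauto.
  - intros x y Hx Hy Hxy. apply H; auto. now apply trace_eq.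
Qed.

Lemma selection_traces B a Q : dpr2 Q -> finite_in nu a ->
  (forall x y, x ∈ I -> y ∈ I -> agree B a x y -> forall z, Q x z <-> Q y z) ->
  exists k, adm I (traces B) k /\ forall x, x ∈ I -> (exists z, Q x z) -> Q x (ap k x).
Proof.
  intros HQ Ha H. apply (adm_selection I (traces B) Q (trace B a)); auto.
  - apply in_traces. eauto.
  - intros x y Hx Hy Hxy. apply H; auto. now apply trace_eq.
Qed.

Lemma value_in x c : x ∈ I -> c ∈ nu -> ap x c ∈ Z.
Proof. intros Hx Hc. apply in_funs in Hx. now apply Hx. Qed.

(** * Resampling one coordinate within its fibre *)

Section Factor.
(** [W] attaches a fibre measure to each projection. [Hint] makes [D] the average of these measures,
    and [Hcom] lets a fibre measure be exchanged with a later copy of [D]. *)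
Variable W : V -> V.
Hypotheses (HW : dfun1 W)
  (HWu : forall z, z ∈ Z -> ultra Z (W (p z)))
  (Hfib : forall z, z ∈ Z -> ae (W (p z)) (fun w => p w = p z))
  (Hint : forall P, dpr1 P -> ae D (fun z => ae (W (p z)) P) <-> ae D P)
  (Hcom : forall z Y, z ∈ Z -> dpr2 Y -> ae (W (p z)) (fun w => ae D (fun v => Y w v)) <->
     ae D (fun v => ae (W (p z)) (fun w => Y w v))).
Variable i : V.
Hypothesis Hi : i ∈ nu.

Definition fiber (X : V) : V :=
  sep I (fun x => ae (W (p (ap x i))) (fun w => upd nu x i w ∈ X)).

Lemma in_fiber X x : x ∈ fiber X <-> x ∈ I /\
  ae (W (p (ap x i))) (fun w => upd nu x i w ∈ X).
Proof.
  exact (in_sep I (fun x => ae (W (p (ap x i))) (fun w => upd nu x i w ∈ X)) ltac:(dsolve) x).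
Qed.

Lemma ae_W_iff x (P Q : V -> Prop) : x ∈ I -> (forall w, w ∈ Z -> P w <-> Q w) ->
  ae (W (p (ap x i))) P <-> ae (W (p (ap x i))) Q.
Proof.
  intros Hx H. pose proof (proj1 (HWu _ (value_in x i Hx Hi))) as HF.
  split; apply (ae_mono Z _ HF); intros w Hw; apply H; auto.
Qed.

Lemma ae_D_iff (P Q : V -> Prop) : (forall w, w ∈ Z -> P w <-> Q w) -> ae D P <-> ae D Q.
Proof. intros H. split; apply (ae_mono Z D HD'); intros w Hw; apply H; auto. Qed.

Lemma ae_E_iff (P Q : V -> Prop) : (forall w, w ∈ I -> P w <-> Q w) -> ae E P <-> ae E Q.
Proof. intros H. split; apply (ae_mono I E HE); intros w Hw; apply H; auto. Qed.

Lemma fiber_depends a X : i ∈ a -> depends nu Z a X -> subset a nu ->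
  depends nu Z a (fiber X).
Proof.
  intros Hia HX Ha x y Hx Hy H Hxf. apply in_fiber in Hxf. apply in_fiber. split; auto.
  destruct Hxf as [_ K]. rewrite <- (H i Hia). revert K.
  apply (ae_mono Z _ (proj1 (HWu _ (value_in x i Hx Hi)))). intros w Hw.
  apply HX; try now apply upd_funs. intros c Hc. destruct (classic (c = i)) as [-> |N].
  - now rewrite !ap_upd_same.
  - rewrite !ap_upd_other; auto.
Qed.

(** Both sides are averaged over the largest coordinate [m] of [a]. If [m] is [i], resampling after
    drawing is absorbed by [Hint]. If [m] lies above [i], [Hcom] moves the resampling inside the
    average and the induction hypothesis applies below [m]. If [i] is not in [a], resampling changes
    nothing. *)
Lemma fiber_iff_bounded : forall d, ordinal d -> forall a X, finite_in nu a -> subset X I ->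
  depends nu Z a X -> subset a d ->
  ae E (fun x => x ∈ fiber X) <-> ae E (fun x => x ∈ X).
Proof.
  apply (eps_ind (fun d => ordinal d -> forall a X, finite_in nu a -> subset X I ->
    depends nu Z a X -> subset a d ->
    ae E (fun x => x ∈ fiber X) <-> ae E (fun x => x ∈ X)));
    [unfold depends, iterate, fiber; dsolve|].
  intros d IH Hd a X Ha HXI HX Had.
  destruct (classic (i ∈ a)) as [Hia|Hia].
  - destruct (Ha) as [Hanu Hmax]. destruct (Hmax a) as (m & Hma & Hm);
      [now intros x|eauto|].
    assert (m ∈ nu) as Hmnu by auto.
    rewrite <- (average_iff nu Z D Hnu HD a m X) by auto.
    assert (depends nu Z a (fiber X)) as HXf by (apply fiber_depends; auto).
    rewrite <- (average_iff nu Z D Hnu HD a m (fiber X)) by auto.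
    destruct (classic (m = i)) as [-> |N].
    + apply ae_E_iff. intros x Hx. rewrite !in_average. apply and_iff_compat_l.
      rewrite <- (Hint (fun w => upd nu x i w ∈ X)) by dsolve.
      apply ae_D_iff. intros z Hz.
      rewrite in_fiber. rewrite ap_upd_same by auto.
      assert (ae (W (p z)) (fun w => upd nu (upd nu x i z) i w ∈ X) <->
        ae (W (p z)) (fun w => upd nu x i w ∈ X)) as K.
      { split; apply (ae_mono Z _ (proj1 (HWu _ Hz))); intros w Hw;
        rewrite (upd_upd nu Z x i z w Hi Hx Hz Hw); auto. }
      rewrite K. split; [tauto|]. intros G. split; auto. now apply upd_funs.
    + assert (i ∈ m) as Him by (destruct (Hm i Hia); congruence).
      assert (subset (sep a (fun c => c <> m)) a) as Hs by (apply sep_subset; dsolve).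
      rewrite <- (IH m) with (a := sep a (fun c => c <> m)) (X := average nu Z D m X); auto.
      * apply ae_E_iff. intros x Hx. rewrite in_average, in_fiber. apply and_iff_compat_l.
        transitivity (ae D (fun v => ae (W (p (ap x i)))
          (fun w => upd nu (upd nu x i w) m v ∈ X))).
        -- apply ae_D_iff. intros v Hv. rewrite in_fiber. rewrite ap_upd_other by auto.
           rewrite (ae_W_iff x (fun w => upd nu (upd nu x m v) i w ∈ X)
             (fun w => upd nu (upd nu x i w) m v ∈ X)) by
             (auto; intros w Hw; rewrite (upd_comm nu Z x m i v w); tauto).
           split; [tauto|]. intros G. split; auto. now apply upd_funs.
        -- rewrite <- (Hcom (ap x i) (fun w v => upd nu (upd nu x i w) m v ∈ X));
             [|now apply value_in|dsolve].
           apply ae_W_iff; auto. intros w Hw. rewrite in_average.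
           split; [|tauto]. intros G. split; auto. now apply upd_funs.
      * exact (ordinal_elem d m Hd (Had m Hma)).
      * exact (finite_in_subset nu a _ Ha Hs).
      * intros x Hx. now apply in_average in Hx.
      * now apply average_depends.
      * intros c Hc. apply in_sep in Hc; [|dsolve]. destruct (Hm c); tauto.
  - apply ae_E_iff. intros x Hx. rewrite in_fiber.
    assert (forall w, w ∈ Z -> upd nu x i w ∈ X <-> x ∈ X) as K.
    { intros w Hw. assert (forall c, c ∈ a -> ap (upd nu x i w) c = ap x c) as L.
      { intros c Hc. apply ap_upd_other; [now apply Ha|congruence]. }
      split; apply HX; auto; try now apply upd_funs. intros c Hc. symmetry. auto. }
    rewrite (ae_W_iff x _ (fun _ => x ∈ X) Hx K).
    rewrite (ae_const Z _ (proj1 (HWu _ (value_in x i Hx Hi)))). split; [tauto|auto].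
Qed.

(* Fubini: the [i]-th coordinate can be resampled last within its fibre. *)
Lemma ae_fiber a P : dpr1 P -> finite_in nu a ->
  (forall x y, x ∈ I -> y ∈ I -> (forall c, c ∈ a -> ap x c = ap y c) -> P x -> P y) ->
  ae E (fun x => ae (W (p (ap x i))) (fun w => P (upd nu x i w))) <-> ae E P.
Proof.
  intros HP Ha H.
  assert (forall x, x ∈ sep I P <-> x ∈ I /\ P x) as HS by now apply in_sep.
  transitivity (ae E (fun x => x ∈ fiber (sep I P))).
  - apply ae_E_iff. intros x Hx. rewrite in_fiber.
    rewrite (ae_W_iff x (fun w => upd nu x i w ∈ sep I P) (fun w => P (upd nu x i w))); auto.
    + tauto.
    + intros w Hw. rewrite HS. pose proof (upd_funs nu Z x i w Hx Hw). tauto.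
  - rewrite (fiber_iff_bounded nu Hnu a); auto.
    + apply ae_E_iff. intros x Hx. rewrite HS. tauto.
    + intros x Hx. now apply HS in Hx.
    + intros x y Hx Hy Hxy. rewrite !HS. intros [_ G]. split; eauto.
    + apply Ha.
Qed.

Variable B : V.
Hypothesis HiB : ~ i ∈ B.
Local Notation B' := (cup B (upr i i)).

Lemma in_B' c : c ∈ B' <-> c ∈ B \/ c = i.
Proof. rewrite in_cup, in_upr. tauto. Qed.

Lemma visible_B'_i x : visible B' x i = p (ap x i).
Proof. apply ite_true. apply in_B'. auto. Qed.

Lemma visible_B_i x : visible B x i = ap x i.
Proof. now apply ite_false. Qed.

Lemma visible_B'_other x c : c <> i -> visible B' x c = visible B x c.
Proof. intros H. apply ite_iff. rewrite in_B'. tauto. Qed.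

Lemma agree_B' a x y : agree B a x y -> (i ∈ a -> ap x i = ap y i) -> agree B' a x y.
Proof.
  intros H G c Hc. destruct (classic (c = i)) as [-> |N].
  - rewrite !visible_B'_i. now rewrite G.
  - rewrite !visible_B'_other by auto. auto.
Qed.

Lemma agree_upd a x y w : subset a nu -> agree B' a x y ->
  agree B a (upd nu x i w) (upd nu y i w).
Proof.
  intros Ha H c Hc. destruct (classic (c = i)) as [-> |N].
  - rewrite !visible_B_i. now rewrite !ap_upd_same.
  - specialize (H c Hc). rewrite !visible_B'_other in H by auto. revert H.
    unfold visible. rewrite !ap_upd_other by auto. auto.
Qed.

Lemma agree_upd_fiber a x w : subset a nu -> p w = p (ap x i) -> agree B' a (upd nu x i w) x.
Proof.
  intros Ha H c Hc. destruct (classic (c = i)) as [-> |N].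
  - rewrite !visible_B'_i. now rewrite ap_upd_same.
  - unfold visible. now rewrite ap_upd_other by auto.
Qed.

Definition section (f x : V) : V := lam Z (fun w => ap f (upd nu x i w)).

(** At [x] this is the element of the ultrapower by the fibre measure that [f] represents when only
    the [i]-th coordinate varies. It sees that coordinate through its projection only, so it
    represents an element of the model that blurs [i] as well. *)
Definition integral (f : V) : V :=
  lam I (fun x => ucol Z (W (p (ap x i))) (section f x)).

Lemma ap_integral f x : x ∈ I ->
  ap (integral f) x = ucol Z (W (p (ap x i))) (section f x).
Proof. intros Hx. unfold integral, section. rewrite ap_lam; auto. dsolve. Qed.

Lemma section_function f x : function_on (section f x) Z.
Proof. apply lam_function. dsolve. Qed.

Lemma ap_section f x w : w ∈ Z -> ap (section f x) w = ap f (upd nu x i w).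
Proof. intros Hw. unfold section. rewrite ap_lam; auto. dsolve. Qed.

Lemma finite_add_i a : finite_in nu a -> finite_in nu (cup a (upr i i)).
Proof. intros Ha. apply finite_in_cup; auto. now apply finite_in_singleton. Qed.

Lemma agree_B'_i a x y : agree B' (cup a (upr i i)) x y -> p (ap x i) = p (ap y i).
Proof.
  intros H. rewrite <- !visible_B'_i. apply H. apply in_cup. right. apply in_upr. auto.
Qed.

Lemma integral_adm f : adm I (traces B) f -> adm I (traces B') (integral f).
Proof.
  intros Hf. apply adm_traces in Hf. destruct Hf as (Hf & a & Ha & H). apply adm_traces.
  split; [apply lam_function; unfold section; dsolve|].
  exists (cup a (upr i i)). split; [now apply finite_add_i|].
  intros x y Hx Hy Hxy. rewrite !ap_integral by auto. rewrite (agree_B'_i a x y Hxy).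
  replace (section f x) with (section f y); [reflexivity|].
  symmetry. apply lam_ext; [dsolve|dsolve|]. intros w Hw.
  apply H; try now apply upd_funs. apply agree_upd; [apply Ha|].
  revert Hxy. apply agree_subset, subset_cup_l.
Qed.

Lemma memE_integral f g : adm I (traces B) f -> adm I (traces B) g ->
  memE E g f -> memE E (integral g) (integral f).
Proof.
  intros Hf Hg H.
  destruct (join_supports2 I E (traces B) (iterate_good B) f g Hf Hg) as (s & Hs & K1 & K2).
  apply in_traces in Hs. destruct Hs as (a & Ha & ->).
  unfold memE in H. rewrite <- (ae_fiber a) in H.
  - revert H. apply (ae_mono I E HE). intros x Hx H. rewrite !ap_integral by auto.
    apply in_ucol; auto using section_function, value_in.
    exists (section g x). split; [apply section_function|]. split; auto.
    revert H. apply (ae_mono Z _ (proj1 (HWu _ (value_in x i Hx Hi)))). intros w Hw.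
    now rewrite !ap_section.
  - dsolve.
  - exact Ha.
  - intros x y Hx Hy Hxy.
    assert (ap (trace B a) x = ap (trace B a) y) as G by (apply trace_eq; auto; now apply agree_eq).
    rewrite (K1 x y), (K2 x y); auto.
Qed.

(* A [B']-supported choice [k] of functions on the fibres is undone by evaluating it at the
   [i]-th coordinate. *)
Lemma uncurry k : adm I (traces B') k -> exists g, adm I (traces B) g /\
  forall x, x ∈ I -> ae (W (p (ap x i))) (fun w => ap g (upd nu x i w) = ap (ap k x) w).
Proof.
  intros Hk. apply adm_traces in Hk. destruct Hk as (Hk & a & Ha & H).
  exists (lam I (fun x => ap (ap k x) (ap x i))). split.
  - apply adm_traces. split; [apply lam_function; dsolve|].
    exists (cup a (upr i i)). split; [now apply finite_add_i|].
    intros x y Hx Hy Hxy. rewrite !ap_lam by (dsolve || auto).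
    assert (ap x i = ap y i) as E1.
    { rewrite <- !visible_B_i. apply Hxy. apply in_cup. right. apply in_upr. auto. }
    rewrite E1. f_equal. apply H; auto. apply agree_B'; auto.
    revert Hxy. apply agree_subset, subset_cup_l.
  - intros x Hx. generalize (Hfib _ (value_in x i Hx Hi)).
    apply (ae_mono Z _ (proj1 (HWu _ (value_in x i Hx Hi)))). intros w Hw Ew.
    pose proof (upd_funs nu Z x i w Hx Hw) as Hu.
    rewrite ap_lam by (dsolve || auto). rewrite ap_upd_same by auto.
    f_equal. apply H; auto. apply agree_upd_fiber; auto. apply Ha.
Qed.

Lemma ucol_uncurry k g x : x ∈ I -> function_on (ap k x) Z ->
  ae (W (p (ap x i))) (fun w => ap g (upd nu x i w) = ap (ap k x) w) ->
  ap (integral g) x = ucol Z (W (p (ap x i))) (ap k x).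
Proof.
  intros Hx Hk H. rewrite ap_integral by auto.
  apply ucol_eq; auto using section_function, value_in.
  revert H. apply (ae_mono Z _ (proj1 (HWu _ (value_in x i Hx Hi)))). intros w Hw.
  now rewrite ap_section.
Qed.

(** The factor lemma: forming the class of [f] in one go, or first in the fibre over x_i and then in
    the remaining data, gives literally the same set, as all models are collapsed. For the harder
    inclusion, a member of the class of [integral f] is at each [x] the class of some function on
    the fibre; such functions are selected with a finite support and then uncurried. *)
Lemma col_integral : forall y f, adm I (traces B) f -> y = col I E (traces B) f ->
  y = col I E (traces B') (integral f).
Proof.
  pose proof (iterate_good B) as HG. pose proof (iterate_good B') as HG'.
  apply (eps_ind (fun y => forall f, adm I (traces B) f -> y = col I E (traces B) f ->
    y = col I E (traces B') (integral f))).
  { unfold integral, section, iterate. dsolve; apply dft_traces; dsolve. }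
  intros y IH f Hf Ey. apply set_ext. intros u.
  rewrite (in_col I E _ HG' (integral f)) by now apply integral_adm. split.
  - intros Hu. pose proof Hu as Hu'. rewrite Ey in Hu'. apply (in_col I E _ HG f u Hf) in Hu'.
    destruct Hu' as (g & Hg & Hgf & Eu). exists (integral g).
    split; [now apply integral_adm|]. split; [now apply memE_integral|]. now apply IH.
  - intros (h & Hh & Hhf & Eu).
    pose proof Hf as Hf'. apply adm_traces in Hf'. destruct Hf' as (_ & a & Ha & Ka).
    pose proof Hh as Hh'. apply adm_traces in Hh'. destruct Hh' as (_ & b & Hb & Kb).
    destruct (selection_traces B' (cup (cup a b) (upr i i)) (fun x k => function_on k Z /\
      ae (W (p (ap x i))) (fun w => ap k w ∈ ap f (upd nu x i w)) /\
      ap h x = ucol Z (W (p (ap x i))) k)) as (k & Hk & Kk).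
    + dsolve.
    + apply finite_add_i. now apply finite_in_cup.
    + intros x y' Hx Hy Hxy k. rewrite (agree_B'_i _ _ _ Hxy).
      assert (agree B' a x y') as Hxa.
      { revert Hxy. apply agree_subset. intros z Hz. apply subset_cup_l, subset_cup_l, Hz. }
      assert (agree B' b x y') as Hxb.
      { revert Hxy. apply agree_subset. intros z Hz. apply subset_cup_l, subset_cup_r, Hz. }
      rewrite (Kb x y') by auto.
      rewrite (ae_W_iff y' (fun w => ap k w ∈ ap f (upd nu x i w))
        (fun w => ap k w ∈ ap f (upd nu y' i w))); [tauto|auto|].
      intros w Hw. rewrite (Ka (upd nu x i w) (upd nu y' i w)); [tauto| | |].
      * now apply upd_funs.
      * now apply upd_funs.
      * apply agree_upd; auto. apply Ha.
    + destruct (uncurry k Hk) as (g & Hg & Kg).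
      assert (ae E (fun x => function_on (ap k x) Z /\
        ae (W (p (ap x i))) (fun w => ap (ap k x) w ∈ ap f (upd nu x i w)) /\
        ap h x = ucol Z (W (p (ap x i))) (ap k x))) as K.
      { revert Hhf. apply (ae_mono I E HE). intros x Hx H. rewrite ap_integral in H by auto.
        apply in_ucol in H; auto using section_function, value_in.
        destruct H as (k0 & Hk0 & K0 & E0). apply Kk; auto. exists k0. split; auto. split; auto.
        revert K0. apply (ae_mono Z _ (proj1 (HWu _ (value_in x i Hx Hi)))). intros w Hw.
        now rewrite ap_section. }
      assert (memE E g f) as Hgf.
      { destruct (join_supports2 I E (traces B) HG f g Hf Hg) as (s & Hs & K1 & K2).
        apply in_traces in Hs. destruct Hs as (c & Hc & ->).
        apply (ae_fiber c (fun x => ap g x ∈ ap f x)).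
        - dsolve.
        - exact Hc.
        - intros x y' Hx Hy Hxy.
          assert (ap (trace B c) x = ap (trace B c) y') as G
            by (apply trace_eq; auto; now apply agree_eq).
          rewrite (K1 x y'), (K2 x y'); auto.
        - revert K. apply (ae_mono I E HE). intros x Hx (_ & K & _).
          generalize K (Kg x Hx).
          apply (ae_mono2 Z _ (proj1 (HWu _ (value_in x i Hx Hi)))).
          intros w Hw H1 ->. exact H1. }
      assert (col I E (traces B) g ∈ y) as Hy by (rewrite Ey; now apply (col_mem I E _ HG)).
      assert (u = col I E (traces B) g) as ->; [|exact Hy].
      rewrite (IH _ Hy g Hg eq_refl), Eu. apply (col_eq I E _ HG'); auto using integral_adm.
      revert K. apply (ae_mono I E HE). intros x Hx (K1 & _ & K3).
      rewrite K3. symmetry. apply ucol_uncurry; auto.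
Qed.

(** Membership in the finer model becomes a statement about ultrapowers of V, pointwise over the
    coarser one. This makes two finer models with the same coarsening comparable. *)
Lemma uclass_iff z : adm I (traces B') z ->
  uclass I E (traces B) (col I E (traces B') z) <->
  ae E (fun x => ult Z (W (p (ap x i))) (ap z x)).
Proof.
  pose proof (iterate_good B) as HG. pose proof (iterate_good B') as HG'.
  intros Hz. split.
  - intros (f & Hf & H). rewrite (col_integral _ f Hf eq_refl) in H.
    apply (col_eq I E _ HG') in H; auto using integral_adm.
    revert H. apply (ae_mono I E HE). intros x Hx ->. apply ult_iff.
    exists (section f x). split; [apply section_function|]. now apply ap_integral.
  - intros H. pose proof Hz as Hz'. apply adm_traces in Hz'. destruct Hz' as (_ & a & Ha & Ka).
    destruct (selection_traces B' (cup a (upr i i)) (fun x k => function_on k Z /\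
      ap z x = ucol Z (W (p (ap x i))) k)) as (k & Hk & Kk).
    + dsolve.
    + now apply finite_add_i.
    + intros x y Hx Hy Hxy k. rewrite (agree_B'_i _ _ _ Hxy).
      rewrite (Ka x y); auto; [tauto|]. revert Hxy. apply agree_subset, subset_cup_l.
    + destruct (uncurry k Hk) as (g & Hg & Kg). exists g. split; [exact Hg|].
      rewrite (col_integral _ g Hg eq_refl). apply (col_eq I E _ HG'); auto using integral_adm.
      revert H. apply (ae_mono I E HE). intros x Hx H. apply ult_iff in H.
      destruct (Kk x Hx H) as [K1 K2]. rewrite K2. symmetry. apply ucol_uncurry; auto.
Qed.

End Factor.
End FiniteSupports.

(** * The models and their embeddings *)

Section Models.
Context {V : set_structure} {HV : ZFC V}.
Variables (nu Z D : V) (p : V -> V).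
Hypotheses (Hnu : ordinal nu) (HD : ultra Z D) (Hp : dfun1 p).
Let HD' : sfilter Z D := proj1 HD.
Local Notation I := (funs nu Z).
Local Notation E := (iterate nu Z D).
Let HE : sfilter I E := iterate_sfilter nu Z D Hnu HD.

Definition model (i y : V) : Prop := uclass I E (traces nu Z p (upr i i)) y.

(** * Distinctness of the models *)

Section Distinct.
Variable W : V -> V.
Hypotheses (HW : dfun1 W)
  (HWu : forall z, z ∈ Z -> ultra Z (W (p z)))
  (Hfib : forall z, z ∈ Z -> ae (W (p z)) (fun w => p w = p z))
  (Hint : forall P, dpr1 P -> ae D (fun z => ae (W (p z)) P) <-> ae D P)
  (Hcom : forall z Y, z ∈ Z -> dpr2 Y -> ae (W (p z)) (fun w => ae D (fun v => Y w v)) <->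
     ae D (fun v => ae (W (p z)) (fun w => Y w v)))
  (Hne : forall z, z ∈ Z -> ae D (fun v => p v <> p z))
  (Hdist : forall z v, z ∈ Z -> v ∈ Z -> p z <> p v ->
     exists y, ~ (ult Z (W (p z)) y <-> ult Z (W (p v)) y)).

Lemma ae_projections_lt i j : j ∈ nu -> i ∈ j -> ae E (fun x => p (ap x i) <> p (ap x j)).
Proof.
  intros Hj Hij. assert (i ∈ nu) as Hi by now apply (proj1 Hnu j).
  assert (i <> j) as N by (intros ->; now apply (not_mem_self j)).
  pose (X := sep I (fun x => p (ap x i) <> p (ap x j))).
  assert (forall x, x ∈ X <-> x ∈ I /\ p (ap x i) <> p (ap x j)) as HX
    by (apply in_sep; dsolve).
  assert (ae E (fun x => x ∈ X)) as K.
  { apply (average_iff nu Z D Hnu HD (cup (upr i i) (upr j j)) j X).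
    - apply finite_in_cup; auto; now apply finite_in_singleton.
    - exact Hj.
    - intros c Hc. apply in_cup in Hc. rewrite !in_upr in Hc.
      destruct Hc as [[-> | ->]|[-> | ->]]; auto.
    - intros x y Hx Hy H. rewrite !HX. intros [_ G]. split; auto.
      rewrite <- !H; auto; apply in_cup; rewrite !in_upr; auto.
    (* With x_i held fixed, averaging over the later coordinate [j] leaves exactly [Hne]. *)
    - apply (ae_all I E HE). intros x Hx. apply in_average. split; auto.
      generalize (Hne (ap x i) (value_in nu Z x i Hx Hi)). apply (ae_mono Z D HD').
      intros v Hv H. apply HX. split; [now apply upd_funs|].
      rewrite ap_upd_other, ap_upd_same by auto. congruence. }
  revert K. apply (ae_mono I E HE). intros x Hx H. now apply HX in H.
Qed.

Lemma ae_projections i j : i ∈ nu -> j ∈ nu -> i <> j ->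
  ae E (fun x => p (ap x i) <> p (ap x j)).
Proof.
  intros Hi Hj N.
  destruct (ordinal_trichotomy i (ordinal_elem _ _ Hnu Hi) j (ordinal_elem _ _ Hnu Hj))
    as [H|[H|H]].
  - now apply ae_projections_lt.
  - contradiction.
  - generalize (ae_projections_lt j i Hi H). apply (ae_mono I E HE). congruence.
Qed.

(** With both [i] and [j] blurred, choose at almost every [x] a set lying in only one of the two
    fibre ultrapowers. The class of this choice belongs to exactly one of the two models. *)
Lemma models_distinct i j : i ∈ nu -> j ∈ nu -> i <> j ->
  ~ forall y, model i y <-> model j y.
Proof.
  intros Hi Hj N HM.
  set (B := cup (upr i i) (upr j j)).
  assert (cup (upr j j) (upr i i) = B) as EB.
  { apply set_ext. intros c. unfold B. rewrite !in_cup. tauto. }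
  assert (forall c, c = i \/ c = j -> c ∈ B) as HB.
  { intros c Hc. unfold B. rewrite in_cup, !in_upr. tauto. }
  pose (A := fun k x y => ult Z (W (p (ap x k))) y).
  assert (forall k, dpr2 (A k)) as HA by (intros k; unfold A; dsolve).
  pose proof (HA i) as HAi. pose proof (HA j) as HAj.
  assert (finite_in nu B) as HBf.
  { apply finite_in_cup; auto; now apply finite_in_singleton. }
  assert (forall k x y, k = i \/ k = j -> agree p B B x y -> p (ap x k) = p (ap y k)) as Hag.
  { intros k x y Hk H. specialize (H k (HB k Hk)). unfold visible in H.
    rewrite !ite_true in H; auto. }
  (* The separating set depends on [x] only through the two projections, so blurring [i] and [j]
     keeps the selected function admissible. *)
  destruct (selection_traces nu Z p Hp B B (fun x y => ~ (A i x y <-> A j x y)))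
    as (z & Hz & Kz); [dsolve|exact HBf| |].
  { intros x y Hx Hy H w. unfold A. rewrite (Hag i x y), (Hag j x y) by auto. tauto. }
  assert (ae E (fun x => ~ (A i x (ap z x) <-> A j x (ap z x)))) as K.
  { generalize (ae_projections i j Hi Hj N). apply (ae_mono I E HE). intros x Hx Hpx.
    apply Kz; auto. apply Hdist; auto; now apply (value_in nu). }
  (* The indices cross: the model that blurs [j] still sees x_i, so it is the one obtained by
     resampling [i]. *)
  assert (ae E (fun x => A i x (ap z x)) <-> ae E (fun x => A j x (ap z x))) as L.
  { transitivity (model j (col I E (traces nu Z p B) z)).
    - symmetry. unfold model. rewrite <- EB.
      apply (uclass_iff nu Z D p Hnu HD Hp W HW HWu Hfib Hint Hcom i Hi).
      + rewrite in_upr. intuition congruence.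
      + rewrite EB. exact Hz.
    - rewrite <- HM. unfold model.
      apply (uclass_iff nu Z D p Hnu HD Hp W HW HWu Hfib Hint Hcom j Hj).
      + rewrite in_upr. intuition congruence.
      + exact Hz. }
  pose proof Hz as Hz'. apply adm_traces in Hz'; [|exact Hp].
  destruct Hz' as (_ & a & Ha & Ka).
  assert (forall k, k = i \/ k = j -> ae E (fun x => A k x (ap z x)) \/
    ae E (fun x => ~ A k x (ap z x))) as Hdec.
  { intros k Hk. pose proof (HA k) as HAk. apply (ae_dec_traces nu Z D p Hnu HD Hp B (cup a B)); [dsolve| |].
    - now apply finite_in_cup.
    - intros x y Hx Hy H. unfold A. rewrite (Hag k x y); auto.
      + rewrite (Ka x y); auto. revert H. apply agree_subset, subset_cup_l.
      + revert H. apply agree_subset, subset_cup_r. }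
  (* The filter decides both memberships. Equal verdicts contradict [K], different ones contradict
     [L]. *)
  destruct (Hdec i) as [H1|H1]; auto; destruct (Hdec j) as [H2|H2]; auto.
  - apply (ae_contra I E HE _ (ae_and I E HE _ _ H1 H2)). revert K.
    apply (ae_mono I E HE). tauto.
  - apply L in H1. exact (ae_contra I E HE _ H1 H2).
  - apply L in H2. exact (ae_contra I E HE _ H2 H1).
  - apply (ae_contra I E HE _ (ae_and I E HE _ _ H1 H2)). revert K.
    apply (ae_mono I E HE). tauto.
Qed.
End Distinct.

(** * Embeddings obtained by skipping a coordinate *)

Section Embed.
Hypothesis Hlim : forall c, c ∈ nu -> suc c ∈ nu.
Variables (i j : V).
Hypothesis Hj : j ∈ nu.

Definition bump (c : V) : V := ite (c ∈ j) c (suc c).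

Lemma bump_dfun1 : dfun1 bump.
Proof. unfold bump. dsolve. Qed.

Lemma bump_in c : c ∈ nu -> bump c ∈ nu.
Proof.
  intros Hc. unfold bump. destruct (classic (c ∈ j)).
  - now rewrite ite_true.
  - rewrite ite_false by auto. auto.
Qed.

Lemma bump_neq c : bump c <> j.
Proof.
  unfold bump. destruct (classic (c ∈ j)) as [H|H].
  - rewrite ite_true by auto. intros ->. now apply (not_mem_self j).
  - rewrite ite_false by auto. intros G. apply H. rewrite <- G. apply in_suc. auto.
Qed.

Lemma suc_mono c d : ordinal d -> c ∈ d -> suc c ∈ suc d.
Proof.
  intros Hd Hc. apply in_suc.
  destruct (ordinal_trichotomy (suc c)) with (b := d) as [H|[H|H]]; auto.
  - apply ordinal_suc. now apply (ordinal_elem d).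
  - exfalso. apply in_suc in H. destruct H as [H| ->].
    + exact (ordinal_asym d c Hd H Hc).
    + exact (not_mem_self c Hc).
Qed.

Lemma bump_mono c d : c ∈ d -> d ∈ nu -> bump c ∈ bump d.
Proof.
  intros Hc Hd. assert (ordinal d) as Hdo by exact (ordinal_elem nu d Hnu Hd).
  assert (ordinal j) as Hjo by exact (ordinal_elem nu j Hnu Hj).
  unfold bump. destruct (classic (d ∈ j)) as [H|H].
  - rewrite (ite_true (d ∈ j)) by auto. rewrite ite_true; auto. now apply (proj1 Hjo d).
  - rewrite (ite_false (d ∈ j)) by auto. destruct (classic (c ∈ j)).
    + rewrite ite_true by auto. apply in_suc. auto.
    + rewrite ite_false by auto. now apply suc_mono.
Qed.

Lemma bump_inj c d : c ∈ nu -> d ∈ nu -> bump c = bump d -> c = d.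
Proof.
  intros Hc Hd E0.
  destruct (ordinal_trichotomy c (ordinal_elem _ _ Hnu Hc) d (ordinal_elem _ _ Hnu Hd))
    as [H|[H|H]]; auto; exfalso; apply bump_mono in H; auto;
    rewrite E0 in H; exact (not_mem_self _ H).
Qed.

Definition shift : V := lam I (fun x => lam nu (fun c => ap x (bump c))).

Lemma ap_shift x : x ∈ I -> ap shift x = lam nu (fun c => ap x (bump c)).
Proof.
  pose proof bump_dfun1. intros Hx. unfold shift. rewrite ap_lam; [reflexivity|dsolve|auto].
Qed.

Lemma ap_ap_shift x c : x ∈ I -> c ∈ nu -> ap (ap shift x) c = ap x (bump c).
Proof.
  pose proof bump_dfun1. intros Hx Hc. rewrite ap_shift by auto.
  rewrite ap_lam; [reflexivity|dsolve|auto].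
Qed.

Lemma shift_in x : x ∈ I -> ap shift x ∈ I.
Proof.
  pose proof bump_dfun1. intros Hx. rewrite ap_shift by auto.
  apply lam_funs; [dsolve|]. intros c Hc. apply (value_in nu); auto. now apply bump_in.
Qed.

Lemma finite_in_bump a : finite_in nu a -> finite_in nu (rep a bump).
Proof.
  pose proof bump_dfun1 as Hb. intros [Ha Hmax].
  split.
  - intros x Hx. apply in_rep in Hx; auto. destruct Hx as (c & Hc & ->). apply bump_in; auto.
  - intros b Hba (x & Hx).
    assert (forall c, c ∈ sep a (fun c => bump c ∈ b) <-> c ∈ a /\ bump c ∈ b) as HS
      by (apply in_sep; dsolve).
    destruct (Hmax (sep a (fun c => bump c ∈ b))) as (m & Hm & K).
    + intros c Hc. now apply HS in Hc.
    + pose proof (Hba x Hx) as Hx'. apply in_rep in Hx'; auto. destruct Hx' as (c & Hc & ->).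
      exists c. now apply HS.
    + apply HS in Hm. exists (bump m). split; [tauto|]. intros d Hd.
      pose proof (Hba d Hd) as Hd'. apply in_rep in Hd'; auto. destruct Hd' as (c & Hc & ->).
      destruct (K c) as [G| ->]; auto.
      * now apply HS.
      * left. apply bump_mono; auto. now apply Ha.
Qed.

(** The target blurs only [j], which is not in the range of [bump]. All coordinates that are read
    after the shift are fully visible, so it does not matter which one the source blurs. *)
Lemma shift_adm f : adm I (traces nu Z p (upr i i)) f ->
  adm I (traces nu Z p (upr j j)) (reindex I shift f).
Proof.
  pose proof bump_dfun1 as Hb. intros Hf. apply adm_traces in Hf; [|exact Hp].
  destruct Hf as (Hf & a & Ha & H). apply adm_traces; [exact Hp|].
  split; [apply lam_function; dsolve|].
  exists (rep a bump). split; [now apply finite_in_bump|].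
  intros x y Hx Hy Hxy. unfold reindex. rewrite !ap_lam by (dsolve || auto).
  apply H; try now apply shift_in.
  apply agree_eq. intros c Hc. assert (c ∈ nu) by now apply Ha.
  rewrite !ap_ap_shift by auto.
  specialize (Hxy (bump c)). unfold visible in Hxy. rewrite !ite_false in Hxy.
  - apply Hxy. apply in_rep; eauto.
  - rewrite in_upr. pose proof (bump_neq c). tauto.
  - rewrite in_upr. pose proof (bump_neq c). tauto.
Qed.

Lemma domain_unique (f a b : V) : function_on f a -> function_on f b -> a = b.
Proof.
  intros Ha Hb. apply set_ext. intros x. split; intros Hx.
  - apply (app_dom f b x (ap f x)); auto. now apply (app_ap f a).
  - apply (app_dom f a x (ap f x)); auto. now apply (app_ap f b).
Qed.

(** A strategy for [X] is pulled back: at position [bump c] the sequence played so far is thinned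
    out to one of length [c], and the strategy is consulted there. *)
Lemma shift_filter X : X ∈ E -> ae E (fun x => ap shift x ∈ X).
Proof.
  pose proof bump_dfun1 as Hb. intros HX. apply in_iterate in HX.
  destruct HX as (HXI & F & HF & HFX).
  (* Recovers [c] from a partial sequence of length [bump c], by injectivity of [bump]. *)
  pose (stage := fun g => iota (fun c => c ∈ nu /\ function_on g (bump c))).
  assert (dfun1 stage) as Hst by (unfold stage; dsolve).
  assert (forall g c, c ∈ nu -> function_on g (bump c) -> stage g = c) as Hstage.
  { intros g c Hc Hg. apply iota_eq; auto. intros d [Hd Hgd].
    apply bump_inj; auto. exact (domain_unique g _ _ Hgd Hg). }
  (* The positions outside the range of [bump] are [j] and the limit ordinals above it; there every
     element of [Z] is allowed. *)
  pose (G := fun g => ite (exists c, c ∈ nu /\ function_on g (bump c))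
    (ap F (lam (stage g) (fun e => ap g (bump e)))) Z).
  assert (dfun1 G) as HG by (unfold G; dsolve).
  destruct (make_strategy nu Z G HG) as (F' & HF').
  apply (ae_iterate nu Z D _ F').
  - assert (dft true (fun _ : nat -> V => shift)) by dsolve. dsolve.
  - intros d g Hd Hg. rewrite (HF' d) by auto. unfold G.
    destruct (classic (exists c, c ∈ nu /\ function_on g (bump c))) as [(c & Hc & Hgc)|N].
    + rewrite ite_true by eauto. rewrite (Hstage g c) by auto. apply (HF c); auto.
      apply lam_funs; [dsolve|]. intros e He. apply in_funs in Hg. apply Hg.
      rewrite (domain_unique g d (bump c)) by tauto. now apply bump_mono.
    + rewrite ite_false by auto. apply HD'.
  - intros x Hx Hf. apply HFX; [now apply shift_in|]. intros c Hc.
    rewrite ap_ap_shift by auto. pose proof (Hf (bump c) (bump_in c Hc)) as K.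
    rewrite (HF' _ _ (bump_in c Hc) (restr_funs nu Z Hnu x _ Hx (bump_in c Hc))) in K.
    assert (function_on (restr x (bump c)) (bump c)) as Hr by (apply lam_function; dsolve).
    unfold G in K. rewrite ite_true in K by eauto. rewrite (Hstage _ c) in K by auto.
    replace (restr (ap shift x) c) with (lam c (fun e => ap (restr x (bump c)) (bump e)));
      [exact K|].
    apply lam_ext; [dsolve|dsolve|]. intros e He.
    rewrite ap_ap_shift by (auto; now apply (proj1 Hnu c)).
    unfold restr. rewrite ap_lam; [reflexivity|dsolve|]. now apply bump_mono.
Qed.

Lemma model_embedding : exists f, elementary_embedding (model i) (model j) f.
Proof.
  exact (reindex_elementary I E (traces nu Z p (upr i i)) I E (traces nu Z p (upr j j)) shift
    (iterate_good nu Z D p Hnu HD Hp (upr i i)) (iterate_good nu Z D p Hnu HD Hp (upr j j))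
    shift_in shift_adm shift_filter).
Qed.
End Embed.

End Models.

(** * Measures *)

Section Measures.
Context {V : set_structure} {HV : ZFC V}.

Lemma natural_in_infinite (n w : V) : ordinal w -> ~ natural_number w -> natural_number n ->
  n ∈ w.
Proof.
  intros Hw N Hn. destruct (ordinal_trichotomy n (proj1 Hn) w Hw) as [H|[H|H]]; auto.
  - now subst.
  - exfalso. apply N. now apply (natural_elem n).
Qed.

Lemma omega_in_uncountable (k : V) : uncountable_cardinal k -> omega ∈ k.
Proof.
  intros [[Hk _] (w & Hw & N)]. assert (ordinal w) as Hwo by now apply (ordinal_elem k).
  destruct (ordinal_trichotomy omega ordinal_omega w Hwo) as [H|[H|H]].
  - now apply (proj1 Hk w).
  - now subst.
  - exfalso. apply N. now apply in_omega.
Qed.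

(* Hilbert's hotel: an infinite ordinal is equinumerous with its successor. *)
Lemma infinite_cardinal_limit (nu : V) : infinite_cardinal nu ->
  forall c, c ∈ nu -> suc c ∈ nu.
Proof.
  intros [[Ho Hc] Hinf] t Ht. assert (ordinal t) as Hto by now apply (ordinal_elem nu).
  destruct (ordinal_trichotomy (suc t) (ordinal_suc t Hto) nu Ho) as [H|[H|H]]; auto.
  2: { exfalso. apply in_suc in H. destruct H as [H| ->].
       - exact (ordinal_asym nu t Ho H Ht).
       - exact (not_mem_self t Ht). }
  exfalso. subst nu. apply (Hc t Ht).
  assert (~ natural_number t) as Nt by (intros G; now apply Hinf, natural_suc).
  (* Here [bigcup x] is the predecessor of a positive natural number: shifting the natural numbers
     down frees 0 to hit the extra point [t]. *)
  pose (F := fun x => ite (x = zero) t (ite (natural_number x) (bigcup x) x)).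
  assert (dfun1 F) as HF by (unfold F; dsolve).
  assert (F zero = t) as F0 by now apply ite_true.
  assert (forall n : V, suc n <> zero) as Hsz.
  { intros n G. apply (in_zero n). rewrite <- G. apply in_suc. auto. }
  assert (forall n, natural_number n -> F (suc n) = n) as FS.
  { intros n Hn. unfold F. rewrite ite_false by auto.
    rewrite ite_true by now apply natural_suc. exact (bigcup_suc n (proj1 (proj1 Hn))). }
  assert (forall x, ~ natural_number x -> F x = x) as FN.
  { intros x Hx. unfold F. rewrite !ite_false; auto.
    intros ->. apply Hx, natural_zero. }
  assert (forall x, x = zero \/ (exists n, natural_number n /\ x = suc n) \/ ~ natural_number x)
    as Hcases.
  { intros x. destruct (classic (natural_number x)) as [Hx|Hx]; auto.
    pose proof Hx as (_ & [G|[y Hy]] & _).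
    - left. now apply empty_zero.
    - right. left. apply successor_suc in Hy. subst x. exists y. split; auto.
      apply (natural_elem (suc y)); auto. apply in_suc. auto. }
  assert (forall x, x ∈ t -> F x ∈ suc t) as Hinto.
  { intros x Hx. apply in_suc. destruct (Hcases x) as [-> |[(n & Hn & ->)|Hx']].
    - auto.
    - rewrite FS by auto. left. now apply natural_in_infinite.
    - rewrite FN; auto. }
  exists (lam t F). split; [now apply lam_function|]. split; [|split].
  - apply (maps_into_ap _ t); [now apply lam_function|].
    intros x Hx. rewrite ap_lam; auto.
  - intros x x' y Hx Hx'.
    pose proof (app_dom _ _ _ _ (lam_function t F HF) Hx) as Dx.
    pose proof (app_dom _ _ _ _ (lam_function t F HF) Hx') as Dx'.
    apply (app_eq _ t) in Hx; [|now apply lam_function].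
    apply (app_eq _ t) in Hx'; [|now apply lam_function].
    rewrite ap_lam in Hx, Hx' by auto. rewrite Hx in Hx'. clear Hx y.
    destruct (Hcases x) as [-> |[(n & Hn & ->)|Nx]];
    destruct (Hcases x') as [-> |[(n' & Hn' & ->)|Nx']]; auto;
    rewrite ?F0, ?FS, ?FN in Hx' by auto.
    + exfalso. subst n'. contradiction.
    + exfalso. subst x'. exact (not_mem_self _ Dx').
    + exfalso. subst n. contradiction.
    + congruence.
    + exfalso. subst x'. contradiction.
    + exfalso. subst x. exact (not_mem_self _ Dx).
    + exfalso. subst x. contradiction.
    + exact Hx'.
  - intros y Hy.
    assert (exists x, x ∈ t /\ F x = y) as (x & Hx & <-).
    { apply in_suc in Hy. destruct Hy as [Hy| ->].
      - destruct (classic (natural_number y)) as [Ny|Ny].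
        + exists (suc y). split; [|now apply FS]. apply natural_in_infinite; auto.
          now apply natural_suc.
        + exists y. auto.
      - exists zero. split; auto. apply natural_in_infinite; auto. apply natural_zero. }
    exists x. rewrite <- (ap_lam t x F) by auto. apply (app_ap _ t); auto.
    now apply lam_function.
Qed.

Definition measure (k U : V) : Prop := ultrafilter U k /\ nonprincipal U k /\ complete U k.

Lemma dfn_measure b (t s : (nat -> V) -> V) : dft b t -> dft b s ->
  dfn b (fun e => measure (t e) (s e)).
Proof. intros; unfold measure, ultrafilter, nonprincipal, complete, upair; dsolve. Qed.

Section OneMeasure.
Variables (k U : V).
Hypotheses (Hk : omega ∈ k) (HU : measure k U).

Lemma measure_intersection l f : l ∈ k -> function_on f l ->
  (forall n, n ∈ l -> ap f n ∈ U) ->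
  exists Y, Y ∈ U /\ forall x n, x ∈ Y -> n ∈ l -> x ∈ ap f n.
Proof.
  destruct HU as (_ & _ & HC). intros Hl Hf H.
  assert (forall x, x ∈ sep k (fun x => forall i X, app f i X -> x ∈ X) <->
    x ∈ k /\ forall i X, app f i X -> x ∈ X) as HS by (apply in_sep; dsolve).
  exists (sep k (fun x => forall i X, app f i X -> x ∈ X)). split.
  - apply (HC l f); auto. now apply (maps_into_ap f l).
  - intros x n Hx Hn. apply HS in Hx. apply (proj2 Hx n). now apply (app_ap f l).
Qed.

Lemma measure_ultra : ultra k U.
Proof.
  destruct HU as ((U1 & U2 & U3 & U4 & U5 & U6) & _ & _). split.
  - split; [exact U1|]. split; [exact U4|]. split; [exact U2|]. split.
    + intros X HX. apply NNPP. intros N. apply (U3 X HX). intros y Hy. eauto.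
    + intros c Hc.
      destruct (measure_intersection omega (lam omega (ap c)) Hk) as (Y & HY & H).
      * apply lam_function. dsolve.
      * intros n Hn. rewrite ap_lam by (dsolve || auto). auto.
      * exists Y. split; auto. intros x n Hx Hn. specialize (H x n Hx Hn).
        now rewrite ap_lam in H by (dsolve || auto).
  - intros X HX.
    assert (forall w, w ∈ sep k (fun w => ~ w ∈ X) <-> w ∈ k /\ ~ w ∈ X) as HS
      by (apply in_sep; dsolve).
    destruct (U6 X (sep k (fun w => ~ w ∈ X)) HX HS) as [H|H]; auto.
    right. exists (sep k (fun w => ~ w ∈ X)). split; auto. intros x Hx. now apply HS in Hx.
Qed.

Lemma measure_complete l (P : V -> V -> Prop) : l ∈ k -> dpr2 P ->
  (forall n, n ∈ l -> ae U (P n)) -> ae U (fun x => forall n, n ∈ l -> P n x).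
Proof.
  intros Hl HP H. pose proof (proj1 measure_ultra) as HF.
  assert (dfun1 (fun n => sep k (P n))) as HD by dsolve.
  destruct (measure_intersection l (lam l (fun n => sep k (P n))) Hl) as (Y & HY & K).
  - now apply lam_function.
  - intros n Hn. rewrite ap_lam by auto. apply (ae_sep k U HF); auto. dsolve.
  - exists Y. split; auto. intros x Hx n Hn. specialize (K x n Hx Hn).
    rewrite ap_lam in K by auto. apply in_sep in K; [tauto|dsolve].
Qed.

Lemma measure_nonprincipal a : a ∈ k -> ae U (fun x => x <> a).
Proof.
  intros Ha. destruct (ultra_dec k U (fun x => x = a) measure_ultra) as [H|H]; [dsolve| |exact H].
  exfalso. destruct H as (X & HX & H). destruct HU as ((_ & _ & _ & U4 & _) & HN & _).
  apply (HN a (upr a a) Ha); [apply upair_upr|]. apply (U4 X); auto.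
  - intros x Hx. apply in_upr. left. auto.
  - intros x Hx. apply in_upr in Hx. now destruct Hx as [-> | ->].
Qed.
End OneMeasure.

(** One implication for all [Y] suffices: the other is the contrapositive for the complement of [Y],
    since both ultrafilters decide. *)
Lemma ultra_commute Z1 U1 Z2 U2 : ultra Z1 U1 -> ultra Z2 U2 ->
  (forall Y, dpr2 Y -> ae U1 (fun x => ae U2 (fun y => Y x y)) ->
    ae U2 (fun y => ae U1 (fun x => Y x y))) ->
  forall Y, dpr2 Y -> ae U1 (fun x => ae U2 (fun y => Y x y)) <->
    ae U2 (fun y => ae U1 (fun x => Y x y)).
Proof.
  intros H1 H2 H Y HY. split; [auto|]. intros G.
  destruct (ultra_dec Z1 U1 (fun x => ae U2 (fun y => Y x y)) H1) as [K|K]; [dsolve|exact K|].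
  exfalso.
  assert (ae U2 (fun y => ae U1 (fun x => ~ Y x y))) as L.
  { apply (H (fun x y => ~ Y x y)); [dsolve|].
    revert K. apply (ae_mono Z1 U1 (proj1 H1)). intros x Hx N.
    destruct (ultra_dec Z2 U2 (fun y => Y x y) H2) as [M|M]; [dsolve|contradiction|exact M]. }
  destruct (ae_ex Z2 U2 (proj1 H2) _ (ae_and Z2 U2 (proj1 H2) _ _ G L)) as (y & _ & M1 & M2).
  exact (ae_contra Z1 U1 (proj1 H1) _ M1 M2).
Qed.

(** As [k1] is below [k2], completeness of [U2] gives one large set of [y] that works for all [x] in
    [k1] simultaneously. *)
Lemma measures_commute k1 U1 k2 U2 : omega ∈ k1 -> omega ∈ k2 -> measure k1 U1 ->
  measure k2 U2 -> k1 ∈ k2 ->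
  forall Y, dpr2 Y -> ae U1 (fun x => ae U2 (fun y => Y x y)) <->
    ae U2 (fun y => ae U1 (fun x => Y x y)).
Proof.
  intros Hw1 Hw2 H1 H2 Hk.
  pose proof (measure_ultra k1 U1 Hw1 H1) as M1. pose proof (measure_ultra k2 U2 Hw2 H2) as M2.
  apply (ultra_commute k1 U1 k2 U2 M1 M2).
  intros Y HY H.
  assert (ae U2 (fun y => forall x, x ∈ k1 -> ae U2 (fun y => Y x y) -> Y x y)) as K.
  { apply (measure_complete k2 U2 Hw2 H2 k1 (fun x y => ae U2 (fun y => Y x y) -> Y x y)); auto.
    - dsolve.
    - intros x Hx. destruct (classic (ae U2 (fun y => Y x y))) as [G|G].
      + revert G. apply (ae_mono k2 U2 (proj1 M2)). auto.
      + apply (ae_all k2 U2 (proj1 M2)). tauto. }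
  revert K. apply (ae_mono k2 U2 (proj1 M2)). intros y Hy K.
  revert H. apply (ae_mono k1 U1 (proj1 M1)). auto.
Qed.

(** The limit along [U] of a family of ultrafilters. It covers both the copy of W_a on the disjoint
    union, a limit of principal ultrafilters, and the average of these copies. *)
Lemma ultra_limit K U Z (A : V -> V -> Prop) : ultra K U -> dpr2 A ->
  (forall a X Y, a ∈ K -> A a X -> subset X Y -> subset Y Z -> A a Y) ->
  (forall a, a ∈ K -> A a Z) ->
  (forall a X, a ∈ K -> subset X Z -> A a X -> exists x, x ∈ X) ->
  (forall a c, a ∈ K -> (forall n, n ∈ omega -> subset (ap c n) Z /\ A a (ap c n)) ->
     A a (sep Z (fun x => forall n, n ∈ omega -> x ∈ ap c n))) ->
  (forall a X, a ∈ K -> subset X Z -> A a X \/ A a (sep Z (fun x => ~ x ∈ X))) ->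
  ultra Z (sep (pow Z) (fun X => ae U (fun a => A a X))).
Proof.
  intros HU HA A1 A2 A3 A4 A5. pose proof (proj1 HU) as HF.
  assert (forall X, X ∈ sep (pow Z) (fun X => ae U (fun a => A a X)) <->
    subset X Z /\ ae U (fun a => A a X)) as HS.
  { intros X. rewrite in_sep by dsolve. now rewrite in_pow. }
  split; [split; [|split; [|split; [|split]]]|].
  - intros X HX. now apply HS in HX.
  - intros X Y HX HXY HY. apply HS in HX. apply HS. split; auto. destruct HX as [_ HX].
    revert HX. apply (ae_mono K U HF). intros a Ha H. apply (A1 a X); auto.
  - apply HS. split; [now intros x|]. now apply (ae_all K U HF).
  - intros X HX. apply HS in HX. destruct HX as [HX H]. apply (ae_ex K U HF) in H.
    destruct H as (a & Ha & H). apply (A3 a); auto.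
  - intros c Hc. exists (sep Z (fun x => forall n, n ∈ omega -> x ∈ ap c n)).
    assert (forall x, x ∈ sep Z (fun x => forall n, n ∈ omega -> x ∈ ap c n) <->
      x ∈ Z /\ forall n, n ∈ omega -> x ∈ ap c n) as HT by (apply in_sep; dsolve).
    split.
    + apply HS. split; [intros x Hx; now apply HT in Hx|].
      assert (ae U (fun a => forall n, n ∈ omega -> A a (ap c n))) as H.
      { apply (ae_omega K U HF (fun n a => A a (ap c n))); [dsolve|].
        intros n Hn. specialize (Hc n Hn). now apply HS in Hc. }
      revert H. apply (ae_mono K U HF). intros a Ha H. apply A4; auto.
      intros n Hn. split; auto. specialize (Hc n Hn). now apply HS in Hc.
    + intros x n Hx Hn. apply HT in Hx. now apply Hx.
  - intros X HX.
    assert (forall x, x ∈ sep Z (fun x => ~ x ∈ X) <-> x ∈ Z /\ ~ x ∈ X) as HT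
      by (apply in_sep; dsolve).
    destruct (ultra_dec K U (fun a => A a X) HU) as [H|H]; [dsolve| |].
    + left. now apply HS.
    + right. exists (sep Z (fun x => ~ x ∈ X)). split.
      * apply HS. split; [intros x Hx; now apply HT in Hx|].
        revert H. apply (ae_mono K U HF). intros a Ha H. destruct (A5 a X Ha HX); tauto.
      * intros x Hx. now apply HT in Hx.
Qed.

(** * The average of the measures on their disjoint union *)

Section FromMeasurables.
Variables (kappa U m wm : V).
Hypotheses (Hkappa : omega ∈ kappa) (HU : measure kappa U)
  (Hm : forall a, a ∈ kappa -> ordinal (ap m a) /\ omega ∈ ap m a /\ kappa ∈ ap m a)
  (Hinj : forall a b, a ∈ kappa -> b ∈ kappa -> ap m a = ap m b -> a = b)
  (Hwm : forall a, a ∈ kappa -> measure (ap m a) (ap wm a)).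

Let HUu : ultra kappa U := measure_ultra kappa U Hkappa HU.
Let HUf : sfilter kappa U := proj1 HUu.

Lemma wm_ultra a : a ∈ kappa -> ultra (ap m a) (ap wm a).
Proof. intros Ha. apply measure_ultra; auto. now apply Hm. Qed.

Definition total : V := bigcup (rep kappa (fun a => rep (ap m a) (fun x => opr a x))).

Definition base (z : V) : V := iota (fun a => exists x, z = opr a x).
Definition height (z : V) : V := iota (fun x => exists a, z = opr a x).

Definition fibre_measure (a : V) : V :=
  sep (pow total) (fun X => ae (ap wm a) (fun x => opr a x ∈ X)).

Definition total_measure : V :=
  sep (pow total) (fun X => ae U (fun a => X ∈ fibre_measure a)).

Lemma in_total z : z ∈ total <-> exists a x, a ∈ kappa /\ x ∈ ap m a /\ z = opr a x.
Proof.
  unfold total. rewrite in_bigcup_rep by dsolve. split.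
  - intros (a & Ha & Hz). apply in_rep in Hz; [|dsolve]. destruct Hz as (x & Hx & ->). eauto.
  - intros (a & x & Ha & Hx & ->). exists a. split; auto. apply in_rep; [dsolve|eauto].
Qed.

Lemma base_opr a x : base (opr a x) = a.
Proof.
  apply iota_eq; [eauto|]. intros b (y & H). apply opr_inj in H. now destruct H.
Qed.

Lemma height_opr a x : height (opr a x) = x.
Proof.
  apply iota_eq; [eauto|]. intros b (y & H). apply opr_inj in H. now destruct H.
Qed.

Lemma base_dfun1 : dfun1 base.
Proof. unfold base. dsolve. Qed.
Lemma height_dfun1 : dfun1 height.
Proof. unfold height. dsolve. Qed.
Lemma fibre_measure_dfun1 : dfun1 fibre_measure.
Proof. unfold fibre_measure. dsolve. Qed.

Lemma base_in z : z ∈ total -> base z ∈ kappa.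
Proof. intros Hz. apply in_total in Hz. destruct Hz as (a & x & Ha & _ & ->). now rewrite base_opr. Qed.

Lemma fibre_measure_ultra a : a ∈ kappa -> ultra total (fibre_measure a).
Proof.
  intros Ha.
  assert (forall x, x ∈ ap m a -> opr a x ∈ total) as HT.
  { intros x Hx. apply in_total. eauto. }
  apply (ultra_limit (ap m a) (ap wm a) total (fun x X => opr a x ∈ X) (wm_ultra a Ha)).
  - dsolve.
  - intros x X Y Hx H HXY _. auto.
  - auto.
  - intros x X Hx _ H. eauto.
  - intros x c Hx H. apply in_sep; [dsolve|]. split; auto. intros n Hn. now apply H.
  - intros x X Hx HX. destruct (classic (opr a x ∈ X)); auto. right.
    apply in_sep; [dsolve|auto].
Qed.

Lemma ae_fibre a P : a ∈ kappa -> dpr1 P ->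
  ae (fibre_measure a) P <-> ae (ap wm a) (fun x => P (opr a x)).
Proof.
  intros Ha HP. pose proof (proj1 (wm_ultra a Ha)) as HF.
  rewrite (ae_sep total _ (proj1 (fibre_measure_ultra a Ha))) by auto.
  unfold fibre_measure. rewrite in_sep by dsolve. rewrite in_pow. split.
  - intros [_ H]. revert H. apply (ae_mono _ _ HF). intros x Hx H. apply in_sep in H; tauto.
  - intros H. split; [intros x Hx; apply in_sep in Hx; tauto|].
    revert H. apply (ae_mono _ _ HF). intros x Hx H. apply in_sep; auto. split; auto.
    apply in_total. eauto.
Qed.

Lemma total_measure_ultra : ultra total total_measure.
Proof.
  pose proof fibre_measure_dfun1 as HW.
  apply (ultra_limit kappa U total (fun a X => X ∈ fibre_measure a) HUu).
  - dsolve.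
  - intros a X Y Ha H HXY HY.
    destruct (fibre_measure_ultra a Ha) as [(_ & F2 & _) _]. eauto.
  - intros a Ha. apply (proj1 (fibre_measure_ultra a Ha)).
  - intros a X Ha _ HX. now apply (proj1 (fibre_measure_ultra a Ha)).
  - intros a c Ha H. pose proof (proj1 (fibre_measure_ultra a Ha)) as HF.
    apply (ae_sep _ _ HF); [dsolve|].
    apply (ae_omega _ _ HF (fun n x => x ∈ ap c n)); [dsolve|].
    intros n Hn. exists (ap c n). split; auto. now apply H.
  - intros a X Ha HX. destruct (fibre_measure_ultra a Ha) as [HF HD].
    destruct (HD X HX) as [H|H]; auto. right. apply (ae_sep _ _ HF); [dsolve|]. exact H.
Qed.

Lemma ae_total P : dpr1 P -> ae total_measure P <-> ae U (fun a => ae (fibre_measure a) P).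
Proof.
  intros HP. pose proof fibre_measure_dfun1 as HW.
  rewrite (ae_sep total _ (proj1 total_measure_ultra)) by auto.
  unfold total_measure. rewrite in_sep by dsolve. rewrite in_pow. split.
  - intros [_ H]. revert H. apply (ae_mono _ _ HUf). intros a Ha.
    now apply (ae_sep total _ (proj1 (fibre_measure_ultra a Ha))).
  - intros H. split; [intros x Hx; apply in_sep in Hx; tauto|].
    revert H. apply (ae_mono _ _ HUf). intros a Ha.
    now apply (ae_sep total _ (proj1 (fibre_measure_ultra a Ha))).
Qed.

Lemma fibre_base a : a ∈ kappa -> ae (fibre_measure a) (fun w => base w = a).
Proof.
  intros Ha. pose proof base_dfun1. apply ae_fibre; [auto|dsolve|].
  apply (ae_all _ _ (proj1 (wm_ultra a Ha))). intros x _. apply base_opr.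
Qed.

(** The measure of the fibre over [a] concentrates on points of base [a], so drawing from the fibre
    a second time changes nothing. *)
Lemma ae_total_fibres P : dpr1 P ->
  ae total_measure (fun z => ae (fibre_measure (base z)) P) <-> ae total_measure P.
Proof.
  intros HP. pose proof base_dfun1 as Hb. pose proof fibre_measure_dfun1 as HW.
  rewrite !ae_total by dsolve.
  assert (forall a, a ∈ kappa -> ae (fibre_measure a) (fun z => ae (fibre_measure (base z)) P)
    <-> ae (fibre_measure a) P) as K.
  { intros a Ha. pose proof (proj1 (fibre_measure_ultra a Ha)) as HF.
    rewrite <- (ae_const _ _ HF (ae (fibre_measure a) P)).
    split; intros H; generalize H (fibre_base a Ha); apply (ae_mono2 _ _ HF);
    intros z Hz H1 H2; rewrite H2 in *; auto. }
  split; apply (ae_mono _ _ HUf); intros a Ha; now apply K.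
Qed.

Lemma ae_iff Z W (P Q : V -> Prop) : ultra Z W -> (forall x, x ∈ Z -> P x <-> Q x) ->
  ae W P <-> ae W Q.
Proof.
  intros HW H. split; apply (ae_mono Z W (proj1 HW)); intros x Hx; now apply H.
Qed.

Lemma ae_iff_ae Z W (P Q R : V -> Prop) : ultra Z W -> ae W R ->
  (forall x, x ∈ Z -> R x -> P x <-> Q x) -> ae W P <-> ae W Q.
Proof.
  intros HW HR H. split; intros G; generalize HR G; apply (ae_mono2 Z W (proj1 HW));
  intros x Hx Rx; now apply H.
Qed.

Lemma fibres_commute a b Y : a ∈ kappa -> b ∈ kappa -> a <> b -> dpr2 Y ->
  ae (fibre_measure a) (fun w => ae (fibre_measure b) (fun v => Y w v)) <->
  ae (fibre_measure b) (fun v => ae (fibre_measure a) (fun w => Y w v)).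
Proof.
  intros Ha Hb N HY. pose proof fibre_measure_dfun1 as HW.
  rewrite (ae_fibre a), (ae_fibre b) by (auto; dsolve).
  rewrite (ae_iff _ _ _ (fun x => ae (ap wm b) (fun y => Y (opr a x) (opr b y))) (wm_ultra a Ha))
    by (intros x Hx; apply ae_fibre; [auto|dsolve]).
  rewrite (ae_iff _ _ (fun y => ae (fibre_measure a) (fun w => Y w (opr b y)))
    (fun y => ae (ap wm a) (fun x => Y (opr a x) (opr b y))) (wm_ultra b Hb))
    by (intros x Hx; apply (ae_fibre a (fun w => Y w (opr b x))); [auto|dsolve]).
  destruct (Hm a Ha) as (Oa & Wa & _), (Hm b Hb) as (Ob & Wb & _).
  destruct (ordinal_trichotomy _ Oa _ Ob) as [H|[H|H]].
  - apply (measures_commute (ap m a) (ap wm a) (ap m b) (ap wm b)) with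
      (Y := fun x y => Y (opr a x) (opr b y)); auto. dsolve.
  - exfalso. auto.
  - symmetry. apply (measures_commute (ap m b) (ap wm b) (ap m a) (ap wm a)) with
      (Y := fun y x => Y (opr a x) (opr b y)); auto. dsolve.
Qed.

(** The fibre measure passes [U] because kappa lies below mu_a, and then each fibre measure over b
    <> a. The fibre b = a is negligible because [U] is nonprincipal. *)
Lemma fibre_total_commute z Y : z ∈ total -> dpr2 Y ->
  ae (fibre_measure (base z)) (fun w => ae total_measure (fun v => Y w v)) <->
  ae total_measure (fun v => ae (fibre_measure (base z)) (fun w => Y w v)).
Proof.
  intros Hz HY. pose proof fibre_measure_dfun1 as HW.
  pose proof (base_in z Hz) as Ha. set (a := base z) in *.
  rewrite (ae_total (fun v => ae (fibre_measure a) (fun w => Y w v))) by dsolve.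
  rewrite (ae_iff total _ _ (fun w => ae U (fun b => ae (fibre_measure b) (fun v => Y w v)))
    (fibre_measure_ultra a Ha)) by (intros w Hw; apply ae_total; dsolve).
  rewrite (ae_fibre a) by (auto; dsolve).
  destruct (Hm a Ha) as (Oa & Wa & Ka).
  rewrite <- (measures_commute kappa U (ap m a) (ap wm a) Hkappa Wa HU (Hwm a Ha) Ka
    (fun b x => ae (fibre_measure b) (fun v => Y (opr a x) v))) by dsolve.
  apply (ae_iff_ae kappa U _ _ (fun b => b <> a) HUu).
  - now apply (measure_nonprincipal kappa U).
  - intros b Hb N. rewrite <- fibres_commute by auto.
    symmetry. apply (ae_fibre a (fun w => ae (fibre_measure b) (fun v => Y w v))); [auto|dsolve].
Qed.

Lemma ae_total_base z : z ∈ total -> ae total_measure (fun v => base v <> base z).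
Proof.
  intros Hz. pose proof base_dfun1 as Hb. pose proof (base_in z Hz) as Ha.
  apply ae_total; [dsolve|].
  generalize (measure_nonprincipal kappa U Hkappa HU (base z) Ha). apply (ae_mono _ _ HUf).
  intros b Hbk N. generalize (fibre_base b Hbk).
  apply (ae_mono _ _ (proj1 (fibre_measure_ultra b Hbk))). congruence.
Qed.

(** A function avoiding each value in [t] almost everywhere would, by completeness of the measure on
    mu_a, avoid all of them at once. *)
Lemma fibre_constant_below a t : a ∈ kappa -> t ∈ ap m a ->
  constant_below total (fibre_measure a) t.
Proof.
  intros Ha Ht g Hg H. pose proof (fibre_measure_ultra a Ha) as HF.
  apply NNPP. intros N.
  assert (forall b, b ∈ t -> ae (fibre_measure a) (fun x => ap g x <> b)) as K.
  { intros b Hb. destruct (ultra_dec _ _ (fun x => ap g x = b) HF) as [G|G]; [dsolve| |exact G].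
    exfalso. eauto. }
  rewrite ae_fibre in H by (auto; dsolve).
  assert (ae (ap wm a) (fun x => forall b, b ∈ t -> ap g (opr a x) <> b)) as L.
  { apply (measure_complete (ap m a) (ap wm a)) with (P := fun b x => ap g (opr a x) <> b).
    - now apply Hm.
    - auto.
    - exact Ht.
    - dsolve.
    - intros b Hb. apply (ae_fibre a (fun w => ap g w <> b)); [auto|dsolve|]. auto. }
  apply (ae_contra _ _ (proj1 (wm_ultra a Ha)) _ H). revert L.
  apply (ae_mono _ _ (proj1 (wm_ultra a Ha))). intros x _ G1 G2. exact (G1 _ G2 eq_refl).
Qed.

(** The smaller cardinal mu_a is the critical point of the first embedding, as witnessed by
    [height], and lies below that of the second, which fixes it. Equal ultrapowers would force the
    embeddings to agree on it by [emb_unique]. *)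
Lemma fibre_ultrapowers_distinct_lt a b : a ∈ kappa -> b ∈ kappa -> ap m a ∈ ap m b ->
  ~ forall y, ult total (fibre_measure a) y <-> ult total (fibre_measure b) y.
Proof.
  intros Ha Hb H HE. destruct (Hm a Ha) as (Oa & _ & _), (Hm b Hb) as (Ob & _ & _).
  pose proof (fibre_measure_ultra a Ha) as Fa. pose proof (fibre_measure_ultra b Hb) as Fb.
  pose proof height_dfun1 as Hh.
  pose proof (emb_unique _ _ _ _ _ _ (ap m a) (ultra_good _ _ Fa) (ultra_good _ _ Fb) HE Oa) as E.
  rewrite (emb_fixed_top total (fibre_measure b) (ap m a) Fb (proj1 Oa)) in E.
  - revert E. apply (emb_moved _ _ _ (lam total height) Fa (proj1 Oa)).
    + intros t Ht. now apply fibre_constant_below.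
    + now apply lam_function.
    + apply ae_fibre; [auto|dsolve|]. apply (ae_all _ _ (proj1 (wm_ultra a Ha))). intros x Hx.
      rewrite ap_lam by (auto; apply in_total; eauto). now rewrite height_opr.
    + intros t Ht K. apply ae_fibre in K; [|auto|dsolve].
      apply (ae_contra _ _ (proj1 (wm_ultra a Ha)) _ K).
      assert (omega ∈ ap m a) as Ha' by now apply Hm.
      generalize (measure_nonprincipal _ _ Ha' (Hwm a Ha) t Ht).
      apply (ae_mono _ _ (proj1 (wm_ultra a Ha))). intros x Hx N G. apply N.
      rewrite ap_lam in G by (auto; apply in_total; eauto). now rewrite height_opr in G.
  - intros t Ht. apply fibre_constant_below; auto. now apply (proj1 Ob (ap m a)).
  - now apply fibre_constant_below.
Qed.

Lemma fibre_ultrapowers_distinct z v : z ∈ total -> v ∈ total -> base z <> base v ->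
  exists y, ~ (ult total (fibre_measure (base z)) y <-> ult total (fibre_measure (base v)) y).
Proof.
  intros Hz Hv N. pose proof (base_in z Hz) as Ha. pose proof (base_in v Hv) as Hb.
  apply NNPP. intros M.
  assert (forall y, ult total (fibre_measure (base z)) y <-> ult total (fibre_measure (base v)) y)
    as K by (intros y; apply NNPP; eauto).
  destruct (ordinal_trichotomy _ (proj1 (Hm _ Ha)) _ (proj1 (Hm _ Hb))) as [H|[H|H]].
  - exact (fibre_ultrapowers_distinct_lt _ _ Ha Hb H K).
  - auto.
  - apply (fibre_ultrapowers_distinct_lt _ _ Hb Ha H). intros y. symmetry. apply K.
Qed.

End FromMeasurables.
End Measures.

Theorem theorem11 (V : set_structure) (HV : ZFC V)
  (kappa : V) (Hkappa : measurable kappa)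
  (mu : V) (Hmu_seq : function_on mu kappa) (Hmu_inj : injective mu)
  (Hmu : forall i m : V, app mu i m -> measurable m /\ kappa ∈ m)
  (nu : V) (Hnu : infinite_cardinal nu) :
  exists M : V -> V -> Prop,
    definable2 M /\
    (forall i, i ∈ nu ->
      transitive_class (M i) /\ well_founded_class (M i) /\
      same_theory (M i) universe) /\
    (forall i j, i ∈ nu -> j ∈ nu -> i <> j -> ~ (forall x, M i x <-> M j x)) /\
    (forall i j, i ∈ nu -> j ∈ nu -> i <> j -> mutually_embeddable (M i) (M j)).
Proof.
  destruct Hkappa as [Hunc (U & HU)]. change (measure kappa U) in HU.
  pose proof (omega_in_uncountable kappa Hunc) as Hw.
  assert (forall a, a ∈ kappa -> measurable (ap mu a) /\ kappa ∈ ap mu a) as Hmu'.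
  { intros a Ha. apply (Hmu a). now apply (app_ap mu kappa). }
  assert (dpr2 (fun a W => measure (ap mu a) W)) as Hdef.
  { intros t s Ht Hs. apply dfn_measure; dsolve. }
  (* The measures must be chosen inside V, as one set: averaging them over kappa refers to the whole
     family. *)
  destruct (selection kappa (fun a W => measure (ap mu a) W) Hdef) as (wm & _ & Hwm & _).
  assert (forall a, a ∈ kappa -> measure (ap mu a) (ap wm a)) as Hwm'.
  { intros a Ha. apply Hwm; auto. destruct (Hmu' a Ha) as [[_ (W & HW)] _]. now exists W. }
  assert (forall a, a ∈ kappa -> ordinal (ap mu a) /\ omega ∈ ap mu a /\ kappa ∈ ap mu a) as Hm.
  { intros a Ha. destruct (Hmu' a Ha) as [[Hu _] Hk]. split; [apply Hu|]. split; auto.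
    now apply omega_in_uncountable. }
  assert (forall a b, a ∈ kappa -> b ∈ kappa -> ap mu a = ap mu b -> a = b) as Hinj.
  { intros a b Ha Hb E. apply (Hmu_inj a b (ap mu b)).
    - rewrite <- E. now apply (app_ap mu kappa).
    - now apply (app_ap mu kappa). }
  assert (ordinal nu) as Hnuo by apply Hnu.
  pose proof (infinite_cardinal_limit nu Hnu) as Hlim.
  pose proof (total_measure_ultra kappa U mu wm Hw HU Hm Hwm') as HD.
  set (Z := total kappa mu) in *. set (D := total_measure kappa U mu wm) in *.
  exists (model nu Z D base). split; [|split; [|split]].
  - apply definable_2. unfold model. intros t s Ht Hs. dsolve.
    apply dft_traces; [exact base_dfun1|dsolve].
  - intros i Hi. pose proof (iterate_good nu Z D base Hnuo HD base_dfun1 (upr i i)) as HG.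
    split; [|split].
    + exact (uclass_transitive _ _ _ HG).
    + exact (uclass_well_founded _ _ _).
    + exact (uclass_theory _ _ _ HG).
  - intros i j Hi Hj N.
    apply (models_distinct nu Z D base Hnuo HD base_dfun1 (fibre_measure kappa mu wm)); auto.
    + exact (fibre_measure_dfun1 kappa mu wm).
    + intros z Hz. apply (fibre_measure_ultra kappa mu wm); auto. now apply (base_in kappa mu).
    + intros z Hz. apply (fibre_base kappa mu wm); auto. now apply (base_in kappa mu).
    + exact (ae_total_fibres kappa U mu wm Hw HU Hm Hwm').
    + exact (fibre_total_commute kappa U mu wm Hw HU Hm Hinj Hwm').
    + exact (ae_total_base kappa U mu wm Hw HU Hm Hwm').
    + exact (fibre_ultrapowers_distinct kappa mu wm Hm Hinj Hwm').
  - intros i j Hi Hj N. split.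
    + exact (model_embedding nu Z D base Hnuo HD base_dfun1 Hlim i j Hj).
    + exact (model_embedding nu Z D base Hnuo HD base_dfun1 Hlim j i Hi).
Qed.
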